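(* In the operator setting, if $A\in\mathcal{B}(L(\mathcal{X},\mathcal{Y}))$ is invertible with inverse $B\in L(\mathcal{Y},\mathcal{X})$, then $B\in\mathcal{B}(L(\mathcal{Y},\mathcal{X}))$.
   Context: $|k|_\infty=\max_j|k_j|$. Fourier transform $\hat f(\lambda)=\int f(t)e^{-it\cdot\lambda}dt$. A Banach $L^1(\mathbb{R}^d)$-module structure on a Banach space $\mathcal{M}$ associated with a representation $\mathcal{T}:\mathbb{R}^d\to B(\mathcal{M})$ by invertible isometries is a bilinear map $(f,x)\mapsto fx$ with $(f*g)x=f(gx)$, $\|fx\|\le\|f\|_1\|x\|$, $\mathcal{T}(t)(fx)=(f(\cdot+t))x=f(\mathcal{T}(t)x)$, non-degenerate; for $\mathcal{T}$-continuous $x$, $fx=\int f(t)\mathcal{T}(-t)x\,dt$. Operator setting: $\mathcal{X},\mathcal{Y}$ complex Banach spaces; each of $L(\mathcal{X},\mathcal{Y}),L(\mathcal{Y},\mathcal{X}),B(\mathcal{X}),B(\mathcal{Y})$ carries such a module structure with representations $\mathcal{T}_{\mathcal{U}\mathcal{V}}$ satisfying $\mathcal{T}_{\mathcal{U}\mathcal{W}}(t)(BA)=(\mathcal{T}_{\mathcal{V}\mathcal{W}}(t)B)(\mathcal{T}_{\mathcal{U}\mathcal{V}}(t)A)$, and coupled: $A,B$ mutually inverse iff $\mathcal{T}_{\mathcal{X}\mathcal{Y}}(t)A$, $\mathcal{T}_{\mathcal{Y}\mathcal{X}}(t)B$ are, for all $t$. $\hat\phi(\lambda)=\max(1-|\lambda|,0)$;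 $\phi^d_{N,a}\in L^1(\mathbb{R}^d)$ has $\hat\phi^d_{N,a}(\lambda)=\prod_k\hat\phi((\lambda_k-Na_k)/N)$. Beurling class: $\|A\|_{\mathcal{B}}=\sum_{k\in\mathbb{Z}^d}\sup_{n\in\mathbb{Z}^d,\,|n|_\infty\ge|k|_\infty}\|\phi^d_{1,n}A\|$, $\mathcal{B}(L(\mathcal{U},\mathcal{V}))=\{A:\|A\|_{\mathcal{B}}<\infty\}$. *)

(* Defs.v *)
From HB Require Import structures.
From mathcomp Require Import all_boot all_order all_algebra.
From mathcomp Require Import all_classical all_reals all_analysis.
From mathcomp Require Import complex.
Import Order.TTheory GRing.Theory Num.Theory.
Import numFieldNormedType.Exports.

Set Implicit Arguments.
Unset Strict Implicit.
Unset Printing Implicit Defensive.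

Local Open Scope classical_set_scope.
Local Open Scope ring_scope.
Local Open Scope complex_scope.

Section Defs.
Variable R : realType.

Definition measurable_Rd (d : nat) (g : 'rV[R]_d -> R) : Prop :=
  forall B : set R, measurable B -> <<s (@open 'rV[R]_d) >> (g @^-1` B).

(** Lebesgue integral over R^d of an extended-real function, defined as the
    iterated one-dimensional Lebesgue integral (R^0 is a point of mass 1).
    By Tonelli/Fubini this is the Lebesgue integral w.r.t. Lebesgue measure
    on R^d for nonnegative measurable, resp. integrable, functions. *)
Fixpoint intRd (d : nat) : ('rV[R]_d -> \bar R) -> \bar R :=
  match d return ('rV[R]_d -> \bar R) -> \bar R with
  | 0 => fun f => f 0
  | d'.+1 => fun f =>
      (\int[@lebesgue_measure R]_(s in setT)
         intRd (fun v : 'rV[R]_d' => f (row_mx (const_mx s : 'rV[R]_1) v)))%E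
  end.

Definition RintRd (d : nat) (g : 'rV[R]_d -> R) : R :=
  fine (intRd (fun t => (g t)%:E)).

Definition cintRd (d : nat) (f : 'rV[R]_d -> R[i]) : R[i] :=
  (RintRd (fun t => complex.Re (f t))) +i* (RintRd (fun t => complex.Im (f t))).

Definition L1 (d : nat) (f : 'rV[R]_d -> R[i]) : Prop :=
  [/\ measurable_Rd (fun t => complex.Re (f t)),
      measurable_Rd (fun t => complex.Im (f t)) &
      (intRd (fun t => (complex.Re `|f t|)%:E) < +oo)%E].

Definition L1norm (d : nat) (f : 'rV[R]_d -> R[i]) : R :=
  RintRd (fun t => complex.Re `|f t|).

Definition conv (d : nat) (f g : 'rV[R]_d -> R[i]) : 'rV[R]_d -> R[i] :=
  fun t => cintRd (fun s => f s * g (t - s)).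

Definition shift (d : nat) (f : 'rV[R]_d -> R[i]) (t : 'rV[R]_d) :=
  fun s => f (s + t).

Definition is_bounded_linear (U V : completeNormedModType R[i]) (A : U -> V)
  : Prop :=
  (forall (a : R[i]) (u w : U), A (a *: u + w) = a *: A u + A w) /\
  exists M : R, forall u : U, `|A u| <= M%:C * `|u|.

Definition opnorm (U V : completeNormedModType R[i]) (A : U -> V) : R :=
  sup [set complex.Re `|A u| | u in [set u : U | complex.Re `|u| <= 1]].

Definition opzero (U V : completeNormedModType R[i]) : U -> V := fun _ => 0.
Definition opadd (U V : completeNormedModType R[i]) (A B : U -> V) : U -> V :=
  fun u => A u + B u.
Definition opscale (U V : completeNormedModType R[i]) (a : R[i]) (A : U -> V)
  : U -> V := fun u => a *: A u.

Definition is_functional (V : completeNormedModType R[i]) (ys : V -> R[i])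
  : Prop :=
  (forall (a : R[i]) (u w : V), ys (a *: u + w) = a * ys u + ys w) /\
  (forall (u0 : V) (eps : R), 0 < eps -> exists2 delta : R, 0 < delta &
     forall u : V, complex.Re `|u - u0| < delta ->
       complex.Re `|ys u - ys u0| < eps).

Definition is_isometric_rep (d : nat) (U V : completeNormedModType R[i])
  (T : 'rV[R]_d -> (U -> V) -> (U -> V)) : Prop :=
  [/\ forall t A, is_bounded_linear A -> is_bounded_linear (T t A),
      forall t a A B, is_bounded_linear A -> is_bounded_linear B ->
        T t (opadd (opscale a A) B) = opadd (opscale a (T t A)) (T t B),
      forall t A, is_bounded_linear A -> opnorm (T t A) = opnorm A,
      forall A, is_bounded_linear A -> T 0 A = A &
      forall s t A, is_bounded_linear A -> T (s + t) A = T s (T t A)].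

Definition T_continuous (d : nat) (U V : completeNormedModType R[i])
  (T : 'rV[R]_d -> (U -> V) -> (U -> V)) (A : U -> V) : Prop :=
  forall (t0 : 'rV[R]_d) (eps : R), 0 < eps -> exists2 delta : R, 0 < delta &
    forall t : 'rV[R]_d, `|t - t0| < delta ->
      opnorm (fun u => T t A u - T t0 A u) < eps.

Record is_L1_module (d : nat) (U V : completeNormedModType R[i])
  (T : 'rV[R]_d -> (U -> V) -> (U -> V))
  (act : ('rV[R]_d -> R[i]) -> (U -> V) -> (U -> V)) : Prop := {
  mod_closed : forall f A, L1 f -> is_bounded_linear A ->
    is_bounded_linear (act f A);
  mod_linl : forall (a : R[i]) f g A, L1 f -> L1 g -> is_bounded_linear A ->
    act (fun t => a * f t + g t) A = opadd (opscale a (act f A)) (act g A);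
  mod_linr : forall (a : R[i]) f A B, L1 f -> is_bounded_linear A ->
    is_bounded_linear B ->
    act f (opadd (opscale a A) B) = opadd (opscale a (act f A)) (act f B);
  mod_conv : forall f g A, L1 f -> L1 g -> is_bounded_linear A ->
    act (conv f g) A = act f (act g A);
  mod_norm : forall f A, L1 f -> is_bounded_linear A ->
    opnorm (act f A) <= L1norm f * opnorm A;
  mod_shift : forall f A t, L1 f -> is_bounded_linear A ->
    T t (act f A) = act (shift f t) A;
  mod_shift' : forall f A t, L1 f -> is_bounded_linear A ->
    T t (act f A) = act f (T t A);
  mod_nondeg : forall A, is_bounded_linear A ->
    (forall f, L1 f -> act f A = @opzero U V) -> A = @opzero U V;
  (* for T-continuous A, fA = int f(t) T(-t)A dt (Bochner integral in
     L(U,V)), stated through its evaluations tested against functionals *)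
  mod_integral : forall f A, L1 f -> is_bounded_linear A -> T_continuous T A ->
    forall (u : U) (ys : V -> R[i]), is_functional ys ->
      ys (act f A u) = cintRd (fun t => f t * ys (T (- t) A u))
}.

(** phi with hat phi(l) = max(1 - |l|, 0): phi(s) = (1 - cos s)/(pi s^2). *)
Definition fejer (s : R) : R :=
  if s == 0 then (2 * pi)^-1 else (1 - cos s) / (pi * s ^+ 2).

Definition expi (x : R) : R[i] := cos x +i* sin x.

(** phi^d_{1,n}(t) = prod_k phi(t_k) e^{i n_k t_k}, so that
    hat phi^d_{1,n}(l) = prod_k hat phi(l_k - n_k). *)
Definition phi1 (d : nat) (n : 'rV[int]_d) : 'rV[R]_d -> R[i] :=
  fun t => \prod_(k < d)
    ((fejer (t ord0 k))%:C * expi ((n ord0 k)%:~R * t ord0 k)).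

Definition ninf (d : nat) (k : 'rV[int]_d) : nat :=
  \max_(j < d) `|k ord0 j|%N.

Definition beurling_norm (d : nat) (U V : completeNormedModType R[i])
  (act : ('rV[R]_d -> R[i]) -> (U -> V) -> (U -> V)) (A : U -> V) : \bar R :=
  (\esum_(k in [set: 'rV[int]_d])
     ereal_sup [set (opnorm (act (phi1 n) A))%:E |
                n in [set n : 'rV[int]_d | (ninf k <= ninf n)%N]])%E.

Definition in_beurling (d : nat) (U V : completeNormedModType R[i])
  (act : ('rV[R]_d -> R[i]) -> (U -> V) -> (U -> V)) (A : U -> V) : Prop :=
  is_bounded_linear A /\ (beurling_norm act A < +oo)%E.

Definition rep_mult (d : nat) (U V W : completeNormedModType R[i])
  (TUV : 'rV[R]_d -> (U -> V) -> (U -> V))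
  (TVW : 'rV[R]_d -> (V -> W) -> (V -> W))
  (TUW : 'rV[R]_d -> (U -> W) -> (U -> W)) : Prop :=
  forall t (A : U -> V) (B : V -> W),
    is_bounded_linear A -> is_bounded_linear B ->
    TUW t (fun u => B (A u)) = (fun u => TVW t B (TUV t A u)).

Definition mutually_inverse (U V : completeNormedModType R[i])
  (A : U -> V) (B : V -> U) : Prop :=
  (forall v, A (B v) = v) /\ (forall u, B (A u) = u).

Definition rep_coupled (d : nat) (X Y : completeNormedModType R[i])
  (TXY : 'rV[R]_d -> (X -> Y) -> (X -> Y))
  (TYX : 'rV[R]_d -> (Y -> X) -> (Y -> X)) : Prop :=
  forall (A : X -> Y) (B : Y -> X),
    is_bounded_linear A -> is_bounded_linear B ->
    (mutually_inverse A B <-> forall t, mutually_inverse (TXY t A) (TYX t B)).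

End Defs.

(* Main.v *)
(** Beurling-class operators are limits of their Fejer sums, hence
    [T]-continuous, and so is the inverse [B].  An operator localised at frequency
    [m] satisfies [||(z T(h e_j) - 1)^k A|| <= K (8 h)^k] with [z = e^{-i m_j h}];
    these bounds multiply under composition, so that [phi_n ((phi_m A) (phi_l B))]
    vanishes when [n] is far from [m + l], without any spectral theory.

    Let [G_j] be the Fejer window of width [N] centred at [N j] and
    [beta_j = ||G_j B||].  From [A B = 1],
    [A (G_j B) = G_j 1 - (G_j (A B) - A (G_j B))].  Expand the commutator over
    the pieces [phi_m A] and [G_i B].  For [|m| <= M] it is small because
    [phi_m A] is [T]-continuous and the windows of width [N] concentrate at the
    origin; for [|m| > M] the norms [||phi_m A||] have a small sum.  By the vanishing
    property only [i] near [j] or near [j - m / N] contribute, so [beta] is dominated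
    by a finitely supported sequence plus its convolution with a kernel of small
    sum and of Beurling class, which forces [beta] itself into that class. *)

Require Import Defs.
From HB Require Import structures.
From mathcomp Require Import all_boot all_order all_algebra.
From mathcomp Require Import all_classical all_reals all_analysis.
From mathcomp Require Import complex measurable_realfun.
From mathcomp Require Import zify ring lra.
Import Order.TTheory GRing.Theory Num.Theory.
Import numFieldNormedType.Exports.
Set Implicit Arguments.
Unset Strict Implicit.
Unset Printing Implicit Defensive.
Local Open Scope classical_set_scope.
Local Open Scope ring_scope.
Local Open Scope complex_scope.

(** * Lebesgue measure on R^d *)

Section Rd_measure.
Context {R : realType}.

(** The module action is tied to an integral only on [T]-continuous operators, and there only
    through functionals. Commutator estimates therefore require [T]-continuity first and pass
    through norming functionals. The frequency bounds, needed for all operators, come instead from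
    the axiom that [T t (f A)] is the action of a translate of [f].

    Unit windows would not do for the inverse: a commutator is small only when the window
    concentrates where [T t A] is close to [A], and this forces a large width [N]. The cost must not
    grow with [N]. Centres are therefore counted in units of [N], so that the windows which interact
    lie in a box of fixed radius 67. The constants can then be chosen in the order [tau] (tail of
    [A]), [M] (cut-off), [eps] (which must beat the number of pieces in the box of radius [M]), and
    finally [N].

    The integral of [phi] stays symbolic as [fejer_mass]: wide windows at the origin tend to
    [fejer_mass ^+ d] times the identity, and powers of this constant are divided out at the end. *)

Definition Rd (d : nat) := g_sigma_algebraType (@open 'rV[R]_d).

Definition consV (d : nat) (p : R * 'rV[R]_d) : 'rV[R]_d.+1 :=
  row_mx (const_mx p.1 : 'rV[R]_1) p.2.

Definition unconsV (d : nat) (t : 'rV[R]_d.+1) : R * 'rV[R]_d :=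
  (t ord0 ord0, \row_j t ord0 (lift ord0 j)).

Lemma consV0 d (s : R) (v : 'rV[R]_d) : consV (s, v) ord0 ord0 = s.
Proof.
have -> : ord0 = lshift d (ord0 : 'I_1) by apply: val_inj.
by rewrite /consV; apply: (etrans (row_mxEl _ _ _ _)); rewrite mxE.
Qed.

Lemma consVS d (s : R) (v : 'rV[R]_d) j : consV (s, v) ord0 (lift ord0 j) = v ord0 j.
Proof.
have -> : lift ord0 j = rshift 1 j by apply: val_inj.
by rewrite /consV; exact: row_mxEr.
Qed.

Lemma consVK d : cancel (@consV d) (@unconsV d).
Proof.
move=> [s v]; rewrite /unconsV consV0; congr pair.
by apply/rowP => j; rewrite mxE consVS.
Qed.

Lemma ball_consV d (t : 'rV[R]_d.+1) (e : R) s v :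
  ball (t ord0 ord0) e s -> ball (\row_j t ord0 (lift ord0 j)) e v ->
  0 < e -> ball t e (consV (s, v)).
Proof.
move=> bs bv e0; split => // i j; rewrite (ord1 i).
have [j' ->|->] := unliftP ord0 j; last by rewrite consV0.
by rewrite consVS; case: bv => _ /(_ ord0 j'); rewrite mxE.
Qed.

Lemma measurable_fun_openP (dT : measure_display) (T : measurableType dT) d
    (f : T -> 'rV[R]_d) :
  (forall U : set 'rV[R]_d, open U -> measurable (f @^-1` U)) ->
  measurable_fun setT (f : T -> Rd d).
Proof.
move=> mf _ Y mY; rewrite setTI; move: Y mY; apply: smallest_sub => //; split.
- by rewrite /= preimage_set0.
- by move=> Y /= mY; rewrite setTD preimage_setC; exact: measurableC.
- by move=> F /= mF; rewrite preimage_bigcup; exact: bigcupT_measurable.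
Qed.

(** Borel sets of the larger space must come from the product sigma-algebra. Only the real factor
    needs a countable base: for each rational ball in it, take the union of all open sets of the
    other factor whose product with the ball lands in [U]. *)
Lemma measurable_consV d :
  measurable_fun setT (@consV d : measurableTypeR R * Rd d -> Rd d.+1).
Proof.
apply: measurable_fun_openP => U oU.
pose V (q : rat) (n : nat) : set 'rV[R]_d :=
  \bigcup_(O in [set O | open O /\
     forall s v, ball (ratr q : R) (n.+1%:R^-1) s -> O v -> U (consV (s, v))]) O.
have -> : @consV d @^-1` U = \bigcup_q \bigcup_n
    (ball (ratr q : R) (n.+1%:R^-1) `*` V q n).
  apply/seteqP; split; last first.
    by move=> [s v] [q _ [n _ [/= bs]]]; case=> O [oO HO] Ov; exact: HO.
  move=> [s v] /= Usv.
  have /nbhs_ballP[e /= e0 He] : nbhs (consV (s, v)) U by exact: open_nbhs_nbhs.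
  have [n nP] : exists n : nat, n.+1%:R^-1 < e / 2.
    have [n Hn] := ltr_add_invr (divr_gt0 e0 (ltr0n R 2)).
    by exists n; move: Hn; rewrite add0r.
  have n0 : (0 : R) < n.+1%:R^-1 by rewrite invr_gt0.
  have [q /andP[q1 q2]] : exists q, (s - n.+1%:R^-1 < ratr q < s + n.+1%:R^-1).
    have [|q] := @rat_in_itvoo R (s - n.+1%:R^-1) (s + n.+1%:R^-1).
      by rewrite ltrBlDr -addrA ltrDl addr_gt0.
    by rewrite in_itv /= => ?; exists q.
  exists q => //; exists n => //; split => /=.
    move: q1 q2; rewrite /ball /= ltr_distlC; move: (n.+1%:R^-1) => r q1 q2.
    by apply/andP; split; lra.
  exists (ball v e)°; last first.
    by apply: nbhs_singleton; apply: nbhs_interior; exact: nbhsx_ballx.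
  split; first exact: open_interior.
  move=> s' v' bs' /interior_subset bv'; apply: He; apply: ball_consV => //.
    rewrite consV0; move: bs' nP q1 q2; rewrite /ball /= !ltr_distlC.
    move: (n.+1%:R^-1) => r /andP[? ?] ? ? ?; by apply/andP; split; lra.
  by under eq_mx do rewrite consVS; rewrite (_ : \row_j _ = v)//;
    apply/rowP => j; rewrite mxE.
apply: bigcupT_measurable_rat => q.
apply: bigcupT_measurable => n; apply: measurableX.
  by apply: open_measurable; exact: ball_open.
by apply: sub_sigma_algebra; apply: bigcup_open => O [].
Qed.

Lemma measurable_RdE d (f : 'rV[R]_d -> R) :
  measurable_Rd f <-> measurable_fun setT (f : Rd d -> R).
Proof.
split=> [mf _ B mB|mf B mB]; first by rewrite setTI; exact: mf.
by have := mf measurableT B mB; rewrite setTI.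
Qed.

Lemma continuous_measurable_Rd d (f : 'rV[R]_d -> R) :
  continuous f -> measurable_fun setT (f : Rd d -> R).
Proof.
move=> /continuousP cf; apply: (measurability _ (RGenOpens.measurableE R)).
move=> _ [_ [a [b ->] <-]]; rewrite setTI.
by apply: sub_sigma_algebra; apply: cf; exact: interval_open.
Qed.

Lemma measurable_unconsV d :
  measurable_fun setT (@unconsV d : Rd d.+1 -> measurableTypeR R * Rd d).
Proof.
apply/measurable_fun_pairP; split.
  by apply: continuous_measurable_Rd; exact: coord_continuous.
apply: measurable_fun_openP => U oU; apply: sub_sigma_algebra.
move: oU; rewrite !openE => oU t /oU /nbhs_ballP[e /= e0 He].
apply/nbhs_ballP; exists e => //= t' [_ bt]; apply: He; split => // i j.
by rewrite (ord1 i) !mxE; exact: bt.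
Qed.

Local Open Scope ereal_scope.

Definition mu_step d (m : {sigma_finite_measure set (Rd d) -> \bar R}) :=
  pushforward (@lebesgue_measure R \x m) (@consV d : _ -> Rd d.+1).

Section step.
Variables (d : nat) (m : {sigma_finite_measure set (Rd d) -> \bar R}).

Let mstep : {measure set (Rd d.+1) -> \bar R} :=
  measure_function_pushforward__canonical__measure_function_Measure
    (@lebesgue_measure R \x m)%E (@measurable_consV d).

(** Carried along with the measure because Tonelli's theorem in the next dimension requires it. *)
Lemma mu_step_sigma_finite : sigma_finite setT mstep.
Proof.
have /sigma_finiteP[F [TF ndF Foo]] := sigma_finiteT (@lebesgue_measure R).
have /sigma_finiteP[G [TG ndG Goo]] := sigma_finiteT m.
exists (fun n => @unconsV d @^-1` (F n `*` G n)).
  rewrite -preimage_bigcup (_ : \bigcup_i _ = setT) ?preimage_setT //.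
  rewrite -setXTT TF TG predeqE => -[x y]; split.
    by move=> [n _ []/= ? ?]; split; exists n.
  move=> [/= [n _ Fnx] [k _ Gky]]; exists (maxn n k) => //; split.
    by move: x Fnx; exact/subsetPset/ndF/leq_maxl.
  by move: y Gky; exact/subsetPset/ndG/leq_maxr.
move=> n; have [mF lF] := Foo n; have [mG lG] := Goo n.
have mX := measurableX mF mG; split.
  by rewrite -[X in measurable X]setTI; exact: measurable_unconsV.
rewrite /mstep /= /pushforward -comp_preimage (_ : _ \o _ = id); last first.
  by apply/funext => x /=; rewrite consVK.
by rewrite preimage_id product_measure1E// lte_mul_pinfty// ge0_fin_numE.
Qed.

HB.instance Definition _ := Measure.copy (mu_step m) mstep.
HB.instance Definition _ := Measure_isSigmaFinite.Build _ _ _ (mu_step m)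
  mu_step_sigma_finite.

End step.

(** Follows the recursion of [intRd], so that Tonelli and Fubini identify the iterated integral with
    the integral against a single measure, to which convergence and density theorems apply. *)
Fixpoint mu_Rd (d : nat) : {sigma_finite_measure set (Rd d) -> \bar R} :=
  match d with
  | 0 => [the {sigma_finite_measure set (Rd 0) -> \bar R} of \d_(0%R : Rd 0)]
  | d'.+1 => [the {sigma_finite_measure set (Rd d'.+1) -> \bar R} of mu_step (mu_Rd d')]
  end.

Lemma measurable_consVr d (s : R) :
  measurable_fun setT ((fun v => consV (s, v)) : Rd d -> Rd d.+1).
Proof.
apply: (measurableT_comp (@measurable_consV d)).
by apply/measurable_fun_pairP; split; [exact: measurable_cst|exact: measurable_id].
Qed.

Lemma intRd_ge0E d (f : Rd d -> \bar R) : measurable_fun setT f ->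
  (forall t, 0 <= f t) -> intRd f = \int[mu_Rd d]_t f t.
Proof.
elim: d f => [|d IH] f mf f0.
  rewrite /= integral_dirac// diracT mul1e //.
rewrite /= ge0_integral_pushforward //; last exact: measurable_consV.
rewrite preimage_setT fubini_tonelli1 //; last 2 first.
- exact: (measurableT_comp mf (@measurable_consV d)).
- by move=> x; exact: f0.
apply: eq_integral => s _; rewrite /fubini_F.
by rewrite (IH (fun v => f (consV (s, v)))) //; exact: (measurableT_comp mf (@measurable_consVr d s)).
Qed.

Lemma intRdZl_ge0 d (c : R) (f : Rd d -> \bar R) : (0 <= c)%R ->
  measurable_fun setT f -> (forall t, 0 <= f t) ->
  intRd (fun t => c%:E * f t) = c%:E * intRd f.
Proof.
move=> c0 mf f0; rewrite intRd_ge0E //.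
- by rewrite ge0_integralZl_EFin // -intRd_ge0E.
- exact: measurable_funeM.
- by move=> t; rewrite mule_ge0.
Qed.

Lemma measurable_coord d (g : R -> R) (j : 'I_d) : measurable_fun setT g ->
  measurable_fun setT ((fun t => g (t ord0 j)) : Rd d -> R).
Proof.
move=> mg; apply: (measurableT_comp mg).
by apply: continuous_measurable_Rd; exact: coord_continuous.
Qed.

Lemma measurable_prod_coord d (g : 'I_d -> R -> R) :
  (forall j, measurable_fun setT (g j)) ->
  measurable_fun setT ((fun t => \prod_(j < d) g j (t ord0 j))%R : Rd d -> R).
Proof.
by move=> mg; apply: measurable_prod => j _; exact: measurable_coord.
Qed.

Lemma intRd_prod d (g : 'I_d -> R -> R) :
  (forall j, measurable_fun setT (g j)) -> (forall j s, (0 <= g j s)%R) ->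
  (forall j, \int[@lebesgue_measure R]_s (g j s)%:E < +oo) ->
  intRd (fun t : 'rV[R]_d => (\prod_(j < d) g j (t ord0 j))%:E) =
  (\prod_(j < d) fine (\int[@lebesgue_measure R]_s (g j s)%:E))%:E.
Proof.
elim: d g => [|d IH] g mg g0 gy; first by rewrite /= !big_ord0.
have H s : intRd (fun v : 'rV[R]_d =>
      (\prod_(j < d.+1) g j ((row_mx (const_mx s : 'rV[R]_1) v : 'rV_d.+1) ord0 j))%:E) =
    (g ord0 s)%:E * (\prod_(j < d)
       fine (\int[@lebesgue_measure R]_s (g (lift ord0 j) s)%:E))%:E.
  rewrite -IH // -intRdZl_ge0 //.
  - congr intRd; apply/funext => v; rewrite -[row_mx _ _]/(consV (s, v)).
    rewrite big_ord_recl consV0 -EFinM.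
    by congr (_ * _)%:E; apply: eq_bigr => j _; rewrite consVS.
  - apply/measurable_EFinP.
    exact: (@measurable_prod_coord d (fun j => g (lift ord0 j))).
  - by move=> t; rewrite lee_fin prodr_ge0.
rewrite [LHS]/=; under eq_integral do rewrite H.
rewrite ge0_integralZr //.
- rewrite big_ord_recl EFinM fineK // ge0_fin_numE //.
  by apply: integral_ge0 => s _; rewrite lee_fin.
- by apply/measurable_EFinP; exact: mg.
- by move=> s _; rewrite lee_fin.
- by rewrite lee_fin prodr_ge0 // => j _; apply: fine_ge0; apply: integral_ge0 => s _; rewrite lee_fin.
Qed.

Local Close Scope ereal_scope.

Definition ker1 (s : R) : R := (1 + s ^+ 2)^-1.

Definition kerRd d (t : 'rV[R]_d) : R := \prod_(j < d) ker1 (t ord0 j).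

Lemma ker1_gt0 s : 0 < ker1 s.
Proof. by rewrite invr_gt0 ltr_pwDl // sqr_ge0. Qed.

Lemma ker1_ge0 s : 0 <= ker1 s. Proof. exact/ltW/ker1_gt0. Qed.

Lemma kerRd_gt0 d (t : 'rV[R]_d) : 0 < kerRd t.
Proof. by apply: prodr_gt0 => j _; exact: ker1_gt0. Qed.

Lemma kerRd_ge0 d (t : 'rV[R]_d) : 0 <= kerRd t.
Proof. exact/ltW/kerRd_gt0. Qed.

Lemma continuous_ker1 : continuous ker1.
Proof. exact: continuous_oneDsqrV. Qed.

Lemma measurable_ker1 : measurable_fun setT ker1.
Proof. exact: continuous_measurable_fun continuous_ker1. Qed.

Lemma measurable_kerRd d : measurable_fun setT (@kerRd d : Rd d -> R).
Proof. by apply: (@measurable_prod_coord d (fun=> ker1)) => j; exact: measurable_ker1. Qed.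

Lemma integral_ker1_lty : (\int[@lebesgue_measure R]_s (ker1 s)%:E < +oo)%E.
Proof.
have mk D : measurable_fun D (fun s => (ker1 s)%:E).
  by apply/measurable_EFinP; apply: measurable_funTS; exact: measurable_ker1.
have k0 s : (0 <= (ker1 s)%:E)%E by rewrite lee_fin ker1_ge0.
have Hp : (\int[@lebesgue_measure R]_(s in `[0%R, +oo[) (ker1 s)%:E = (pi / 2)%:E)%E.
  exact: integral0y_oneDsqr.
have Hn : (\int[@lebesgue_measure R]_(s in `]-oo, 0%R]) (ker1 s)%:E = (pi / 2)%:E)%E.
  rewrite -Hp ge0_integration_by_substitution0 //.
  by apply: eq_integral => s _; rewrite /ker1 sqrrN.
rewrite (_ : setT = `]-oo, 0%R[ `|` `[0%R, +oo[); last first.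
  apply/seteqP; split => // s _ /=.
  by rewrite !in_itv /= andbT; have [|] := ltP s 0; [left|right].
rewrite ge0_integral_setU //=; last 2 first.
- exact: mk.
- rewrite disj_set2E; apply/eqP; rewrite -subset0 => s [] /=.
  by rewrite !in_itv /= andbT ltNge => /negP.
rewrite Hp lte_add_pinfty ?ltry //.
apply: (@le_lt_trans _ _ (\int[@lebesgue_measure R]_(s in `]-oo, 0%R]) (ker1 s)%:E)%E).
  apply: ge0_subset_integral => //; last by move=> s /=; rewrite !in_itv /= => /ltW.
  exact: mk.
by rewrite Hn ltry.
Qed.

Definition kerRd_int d := \prod_(j < d) fine (\int[@lebesgue_measure R]_s (ker1 s)%:E)%E.

Lemma intRd_kerRd d : intRd (fun t : 'rV[R]_d => (kerRd t)%:E) = (kerRd_int d)%:E.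
Proof.
apply: (@intRd_prod d (fun=> ker1)) => // j.
- exact: measurable_ker1.
- by move=> s; exact: ker1_ge0.
- exact: integral_ker1_lty.
Qed.

Lemma kerRd_int_ge0 d : 0 <= kerRd_int d.
Proof.
by apply: prodr_ge0 => j _; apply/fine_ge0/integral_ge0 => s _; rewrite lee_fin ker1_ge0.
Qed.

Lemma integral_kerRd d : (\int[mu_Rd d]_t (kerRd t)%:E = (kerRd_int d)%:E)%E.
Proof.
rewrite -intRd_kerRd intRd_ge0E //.
- by apply/measurable_EFinP; exact: measurable_kerRd.
- by move=> t; rewrite lee_fin kerRd_ge0.
Qed.

(** Domination by [kerRd] passes to every slice, so Fubini's theorem for signed functions goes
    through by induction on [d] without exceptional null sets. The Fejer windows below satisfy
    it. *)
Definition domRd d (f : 'rV[R]_d -> R) : Prop :=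
  measurable_fun setT (f : Rd d -> R) /\ exists M, forall t, `|f t| <= M * kerRd t.

Lemma integrable_kerRd d : (mu_Rd d).-integrable setT (EFin \o @kerRd d).
Proof.
apply/integrableP; split; first by apply/measurable_EFinP; exact: measurable_kerRd.
under eq_integral => t _ do rewrite /= ger0_norm ?kerRd_ge0 //.
by rewrite integral_kerRd ltry.
Qed.

Lemma integrable_domRd d f : @domRd d f -> (mu_Rd d).-integrable setT (EFin \o f).
Proof.
move=> [mf [M fM]]; apply: (le_integrable _ _ _ (integrableZl _ M (integrable_kerRd d))) => //.
  exact/measurable_EFinP.
move=> t _ /=; rewrite lee_fin; apply: (le_trans (fM t)); exact: ler_norm.
Qed.

Lemma kerRd_consV d s (v : 'rV[R]_d) : kerRd (consV (s, v)) = ker1 s * kerRd v.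
Proof.
by rewrite /kerRd big_ord_recl consV0; congr (_ * _); apply: eq_bigr => j _; rewrite consVS.
Qed.

Lemma intRd_domE d (f : 'rV[R]_d -> R) : domRd f ->
  (intRd (fun t => (f t)%:E) = \int[mu_Rd d]_t (f t)%:E)%E.
Proof.
elim: d f => [|d IH] f df.
  have [mf _] := df.
  by rewrite /= integral_dirac// ?diracT ?mul1e//; exact/measurable_EFinP.
have [mf [M fM]] := df; have If := integrable_domRd df.
have mfc : measurable_fun setT
    ((fun p => (f (@consV d p))%:E) : measurableTypeR R * Rd d -> \bar R).
  by apply/measurable_EFinP; exact: (measurableT_comp mf (@measurable_consV d)).
have Ic : (@lebesgue_measure R \x mu_Rd d)%E.-integrable setT
    ((fun p => (f (@consV d p))%:E) : measurableTypeR R * Rd d -> \bar R).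
  move/integrableP : If => [mf' lf]; apply/integrableP; split => //.
  move: lf; rewrite /= ge0_integral_pushforward //; last 2 first.
    exact: measurable_consV.
    by apply/measurable_EFinP; exact: measurableT_comp.
rewrite [RHS](_ : _ = \int[@lebesgue_measure R \x mu_Rd d]_(x in
    @consV d @^-1` setT) (f (consV x))%:E)%E; last first.
  apply: integral_pushforward => //.
  - exact: measurable_consV.
  - by apply/measurable_EFinP.
rewrite preimage_setT -integral12_prod_meas1 //.
apply: eq_integral => s _; rewrite /fubini_F.
apply: (IH (fun v => f (consV (s, v)))); split.
  exact: (measurableT_comp mf (@measurable_consVr d s)).
by exists (M * ker1 s) => v; rewrite -mulrA -kerRd_consV.
Qed.

Lemma RintRdE d (f : 'rV[R]_d -> R) : domRd f -> RintRd f = \int[mu_Rd d]_t f t.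
Proof. by move=> df; rewrite /RintRd intRd_domE. Qed.

Lemma domRdZ d (c : R) (f : 'rV[R]_d -> R) : domRd f -> domRd (fun t => c * f t).
Proof.
move=> [mf [M fM]]; split; first by apply: measurable_funM.
by exists (`|c| * M) => t; rewrite normrM -mulrA ler_wpM2l.
Qed.

Lemma domRdD d (f g : 'rV[R]_d -> R) : domRd f -> domRd g -> domRd (fun t => f t + g t).
Proof.
move=> [mf [M fM]] [mg [N gN]]; split; first exact: measurable_funD.
by exists (M + N) => t; rewrite mulrDl (le_trans (ler_normD _ _)) // lerD.
Qed.

Lemma domRdB d (f g : 'rV[R]_d -> R) : domRd f -> domRd g -> domRd (fun t => f t - g t).
Proof.
move=> df dg; have := domRdD df (domRdZ (-1) dg).
by congr domRd; apply/funext => t; rewrite mulN1r.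
Qed.

Lemma domRd_norm d (f : 'rV[R]_d -> R) : domRd f -> domRd (fun t => `|f t|).
Proof.
move=> [mf [M fM]]; split; first exact: measurableT_comp.
by exists M => t; rewrite normr_id.
Qed.

Lemma domRd_le d (f g : 'rV[R]_d -> R) : measurable_fun setT (f : Rd d -> R) ->
  (forall t, `|f t| <= g t) -> domRd g -> domRd f.
Proof.
move=> mf fg [mg [M gM]]; split => //; exists M => t.
by rewrite (le_trans (fg t)) // (le_trans (ler_norm _)).
Qed.

Lemma RintRdZ d (c : R) (f : 'rV[R]_d -> R) : domRd f ->
  RintRd (fun t => c * f t) = c * RintRd f.
Proof.
move=> df; rewrite !RintRdE ?RintegralZl //; [exact: integrable_domRd|exact: domRdZ].
Qed.

Lemma RintRdD d (f g : 'rV[R]_d -> R) : domRd f -> domRd g ->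
  RintRd (fun t => f t + g t) = RintRd f + RintRd g.
Proof.
move=> df dg; rewrite !RintRdE ?RintegralD //; try exact: integrable_domRd.
exact: domRdD.
Qed.

Lemma RintRdB d (f g : 'rV[R]_d -> R) : domRd f -> domRd g ->
  RintRd (fun t => f t - g t) = RintRd f - RintRd g.
Proof.
move=> df dg; rewrite !RintRdE ?RintegralB //; try exact: integrable_domRd.
exact: domRdB.
Qed.

Lemma le_RintRd d (f g : 'rV[R]_d -> R) : domRd f -> domRd g ->
  (forall t, f t <= g t) -> RintRd f <= RintRd g.
Proof.
by move=> df dg fg; rewrite !RintRdE //; apply: le_Rintegral => //; exact: integrable_domRd.
Qed.

Lemma norm_RintRd_le d (f g : 'rV[R]_d -> R) : domRd f -> domRd g ->
  (forall t, `|f t| <= g t) -> `|RintRd f| <= RintRd g.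
Proof.
move=> df dg fg; apply: (@le_trans _ _ (RintRd (fun t => `|f t|))).
  rewrite !RintRdE //; last exact: domRd_norm.
  by apply: le_normr_Rintegral => //; exact: integrable_domRd.
by apply: le_RintRd => //; exact: domRd_norm.
Qed.

Lemma domRd_kerRd d : domRd (@kerRd d).
Proof.
split; first exact: measurable_kerRd.
by exists 1 => t; rewrite mul1r ger0_norm // kerRd_ge0.
Qed.

Lemma RintRd_kerRd d : RintRd (@kerRd d) = kerRd_int d.
Proof. by rewrite /RintRd intRd_kerRd. Qed.

End Rd_measure.

(** * Complex norms and bounded operators *)

Section nrm.
Context {R : realType}.
Local Notation C := R[i].

(** Norms of a complex space take values in [R[i]]; the estimates are carried out in the totally
    ordered field [R]. *)
Definition nrm (V : normedZmodType C) (v : V) : R := complex.Re `|v|.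

Section nrm_lemmas.
Variable V : normedZmodType C.
Implicit Types v w : V.

Lemma nrmE v : `|v| = (nrm v)%:C.
Proof. by rewrite /nrm RRe_real // ger0_real. Qed.

Lemma nrm_ge0 v : 0 <= nrm v.
Proof. by rewrite -ler0c -nrmE. Qed.

Lemma nrm0 : nrm (0 : V) = 0.
Proof. by rewrite /nrm normr0. Qed.

Lemma nrm_eq0 v : nrm v = 0 -> v = 0.
Proof. by move=> v0; apply/eqP; rewrite -normr_eq0 nrmE v0. Qed.

Lemma nrmN v : nrm (- v) = nrm v.
Proof. by rewrite /nrm normrN. Qed.

Lemma nrmB v w : nrm (v - w) = nrm (w - v).
Proof. by rewrite /nrm distrC. Qed.

Lemma nrmD v w : nrm (v + w) <= nrm v + nrm w.
Proof. by rewrite -lecR rmorphD /= -!nrmE ler_normD. Qed.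

Lemma nrm_le v (a : R) : (nrm v <= a) = (`|v| <= a%:C).
Proof. by rewrite nrmE lecR. Qed.

Lemma nrm_lt v (a : R) : (nrm v < a) = (`|v| < a%:C).
Proof. by rewrite nrmE ltcR. Qed.

Lemma nrm_sum I (r : seq I) (P : pred I) (F : I -> V) :
  nrm (\sum_(i <- r | P i) F i) <= \sum_(i <- r | P i) nrm (F i).
Proof.
elim/big_rec2 : _ => [|i x y _ IH]; first by rewrite nrm0.
by rewrite (le_trans (nrmD _ _)) // lerD2l.
Qed.

End nrm_lemmas.

Lemma nrmM (z w : C) : nrm (z * w) = nrm z * nrm w.
Proof. by apply: complexI; rewrite rmorphM /= -!nrmE normrM. Qed.

Lemma nrm1 : nrm (1 : C) = 1.
Proof. by rewrite /nrm normr1. Qed.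

Lemma nrmX (z : C) n : nrm (z ^+ n) = nrm z ^+ n.
Proof. by elim: n => [|n IH]; rewrite ?expr0 ?nrm1 // !exprS nrmM IH. Qed.

Lemma nrm_real (x : R) : nrm (x%:C : C) = `|x|.
Proof. by rewrite /nrm normc_def /= expr0n addr0 sqrtr_sqr. Qed.

Lemma nrmZ (V : normedModType C) (a : C) (v : V) : nrm (a *: v) = nrm a * nrm v.
Proof. by apply: complexI; rewrite rmorphM /= -!nrmE normrZ. Qed.

Lemma nrm_prod I (r : seq I) (P : pred I) (F : I -> C) :
  nrm (\prod_(i <- r | P i) F i) = \prod_(i <- r | P i) nrm (F i).
Proof.
by elim/big_rec2 : _ => [|i x y _ IH]; rewrite ?nrm1 // nrmM IH.
Qed.

Lemma Re_le_nrm (z : C) : `|complex.Re z| <= nrm z.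
Proof.
rewrite /nrm normc_def /= -sqrtr_sqr ler_sqrt ?lerDl ?sqr_ge0 //.
by rewrite addr_ge0 // sqr_ge0.
Qed.

Lemma Im_le_nrm (z : C) : `|complex.Im z| <= nrm z.
Proof.
rewrite /nrm normc_def /= -sqrtr_sqr ler_sqrt ?lerDr ?sqr_ge0 //.
by rewrite addr_ge0 // sqr_ge0.
Qed.

Lemma nrm_le_ReIm (z : C) : nrm z <= `|complex.Re z| + `|complex.Im z|.
Proof.
case: z => a b; rewrite /nrm normc_def /= -[leRHS]ger0_norm ?addr_ge0 //.
rewrite -sqrtr_sqr ler_sqrt ?sqr_ge0 // sqrrD !real_normK ?num_real //.
by rewrite -addrA lerD2l lerDr mulrn_wge0 // mulr_ge0.
Qed.

Lemma nrm_expi (x : R) : nrm (expi x) = 1.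
Proof. by rewrite /nrm normc_def /= cos2Dsin2 sqrtr1. Qed.

Lemma expiD (x y : R) : expi (x + y) = expi x * expi y.
Proof.
by rewrite /expi cosD sinD; apply/eqP; rewrite eq_complex /= eqxx /= addrC mulrC [X in _ + X]mulrC eqxx.
Qed.

Lemma expi0 : expi (0 : R) = 1.
Proof. by rewrite /expi cos0 sin0. Qed.

Lemma expipi : expi (pi : R) = -1.
Proof. by rewrite /expi cospi sinpi; apply/eqP; rewrite eq_complex /= oppr0 !eqxx. Qed.

Lemma expiNpi : expi (- pi : R) = -1.
Proof. by rewrite /expi cosN sinN cospi sinpi; apply/eqP; rewrite eq_complex /= oppr0 !eqxx. Qed.

End nrm.

Section operators.
Context {R : realType}.
Local Notation C := R[i].
Local Notation BS := (completeNormedModType C).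
Implicit Types U V W : BS.

Section one.
Variables U V : BS.
Implicit Types A B : U -> V.
Local Notation bl := is_bounded_linear.

Lemma blD A u w : bl A -> A (u + w) = A u + A w.
Proof. by move=> [lA _]; have := lA 1 u w; rewrite !scale1r. Qed.

Lemma bl0 A : bl A -> A 0 = 0.
Proof. by move=> bA; apply: (addrI (A 0)); rewrite -blD // !addr0. Qed.

Lemma blZ A a u : bl A -> A (a *: u) = a *: A u.
Proof. by move=> bA; have [lA _] := bA; have := lA a u 0; rewrite (bl0 bA) !addr0. Qed.

Lemma blN A u : bl A -> A (- u) = - A u.
Proof. by move=> bA; rewrite -scaleN1r blZ // scaleN1r. Qed.

Lemma blB A u w : bl A -> A (u - w) = A u - A w.
Proof. by move=> bA; rewrite blD // blN. Qed.

Lemma bl_boundP A : bl A -> exists2 M : R, 0 <= M & forall u, nrm (A u) <= M * nrm u.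
Proof.
move=> [_ [M HM]]; exists `|M| => // u; rewrite nrm_le rmorphM /= -nrmE.
by apply: (le_trans (HM u)); rewrite ler_wpM2r // lecR ler_norm.
Qed.

Lemma bl_intro A (M : R) : (forall a u w, A (a *: u + w) = a *: A u + A w) ->
  (forall u, nrm (A u) <= M * nrm u) -> bl A.
Proof.
by move=> lA HM; split => //; exists M => u; rewrite [`|u|]nrmE -rmorphM /= -nrm_le.
Qed.

Let S A := [set complex.Re `|A u| | u in [set u : U | complex.Re `|u| <= 1]].

Lemma opnorm_has_sup A : bl A -> has_sup (S A).
Proof.
move=> bA; split; first by exists (nrm (A 0)); exists 0 => //=; rewrite normr0.
have [M M0 HM] := bl_boundP bA; exists M => _ [u /= u1 <-].
by apply: (le_trans (HM u)); rewrite ler_piMr.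
Qed.

Lemma opnorm_ge0 A : bl A -> 0 <= opnorm A.
Proof.
move=> bA; have -> : 0 = nrm (A 0) by rewrite bl0 // nrm0.
apply: sup_ubound; first by case: (opnorm_has_sup bA).
by exists 0 => //=; rewrite normr0.
Qed.

Lemma opnormP A u : bl A -> nrm (A u) <= opnorm A * nrm u.
Proof.
move=> bA; have [u0|u0] := eqVneq (nrm u) 0.
  by rewrite u0 mulr0 (nrm_eq0 u0) bl0 // nrm0.
have u0' : 0 < nrm u by rewrite lt_neqAle eq_sym u0 nrm_ge0.
rewrite -ler_pdivrMr // -[X in X <= _](_ : nrm (A (((nrm u)^-1)%:C *: u)) = _).
  apply: sup_ubound; first by case: (opnorm_has_sup bA).
  exists (((nrm u)^-1)%:C *: u) => //=.
  by rewrite -/(nrm _) nrmZ nrm_real ger0_norm ?invr_ge0 ?nrm_ge0 // mulVf.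
by rewrite blZ // nrmZ nrm_real ger0_norm ?invr_ge0 ?nrm_ge0 // mulrC.
Qed.

Lemma opnorm_le A (M : R) : 0 <= M -> (forall u, nrm (A u) <= M * nrm u) -> opnorm A <= M.
Proof.
move=> M0 HM; apply: ge_sup => [|_ [u /= u1 <-]].
  by exists (nrm (A 0)); exists 0 => //=; rewrite normr0.
by apply: (le_trans (HM u)); rewrite ler_piMr.
Qed.

Lemma opnorm0_eq A : bl A -> opnorm A = 0 -> A = @opzero R U V.
Proof.
move=> bA A0; apply/funext => u; apply: nrm_eq0; apply/eqP.
by rewrite eq_le nrm_ge0 andbT; have := opnormP u bA; rewrite A0 mul0r.
Qed.

Lemma bl_opzero : bl (@opzero R U V).
Proof. by apply: (@bl_intro _ 0) => [a u w|u]; rewrite /opzero ?scaler0 ?addr0 // nrm0 mul0r. Qed.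

Lemma opnorm_opzero : opnorm (@opzero R U V) = 0.
Proof.
apply/eqP; rewrite eq_le opnorm_ge0 ?andbT; last exact: bl_opzero.
by apply: opnorm_le => // u; rewrite nrm0 mul0r.
Qed.

Lemma bl_add A B : bl A -> bl B -> bl (opadd A B).
Proof.
move=> bA bB; apply: (@bl_intro _ (opnorm A + opnorm B)) => [a u w|u]; rewrite /opadd.
  by rewrite !blD // !blZ // scalerDr addrACA.
by rewrite (le_trans (nrmD _ _)) // mulrDl lerD // opnormP.
Qed.

Lemma bl_scale a A : bl A -> bl (opscale a A).
Proof.
move=> bA; apply: (@bl_intro _ (nrm a * opnorm A)) => [b u w|u]; rewrite /opscale.
  by rewrite blD // blZ // scalerDr !scalerA mulrC.
by rewrite nrmZ -mulrA ler_wpM2l ?nrm_ge0 // opnormP.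
Qed.

Lemma opnorm_add A B : bl A -> bl B -> opnorm (opadd A B) <= opnorm A + opnorm B.
Proof.
move=> bA bB; apply: opnorm_le; first by rewrite addr_ge0 // opnorm_ge0.
by move=> u; rewrite (le_trans (nrmD _ _)) // mulrDl lerD // opnormP.
Qed.

Lemma opnorm_scale_le a A : bl A -> opnorm (opscale a A) <= nrm a * opnorm A.
Proof.
move=> bA; apply: opnorm_le; first by rewrite mulr_ge0 ?nrm_ge0 ?opnorm_ge0.
by move=> u; rewrite nrmZ -mulrA ler_wpM2l ?nrm_ge0 // opnormP.
Qed.

Lemma opnorm_scale a A : bl A -> opnorm (opscale a A) = nrm a * opnorm A.
Proof.
move=> bA; apply/eqP; rewrite eq_le opnorm_scale_le //=.
have [->|a0] := eqVneq a 0.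
  by rewrite nrm0 mul0r opnorm_ge0 //; exact: bl_scale.
have na : 0 < nrm a.
  by rewrite lt_neqAle nrm_ge0 andbT eq_sym; apply: contra_neq a0; exact: nrm_eq0.
rewrite -ler_pdivlMl //; have := opnorm_scale_le a^-1 (bl_scale a bA).
rewrite (_ : opscale _ _ = A); last first.
  by apply/funext => u; rewrite /opscale scalerA mulVf // scale1r.
move/le_trans; apply; rewrite le_eqVlt; apply/orP; left; apply/eqP; congr (_ * _).
by apply: (mulfI (lt0r_neq0 na)); rewrite -nrmM mulfV // nrm1 mulfV // lt0r_neq0.
Qed.

End one.

(** The shape [a A + B] with [a = -1] is the one in which linearity of [T] and of the action is
    assumed. *)
Definition opsub U V (A B : U -> V) : U -> V := opadd (opscale (-1) B) A.

Lemma opsubE U V (A B : U -> V) u : opsub A B u = A u - B u.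
Proof. by rewrite /opsub /opadd /opscale scaleN1r addrC. Qed.

Lemma opsubEf U V (A B : U -> V) : opsub A B = fun u => A u - B u.
Proof. by apply/funext => u; rewrite opsubE. Qed.

Lemma bl_sub U V (A B : U -> V) :
  is_bounded_linear A -> is_bounded_linear B -> is_bounded_linear (opsub A B).
Proof. by move=> bA bB; apply: bl_add => //; exact: bl_scale. Qed.

Lemma opnorm_sub U V (A B : U -> V) : is_bounded_linear A -> is_bounded_linear B ->
  opnorm (opsub A B) <= opnorm A + opnorm B.
Proof.
move=> bA bB; rewrite (le_trans (opnorm_add _ _)) //; first exact: bl_scale.
by rewrite opnorm_scale // nrmN nrm1 mul1r addrC.
Qed.

Lemma opnorm_subC U V (A B : U -> V) : opnorm (opsub A B) = opnorm (opsub B A).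
Proof.
rewrite /opnorm; congr sup; apply/seteqP; split => _ [u /= u1 <-]; exists u => //.
  by rewrite !opsubE distrC.
by rewrite !opsubE distrC.
Qed.

Lemma opnorm_triangle U V (A B D : U -> V) : is_bounded_linear A ->
  is_bounded_linear B -> is_bounded_linear D ->
  opnorm (opsub A D) <= opnorm (opsub A B) + opnorm (opsub B D).
Proof.
move=> bA bB bD; rewrite (_ : opsub A D = opadd (opsub A B) (opsub B D)).
  by apply: opnorm_add; exact: bl_sub.
by apply/funext => u; rewrite /opadd !opsubE addrA subrK.
Qed.

Lemma bl_comp U V W (A : U -> V) (B : V -> W) :
  is_bounded_linear A -> is_bounded_linear B -> is_bounded_linear (fun u => B (A u)).
Proof.
move=> bA bB; apply: (@bl_intro _ _ _ (opnorm B * opnorm A)) => [a u w|u].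
  by rewrite blD // blZ // blD // blZ.
rewrite (le_trans (opnormP _ bB)) // -mulrA ler_wpM2l ?opnorm_ge0 //.
exact: opnormP.
Qed.

Lemma opnorm_comp U V W (A : U -> V) (B : V -> W) :
  is_bounded_linear A -> is_bounded_linear B ->
  opnorm (fun u => B (A u)) <= opnorm B * opnorm A.
Proof.
move=> bA bB; apply: opnorm_le; first by rewrite mulr_ge0 // opnorm_ge0.
move=> u; rewrite (le_trans (opnormP _ bB)) // -mulrA ler_wpM2l ?opnorm_ge0 //.
exact: opnormP.
Qed.

Lemma bl_id U : is_bounded_linear (@id U).
Proof. by apply: (@bl_intro _ _ _ 1) => // u; rewrite mul1r. Qed.

Definition opsum U V I (r : seq I) (c : I -> C) (F : I -> U -> V) : U -> V :=
  fun u => \sum_(i <- r) c i *: F i u.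

Lemma opsum_nil U V I (c : I -> C) (F : I -> U -> V) : opsum [::] c F = @opzero R U V.
Proof. by apply/funext => u; rewrite /opsum big_nil. Qed.

Lemma opsum_cons U V I i (r : seq I) (c : I -> C) (F : I -> U -> V) :
  opsum (i :: r) c F = opadd (opscale (c i) (F i)) (opsum r c F).
Proof. by apply/funext => u; rewrite /opsum big_cons. Qed.

Lemma bl_sum U V I (r : seq I) (c : I -> C) (F : I -> U -> V) :
  (forall i, is_bounded_linear (F i)) -> is_bounded_linear (opsum r c F).
Proof.
move=> bF; elim: r => [|i r IH]; first by rewrite opsum_nil; exact: bl_opzero.
by rewrite opsum_cons; apply: bl_add => //; exact: bl_scale.
Qed.

Lemma opnorm_sum U V I (r : seq I) (c : I -> C) (F : I -> U -> V) :
  (forall i, is_bounded_linear (F i)) ->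
  opnorm (opsum r c F) <= \sum_(i <- r) nrm (c i) * opnorm (F i).
Proof.
move=> bF; elim: r => [|i r IH]; first by rewrite opsum_nil big_nil opnorm_opzero.
rewrite opsum_cons big_cons (le_trans (opnorm_add _ _)) //.
- exact: bl_scale.
- exact: bl_sum.
- by rewrite lerD // opnorm_scale_le.
Qed.

Lemma bl_opsum U V W I (r : seq I) (c : I -> C) (F : I -> U -> V) (B : V -> W) :
  is_bounded_linear B ->
  (fun u => B (opsum r c F u)) = opsum r c (fun i u => B (F i u)).
Proof.
move=> bB; apply/funext => u; rewrite /opsum.
by elim: r => [|i r IH]; rewrite ?big_nil ?big_cons ?bl0 // blD // blZ // IH.
Qed.

(** Completeness of the operator space. Pointwise limits exist because [V] is complete; sending the
    second index to infinity in the Cauchy bound makes the convergence uniform on the unit ball. *)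
Lemma opnorm_cauchy_cvg U V (F : nat -> U -> V) :
  (forall n, is_bounded_linear (F n)) ->
  (forall e : R, 0 < e -> exists N, forall m n, (N <= m)%N -> (N <= n)%N ->
     opnorm (opsub (F m) (F n)) <= e) ->
  exists2 L : U -> V, is_bounded_linear L &
    forall e : R, 0 < e -> exists N, forall n, (N <= n)%N -> opnorm (opsub (F n) L) <= e.
Proof.
move=> bF cF.
have cvgF u : cvgn (fun n => F n u).
  apply: cauchy_cvg; apply/cauchy_exP => e e0.
  have [|N HN] := cF (complex.Re e / (nrm u + 1) / 2).
    rewrite !divr_gt0 // ?ltr_wpDl ?nrm_ge0 //.
    by move: e0; rewrite ltcE => /andP[].
  exists (F N u); exists N => // n /= Nn; rewrite -ball_normE /=.
  have e0' : 0 < complex.Re e by move: e0; rewrite ltcE => /andP[].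
  have -> : e = (complex.Re e)%:C by rewrite RRe_real // gtr0_real.
  rewrite -nrm_lt; have := opnormP u (bl_sub (bF N) (bF n)).
  rewrite opsubE => /le_lt_trans; apply.
  apply: (@le_lt_trans _ _ (complex.Re e / (nrm u + 1) / 2 * (nrm u + 1))).
    apply: ler_pM; rewrite ?nrm_ge0 ?opnorm_ge0 //; first exact: bl_sub.
      exact: HN.
    by rewrite lerDl.
  rewrite mulrAC divfK; last by rewrite gt_eqF // ltr_wpDl ?nrm_ge0.
  by rewrite ltr_pdivrMr // ltr_pMr // ltr1n.
pose L u := limn (fun n => F n u).
have HL u (e : R) : 0 < e -> \forall n \near \oo, nrm (F n u - L u) < e.
  move=> e0; have /cvgrPdist_lt /(_ e%:C) := cvgF u.
  rewrite ltcR => /(_ e0); apply: filterS => n.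
  by rewrite nrm_lt distrC.
have key (e : R) : 0 < e -> exists N, forall n, (N <= n)%N ->
    forall u, nrm (F n u - L u) <= e * nrm u.
  move=> e0; have [N HN] := cF _ e0; exists N => n Nn u.
  apply/ler_addgt0Pr => d d0.
  have [M _ HM] := HL u d d0.
  pose k := maxn N M.
  have -> : F n u - L u = (F n u - F k u) + (F k u - L u) by rewrite addrA subrK.
  rewrite (le_trans (nrmD _ _)) // lerD //; last exact/ltW/HM/leq_maxr.
  rewrite -opsubE (le_trans (opnormP _ _)) //; first exact: bl_sub.
  by rewrite ler_wpM2r ?nrm_ge0 // HN // leq_maxl.
have linL a u w : L (a *: u + w) = a *: L u + L w.
  apply/eqP; rewrite -subr_eq0; apply/eqP/nrm_eq0/eqP.
  rewrite eq_le nrm_ge0 andbT; apply/ler_addgt0Pr => d d0; rewrite add0r.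
  pose e := d / (nrm (a *: u + w) + nrm a * nrm u + nrm w + 1).
  have s0 : 0 < nrm (a *: u + w) + nrm a * nrm u + nrm w + 1.
    by rewrite ltr_wpDl // !addr_ge0 ?mulr_ge0 ?nrm_ge0.
  have e0 : 0 < e by rewrite divr_gt0.
  have [N HN] := key e e0; have {}HN := HN N (leqnn N).
  have -> : L (a *: u + w) - (a *: L u + L w) =
      - (F N (a *: u + w) - L (a *: u + w)) + (a *: (F N u - L u) + (F N w - L w)).
    rewrite (blD _ _ (bF N)) (blZ _ _ (bF N)) scalerBr opprB.
    by rewrite [X in _ = _ + X]addrACA -opprD addrA subrK.
  rewrite (le_trans (nrmD _ _)) // nrmN (le_trans (lerD (HN _) (nrmD _ _))) //.
  rewrite nrmZ (le_trans (lerD (lexx _) (lerD (ler_wpM2l (nrm_ge0 _) (HN _)) (HN _)))) //.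
  rewrite mulrCA -!mulrDr /e mulrAC -mulrA ler_piMr // ?ltW //.
  by rewrite ltr_pdivrMr // mul1r addrA ltrDl.
have [N1 HN1] := key 1 ltr01.
have bL : is_bounded_linear L.
  apply: (@bl_intro _ _ _ (1 + opnorm (F N1))) => // u.
  rewrite -[L u](subrK (F N1 u)) mulrDl (le_trans (nrmD _ _)) // lerD ?opnormP //.
  by rewrite nrmB HN1.
exists L => // e e0; have [N HN] := key e e0; exists N => n Nn.
by apply: opnorm_le (ltW e0) _ => u; rewrite opsubE HN.
Qed.

End operators.

(** * Norming functionals *)

Section hahn_banach.
Context {R : realType}.
Local Notation C := R[i].
Variable V : normedModType C.
Variable v0 : V.

(** Graphs of real-linear functionals dominated by the norm. Single-valuedness follows from the
    bound applied to a difference. The last clause is guarded by non-emptiness so that the union of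
    the empty chain is still admissible in Zorn's lemma. *)
Let sub_graph (G : set (V * R)) := [/\ (forall (a : R) p q, G p -> G q ->
    G (a%:C *: p.1 + q.1, a * p.2 + q.2)), (forall p, G p -> p.2 <= nrm p.1) &
    (G !=set0 -> G (v0, nrm v0))].

Lemma hahn_banach_maximal_graph : exists G : set (V * R), sub_graph G /\
  forall B, G `<` B -> ~ sub_graph B.
Proof.
apply: Zorn_bigcup => F FP totF; split.
- move=> a p q [G FG Gp] [H FH Hq].
  have [GH|HG] := totF _ _ FG FH.
    by exists H => //; have [+ _ _] := FP _ FH; apply => //; exact: GH.
  by exists G => //; have [+ _ _] := FP _ FG; apply => //; exact: HG.
- by move=> p [G FG Gp]; have [_ + _] := FP _ FG; exact.
- by move=> [p [G FG Gp]]; exists G => //; have [_ _] := FP _ FG; apply; exists p.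
Qed.

Lemma real_hahn_banach : exists f : V -> R,
  [/\ forall (a : R) x y, f (a%:C *: x + y) = a * f x + f y,
      forall x, f x <= nrm x & f v0 = nrm v0].
Proof.
have [G [[Glin Gle Gv0] Gmax]] := hahn_banach_maximal_graph.
have G0 : G (v0, nrm v0).
  apply: Gv0; apply: contrapT => /set0P /negP; rewrite negbK => /eqP G0.
  pose B := [set p : V * R | exists t : R, p = (t%:C *: v0, t * nrm v0)].
  apply: (Gmax B).
    rewrite G0; split => // H; have /H : B (v0, nrm v0) by exists 1; rewrite scale1r mul1r.
    by [].
  split.
  - move=> a _ _ [s ->] [t ->]; exists (a * s + t) => /=.
    by rewrite rmorphD rmorphM /= scalerDl mulrDl scalerA mulrA.
  - move=> _ [t ->] /=; rewrite nrmZ nrm_real ler_wpM2r ?nrm_ge0 // ler_norm //.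
  - by move=> _; exists 1; rewrite scale1r mul1r.
have Gz : G (0, 0).
  have := Glin (-1) _ _ G0 G0; rewrite /= mulN1r addNr.
  by rewrite rmorphN /= scaleN1r addNr.
have Guniq x r s : G (x, r) -> G (x, s) -> r = s.
  move=> Gr Gs; apply/eqP; rewrite eq_le; apply/andP; split.
    have /Gle := Glin (-1) _ _ Gs Gr; rewrite /= rmorphN /= scaleN1r addNr nrm0 mulN1r.
    by rewrite addrC subr_le0.
  have /Gle := Glin (-1) _ _ Gr Gs; rewrite /= rmorphN /= scaleN1r addNr nrm0 mulN1r.
  by rewrite addrC subr_le0.
have Gtot y : exists r, G (y, r).
  apply: contrapT => nG.
  (* Extension by one dimension: a value [a] at [y] is admissible when [p.2 - nrm (p.1 - y) <= a <=
     nrm (p.1 + y) - p.2] for all [p] in [G]. The supremum of the lower bounds is taken. *)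
  pose S := [set p.2 - nrm (p.1 - y) | p in G].
  have Sub p' : G p' -> ubound S (nrm (p'.1 + y) - p'.2).
    move=> Gp' _ [p Gp <-]; rewrite lerBlDr addrAC lerBrDr.
    have /Gle := Glin 1 _ _ Gp Gp'; rewrite /= scale1r mul1r => /le_trans; apply.
    rewrite [leRHS]addrC; apply: le_trans (nrmD _ _).
    by rewrite addrACA [- y + _]addrC addrAC addrA addrK addrC.
  have Ss : has_sup S.
    split; first by eexists; exists (0, 0).
    by exists (nrm ((0 : V) + y) - 0); exact: (Sub (0, 0)).
  pose a := sup S.
  have aub p : G p -> p.2 - nrm (p.1 - y) <= a.
    by move=> Gp; apply: sup_ubound; [case: Ss|exists p].
  have alb p : G p -> a <= nrm (p.1 + y) - p.2.
    by move=> Gp; apply: ge_sup; [case: Ss|exact: Sub].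
  pose B := [set q : V * R | exists2 p, G p & exists t : R,
    q = (p.1 + t%:C *: y, p.2 + t * a)].
  apply: (Gmax B).
    split; last first.
      move=> H; apply: nG; exists a; apply: H; exists (0, 0) => //; exists 1 => /=.
      by rewrite !add0r scale1r mul1r.
    by move=> [x r] Gxr; exists (x, r) => //; exists 0; rewrite scale0r mul0r !addr0.
  split.
  - move=> b _ _ [p Gp [s ->]] [q Gq [t ->]] /=.
    exists (b%:C *: p.1 + q.1, b * p.2 + q.2); first exact: Glin.
    exists (b * s + t) => /=; congr pair; last by ring.
    by rewrite rmorphD rmorphM /= scalerDl scalerDr -scalerA addrACA.
  - move=> _ [p Gp [t ->]] /=.
    have Gs (s : R) : G (s%:C *: p.1, s * p.2).
      by have := Glin s _ _ Gp Gz; rewrite /= !addr0.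
    have [t0|t0|->] := ltrgtP t 0; last by rewrite scale0r mul0r !addr0 Gle.
    + have := aub _ (Gs (- t)^-1); rewrite /= => H.
      have nt0 : 0 < - t by rewrite oppr_gt0.
      have := ler_wpM2l (ltW nt0) H; rewrite mulrBr mulrA mulfV ?gt_eqF // mul1r.
      rewrite -[X in _ - X * _]gtr0_norm // -nrm_real -nrmZ scalerBr scalerA -rmorphM /=.
      rewrite mulfV ?gt_eqF // scale1r rmorphN /= scaleNr opprK => ?.
      by lra.
    + have := alb _ (Gs t^-1); rewrite /= => H.
      have := ler_wpM2l (ltW t0) H; rewrite mulrBr mulrA mulfV ?gt_eqF // mul1r.
      rewrite -[X in X * nrm _]gtr0_norm // -nrm_real -nrmZ scalerDr scalerA -rmorphM /=.
      rewrite mulfV ?gt_eqF // scale1r => ?.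
      by lra.
  - move=> _; exists (v0, nrm v0) => //; exists 0.
    by rewrite scale0r mul0r !addr0.
pose f x := xget 0 [set r | G (x, r)].
have fG x : G (x, f x) by exact: (xgetPex 0 (Gtot x)).
exists f; split.
- by move=> a x y; apply: (Guniq (a%:C *: x + y)) => //; exact: (Glin a _ _ (fG x) (fG y)).
- by move=> x; exact: (Gle _ (fG x)).
- by apply: (Guniq v0).
Qed.

Lemma hahn_banach : exists ys : V -> C,
  [/\ forall (a : C) x y, ys (a *: x + y) = a * ys x + ys y,
      forall x, nrm (ys x) <= nrm x & ys v0 = (nrm v0)%:C].
Proof.
have [f [flin fle fv0]] := real_hahn_banach.
have fD x y : f (x + y) = f x + f y by have := flin 1 x y; rewrite scale1r mul1r.
have f0 : f 0 = 0 by have := flin (-1) 0 0; rewrite scaler0 addr0; lra.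
have fZ (a : R) x : f (a%:C *: x) = a * f x by have := flin a x 0; rewrite !addr0 f0 addr0.
pose ys x : C := f x +i* (- f ('i%C *: x)).
have ysD x y : ys (x + y) = ys x + ys y.
  by rewrite /ys scalerDr !fD opprD; apply/eqP; rewrite eq_complex /= !eqxx.
have fi x : f ('i%C *: ('i%C *: x)) = - f x.
  rewrite scalerA -expr2 sqr_i scaleN1r -[- x]scaleN1r.
  by have := fZ (-1) x; rewrite rmorphN /= => ->; rewrite mulN1r.
have ysZ (a : C) x : ys (a *: x) = a * ys x.
  case: a => a b; rewrite [_ +i* _]complexE /= scalerDl ysD -scalerA mulrDl -mulrA.
  have ysr (r : R) z : ys (r%:C *: z) = r%:C * ys z.
    rewrite /ys scalerA ['i%C * _]mulrC -scalerA !fZ.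
    by apply/eqP; rewrite eq_complex /= !mul0r subr0 addr0 mulrN !eqxx.
  rewrite -!ysr; congr (_ + _).
  rewrite /ys fi opprK; apply/eqP; rewrite eq_complex /= !mul0r !mul1r sub0r add0r opprK.
  by rewrite !eqxx.
have yslin a x y : ys (a *: x + y) = a * ys x + ys y by rewrite ysD ysZ.
have ysle x : nrm (ys x) <= nrm x.
  have [->|y0] := eqVneq (ys x) 0; first by rewrite nrm0 nrm_ge0.
  have ny0 : 0 < nrm (ys x).
    by rewrite lt_neqAle nrm_ge0 andbT eq_sym; apply: contra_neq y0; exact: nrm_eq0.
  (* Rotating by the phase [c] makes the value real, where the bound on [f] applies. *)
  pose c : C := (nrm (ys x))%:C / ys x.
  have nc : nrm c = 1.
    apply: (mulIf (lt0r_neq0 ny0)); rewrite -nrmM /c divfK // nrm_real mul1r.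
    by rewrite ger0_norm ?nrm_ge0.
  have := fle (c *: x); rewrite nrmZ nc mul1r; apply: le_trans.
  have : ys (c *: x) = (nrm (ys x))%:C by rewrite ysZ /c divfK.
  by move=> /(congr1 (@complex.Re _)) /= ->.
exists ys; split => //.
(* The real part of [ys v0] already exhausts the bound [nrm v0], which leaves no room for an
   imaginary part. *)
have Im0 : f ('i%C *: v0) = 0.
  have := ysle v0; rewrite {1}/nrm normc_def /= fv0 sqrrN => H.
  have : nrm v0 ^+ 2 + f ('i%C *: v0) ^+ 2 <= nrm v0 ^+ 2.
    by rewrite -ler_sqrt ?sqr_ge0 // sqrtr_sqr ger0_norm ?nrm_ge0.
  rewrite gerDl => H2; apply/eqP; rewrite -sqrf_eq0 eq_le H2 sqr_ge0 //.
by rewrite /ys fv0 Im0 oppr0.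
Qed.

End hahn_banach.

Lemma hahn_banach_functional (R : realType) (V : completeNormedModType R[i]) (v0 : V) :
  exists ys : V -> R[i],
  [/\ is_functional ys, forall x, nrm (ys x) <= nrm x & ys v0 = (nrm v0)%:C].
Proof.
have [ys [lin le eq0]] := hahn_banach v0; exists ys; split => //; split => // u0 e e0.
exists e => // u ue; have -> : ys u - ys u0 = ys (u - u0).
  by have := lin (-1) u0 u; rewrite scaleN1r mulN1r addrC [RHS]addrC => ->.
exact: le_lt_trans (le _) ue.
Qed.

(** * The Fejer kernel *)

Section fejer_kernel.
Context {R : realType}.
Local Notation C := R[i].
Implicit Types (t h x : R) (k K M n : nat).

Lemma sin_mean_value x : exists2 c : R, `|c| <= `|x| & sin x = x * cos c.
Proof.
have pos y : 0 < y -> exists2 c : R, `|c| <= `|y| & sin y = y * cos c.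
  move=> y0; have [|c] := @MVT R sin cos 0 y y0.
  - by apply: continuous_subspaceT; exact: continuous_sin.
  rewrite in_itv /= => /andP[c0 cy]; rewrite sin0 !subr0 => ->.
  exists c; last by rewrite mulrC.
  by rewrite !gtr0_norm // ltW.
have [x0|x0|->] := ltrgtP x 0.
- have [|c cx] := pos (- x); first by rewrite oppr_gt0.
  rewrite sinN mulNr => /oppr_inj ->; exists c => //.
  by rewrite -[`|x|]normrN.
- exact: pos.
- by exists 0 => //; rewrite sin0 mul0r.
Qed.

Lemma abs_sin_le x : `|sin x| <= `|x|.
Proof. by have [c _ ->] := sin_mean_value x; rewrite normrM ler_piMr // cos_max. Qed.

Lemma cos_half x : 1 - cos x = 2 * sin (x / 2) ^+ 2.
Proof.
have -> : cos x = cos ((x / 2) *+ 2) by rewrite -mulr_natr divfK.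
by rewrite cos_mulr2n cos2sin2 -mulr_natr; lra.
Qed.

Lemma one_sub_cos_ge0 x : 0 <= 1 - cos x.
Proof. by rewrite subr_ge0 cos_le1. Qed.

Lemma one_sub_cos_le x : 1 - cos x <= x ^+ 2 / 2.
Proof.
rewrite cos_half; have := abs_sin_le (x / 2).
rewrite -(ler_sqr (normr_nneg _) (normr_nneg _)) !real_normK ?num_real // expr_div_n.
by move: (sin _ ^+ 2) (x ^+ 2) => a b; lra.
Qed.

Lemma one_sub_cos_ge x : (x ^+ 2 / 2) * (1 - x ^+ 2) <= 1 - cos x.
Proof.
rewrite cos_half; have [c cx ->] := sin_mean_value (x / 2).
rewrite exprMn expr_div_n cos2sin2.
have cc : c ^+ 2 <= x ^+ 2.
  rewrite -(real_normK (num_real c)) -(real_normK (num_real x)) lerXn2r ?nnegrE //.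
  by rewrite (le_trans cx) // normrM normfV ler_piMr // ger0_norm // invf_le1 // ler1n.
have sc : sin c ^+ 2 <= c ^+ 2.
  by have := abs_sin_le c; rewrite -(ler_sqr (normr_nneg _) (normr_nneg _)) !real_normK ?num_real.
have x0 := sqr_ge0 x; move: (sin c ^+ 2) (x ^+ 2) (c ^+ 2) cc sc x0 => a b e cc sc x0.
nra.
Qed.

Lemma nrm_expi_sub1 x : nrm (expi x - 1) <= `|x|.
Proof.
rewrite -(ler_sqr (nrm_ge0 _) (normr_nneg _)) real_normK ?num_real //.
rewrite /nrm normc_def /= sqr_sqrtr; last by rewrite addr_ge0 // sqr_ge0.
have := one_sub_cos_le x; have := cos2Dsin2 x; rewrite subr0 sqrrB expr1n mulr1.
by move: (sin x ^+ 2) (cos x ^+ 2) (cos x) (x ^+ 2) => a b c e; rewrite -mulr_natr; lra.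
Qed.

Lemma piV_le : (pi : R)^-1 <= 2^-1.
Proof. by rewrite lef_pV2 ?posrE ?pi_gt0 // pi_ge2. Qed.

Lemma fejer_ge0 t : 0 <= fejer t.
Proof.
rewrite /fejer; case: eqP => _; first by rewrite invr_ge0 mulr_ge0 // pi_ge0.
by rewrite divr_ge0 ?one_sub_cos_ge0 // mulr_ge0 ?pi_ge0 ?sqr_ge0.
Qed.

Lemma fejer_sqr t : t ^+ 2 * fejer t = (1 - cos t) / pi.
Proof.
rewrite /fejer; case: eqP => [->|/eqP t0]; first by rewrite expr0n mul0r cos0 subrr mul0r.
have := lt0r_neq0 (pi_gt0 R); move: (@pi R) (cos t) => p c p0.
by field; rewrite t0 p0.
Qed.

Lemma fejer0 : fejer (0 : R) = (2 * pi)^-1.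
Proof. by rewrite /fejer eqxx. Qed.

Lemma fejer_le t : fejer t <= (2 * pi)^-1.
Proof.
have [->|t0] := eqVneq t 0; first by rewrite fejer0.
have t2 : 0 < t ^+ 2 by rewrite exprn_even_gt0.
rewrite -(ler_pM2l t2) fejer_sqr invfM mulrA ler_wpM2r ?invr_ge0 ?pi_ge0 //.
exact: one_sub_cos_le.
Qed.

Lemma fejer_le1 t : fejer t <= 1.
Proof.
apply: (le_trans (fejer_le t)); rewrite invfM.
have := piV_le; have := pi_gt0 R; rewrite -invr_gt0; move: (pi^-1) => p; lra.
Qed.

Lemma fejer_sqr_le t : t ^+ 2 * fejer t <= 1.
Proof.
rewrite fejer_sqr; have := piV_le; have := cos_geN1 t.
have := pi_gt0 R; rewrite -invr_gt0; move: (pi^-1) (cos t) => p c *; nra.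
Qed.

Lemma fejer_le_ker t : fejer t <= 2 * ker1 t.
Proof.
rewrite /ker1 ler_pdivlMr ?ltr_pwDl ?sqr_ge0 // mulrDr mulr1 mulrC.
by have := fejer_le1 t; have := fejer_sqr_le t; rewrite mulrC; lra.
Qed.

Lemma fejer_near0 t : `|fejer t - (2 * pi)^-1| <= t ^+ 2.
Proof.
have [->|t0] := eqVneq t 0; first by rewrite fejer0 subrr normr0 sqr_ge0.
have t2 : 0 < t ^+ 2 by rewrite exprn_even_gt0.
rewrite ler0_norm ?subr_le0 ?fejer_le // opprB lerBlDr -(ler_pM2l t2) (mulrDr (t ^+ 2)) fejer_sqr.
have := one_sub_cos_ge t; have := piV_le; have := pi_gt0 R; rewrite -invr_gt0 invfM.
move: (pi^-1) (cos t) (t ^+ 2) t2 => p c b b0 p0 p2 H.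
have := ler_wpM2r (ltW p0) H => H2.
have : p * (b * b) <= 1 * (b * b) by rewrite ler_wpM2r ?mulr_ge0 ?ltW //; lra.
by move=> H3; have := mulr_ge0 (ltW b0) (ltW b0); lra.
Qed.

(** The classical Fejer sum, equal to [sin (K t / 2) ^ 2 / sin (t / 2) ^ 2]; [fejer_sum] is this
    closed form with the denominator cleared. *)
Definition cosum K t : R := K%:R + \sum_(l < K) (2 * (K%:R - l.+1%:R)) * cos (l.+1%:R * t).

Lemma dirichlet_sum K t :
  (1 - cos t) * (1 + \sum_(l < K) 2 * cos (l.+1%:R * t)) =
  cos (K%:R * t) - cos (K.+1%:R * t).
Proof.
elim: K => [|K IH]; first by rewrite big_ord0 addr0 mulr1 mul0r mul1r cos0.
rewrite big_ord_recr /= addrA mulrDr IH.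
have -> : K.+2%:R * t = K.+1%:R * t + t by rewrite -[K.+2%:R]natr1 mulrDl mul1r.
have -> : K%:R * t = K.+1%:R * t - t by rewrite -[K.+1%:R]natr1 mulrDl mul1r addrK.
by rewrite cosB cosD; ring.
Qed.

Lemma cosumS K t : cosum K.+1 t = cosum K t + (1 + \sum_(l < K) 2 * cos (l.+1%:R * t)).
Proof.
rewrite /cosum big_ord_recr /= subrr mulr0 mul0r addr0 -natr1 -!addrA; congr (_ + _).
rewrite addrCA; congr (_ + _); rewrite -big_split /=; apply: eq_bigr => l _; ring.
Qed.

Lemma fejer_sum K t : (1 - cos t) * cosum K t = 1 - cos (K%:R * t).
Proof.
elim: K => [|K IH]; first by rewrite /cosum big_ord0 addr0 mulr0 mul0r cos0 subrr.
by rewrite cosumS mulrDr IH dirichlet_sum; ring.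
Qed.

Lemma cosum0 K : cosum K 0 = K%:R ^+ 2.
Proof.
elim: K => [|K IH]; first by rewrite /cosum big_ord0 addr0 expr0n.
rewrite cosumS IH; under eq_bigr do rewrite mulr0 cos0 mulr1.
by rewrite sumr_const card_ord -natr1 -mulr_natr; ring.
Qed.

(** The refinement equation behind every change of width: on the frequency side a triangle of width
    [K] is a combination of unit triangles centred at integers, with weights [fwt K]. Away from
    [t = 0] it follows from [fejer_sum] after multiplication by [t ^+ 2]. *)
Lemma fejer_scale K t : (0 < K)%N ->
  K%:R * fejer (K%:R * t) = fejer t * (cosum K t / K%:R).
Proof.
move=> K0; have KR : K%:R != 0 :> R by rewrite pnatr_eq0 -lt0n.
have p0 := lt0r_neq0 (pi_gt0 R).
have [->|t0] := eqVneq t 0; first (rewrite mulr0 fejer0 cosum0; move: (@pi R) p0 => p p0; by field; rewrite p0 KR).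
have E : K%:R ^+ 2 * t ^+ 2 * fejer (K%:R * t) = t ^+ 2 * fejer t * cosum K t.
  by rewrite -exprMn !fejer_sqr mulrAC -fejer_sum mulrAC.
apply: (mulfI (_ : K%:R * t ^+ 2 != 0)); first by rewrite mulf_neq0 // expf_neq0.
rewrite (_ : K%:R * t ^+ 2 * (K%:R * _) = K%:R ^+ 2 * t ^+ 2 * fejer (K%:R * t)); last by ring.
by rewrite E; field.
Qed.

Definition fwt K (l : int) : R := 1 - `|l|%N%:R / K%:R.

Lemma symmetric_sum (V : zmodType) K (g : int -> V) :
  \sum_(i < K.*2.+1) g (i%:Z - K%:Z) = g 0 + \sum_(l < K) (g l.+1%:Z + g (- l.+1%:Z)).
Proof.
elim: K g => [|K IH] g; first by rewrite big_ord_recl !big_ord0 subrr.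
rewrite doubleS big_ord_recl big_ord_recr /=.
under eq_bigr => i _.
  rewrite (_ : (bump 0 i)%:Z - K.+1%:Z = i%:Z - K%:Z); last by rewrite /bump /=; lia.
  over.
rewrite IH [in RHS]big_ord_recr /= sub0r.
rewrite (_ : (bump 0 K.*2.+1)%:Z - K.+1%:Z = K.+1%:Z); last by rewrite /bump /=; lia.
move: (\sum_(i < K) _) (g 0) (g _) (g _) => b a c e.
by rewrite [LHS]addrC !addrA.
Qed.

Lemma cosum_expi K t : (0 < K)%N -> ((cosum K t / K%:R)%:C : C) =
  \sum_(i < K.*2.+1) (fwt K (i%:Z - K%:Z))%:C * expi ((i%:Z - K%:Z)%:~R * t).
Proof.
move=> K0; have KR : K%:R != 0 :> R by rewrite pnatr_eq0 -lt0n.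
rewrite (symmetric_sum K (fun l => (fwt K l)%:C * expi (l%:~R * t))).
rewrite mul0r expi0 mulr1 /fwt absz0 mul0r subr0 /cosum mulrDl divff // rmorphD /=.
congr (_ + _); rewrite mulr_suml rmorph_sum /=; apply: eq_bigr => l _.
rewrite mulrNz mulNr -mulrDr -pmulrn.
apply/eqP; rewrite eq_complex /= cosN sinN subrr !mulr0 !mul0r subr0 add0r eqxx andbT.
by apply/eqP; field.
Qed.

(** * Finite differences of the Fejer kernel *)

Definition dif (V : zmodType) h (f : R -> V) : R -> V := fun t => f (t + h) - f t.

Lemma iter_difSr (V : zmodType) h k (f : R -> V) t :
  iter k.+1 (dif h) f t = iter k (dif h) f (t + h) - iter k (dif h) f t.
Proof. by []. Qed.

Lemma iter_dif_real h k (f : R -> R) t :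
  ((iter k (dif h) f t)%:C : C) = iter k (dif h) (fun t => (f t)%:C) t.
Proof. by elim: k t => [//|k IH] t; rewrite !iter_difSr rmorphB /= !IH. Qed.

Lemma iter_dif_sum (V : zmodType) I (r : seq I) h k (F : I -> R -> V) t :
  iter k (dif h) (fun t => \sum_(i <- r) F i t) t = \sum_(i <- r) iter k (dif h) (F i) t.
Proof. by elim: k t => [//|k IH] t; rewrite iter_difSr !IH -sumrB. Qed.

Lemma iter_difZ (V : pzRingType) h k (a : V) (f : R -> V) t :
  iter k (dif h) (fun t => a * f t) t = a * iter k (dif h) f t.
Proof. by elim: k t => [//|k IH] t; rewrite !iter_difSr !IH mulrBr. Qed.

Lemma iter_dif_expi h k x t :
  iter k (dif h) (fun t => expi (x * t)) t = (expi (x * h) - 1) ^+ k * expi (x * t) :> C.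
Proof.
elim: k t => [|k IH] t; first by rewrite mul1r.
by rewrite iter_difSr !IH mulrDr expiD exprS; ring.
Qed.

Lemma iter_dif_cvg h k (F : nat -> R -> R) (f : R -> R) :
  (forall t, F n t @[n --> \oo] --> f t) ->
  forall t, iter k (dif h) (F n) t @[n --> \oo] --> iter k (dif h) f t.
Proof. by move=> Ff; elim: k => [//|k IH] t; apply: cvgB; exact: IH. Qed.

Lemma fwt_ge0 K l : (`|l|%N <= K)%N -> 0 <= fwt K l.
Proof.
move=> lK; case: K lK => [|K] lK; first by rewrite /fwt invr0 mulr0 subr0.
by rewrite subr_ge0 ler_pdivrMr ?ltr0n // mul1r ler_nat.
Qed.

Lemma fwt_le1 K l : fwt K l <= 1.
Proof. by rewrite lerBlDr lerDl divr_ge0. Qed.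

Lemma fwt_sum K : (0 < K)%N -> \sum_(i < K.*2.+1) fwt K (i%:Z - K%:Z) = K%:R.
Proof.
move=> K0; have KR : K%:R != 0 :> R by rewrite pnatr_eq0 -lt0n.
have := cosum_expi 0 K0; rewrite cosum0 expr2 mulfK // => /(congr1 (@complex.Re _)) /= ->.
rewrite (raddf_sum (@complex.Re R : C -> R)) /=; apply: eq_bigr => i _.
by rewrite mulr0 cos0 sin0 mulr1 mul0r subr0.
Qed.

(** A Riemann sum of step [1 / M] for the integral of [(1 - |x|) e^{i x t}] over [[-1, 1]], whose
    value is [2 pi fejer t]. Difference bounds are immediate for the sum and survive the limit. *)
Definition fejer_approx M t : R := cosum M (t / M%:R) / M%:R / M%:R.

(** Bernstein's inequality: all frequencies lie in [[-1, 1]], so each difference multiplies an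
    exponential by a factor of modulus at most [|h|], and the nonnegative weights sum to one. *)
Lemma fejer_approx_dif_le h k M t : (0 < M)%N ->
  `|iter k (dif h) (fejer_approx M) t| <= `|h| ^+ k.
Proof.
move=> M0; have MR : 0 < M%:R :> R by rewrite ltr0n.
rewrite -nrm_real iter_dif_real.
have -> : (fun t => (fejer_approx M t)%:C : C) = fun t => (M%:R^-1)%:C *
    \sum_(i < M.*2.+1) (fwt M (i%:Z - M%:Z))%:C * expi ((i%:Z - M%:Z)%:~R / M%:R * t).
  apply/funext => s; rewrite /fejer_approx mulrC rmorphM /= cosum_expi //; congr (_ * _).
  by apply: eq_bigr => i _; rewrite mulrA mulrAC.
rewrite iter_difZ iter_dif_sum nrmM nrm_real ger0_norm ?invr_ge0 ?(ltW MR) //.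
rewrite ler_pdivrMl // (le_trans (nrm_sum _ _ _)) //.
rewrite -[X in _ <= X * _](fwt_sum M0) mulr_suml; apply: ler_sum => i _.
have iM : (`|(i%:Z - M%:Z)|%N <= M)%N by have := ltn_ord i; lia.
rewrite iter_difZ iter_dif_expi !nrmM nrm_expi mulr1 nrm_real ger0_norm ?fwt_ge0 //.
rewrite ler_wpM2l ?fwt_ge0 // nrmX lerXn2r ?nnegrE ?nrm_ge0 //.
rewrite (le_trans (nrm_expi_sub1 _)) // normrM ler_piMl // normrM normfV.
rewrite ler_pdivrMr ?normr_gt0 ?gt_eqF // mul1r [leRHS]ger0_norm ?(ltW MR) //.
by rewrite -intr_norm -abszE pmulrn ler_nat.
Qed.

(** By [fejer_scale] the approximant is [fejer t / fejer (t / n.+1%:R)] for large [n], and the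
    denominator tends to [fejer 0 = (2 pi)^-1]. *)
Lemma fejer_approx_cvg t : fejer_approx n.+1 t @[n --> \oo] --> 2 * pi * fejer t.
Proof.
have p0 := lt0r_neq0 (pi_gt0 R).
have E n : fejer (t / n.+1%:R) * fejer_approx n.+1 t = fejer t.
  have nR : n.+1%:R != 0 :> R by rewrite pnatr_eq0.
  have := fejer_scale (t / n.+1%:R) (ltn0Sn n).
  rewrite mulrCA divff // mulr1 => H.
  by rewrite /fejer_approx mulrA -H mulrC mulKf.
have c1 : fejer (t / n.+1%:R) @[n --> \oo] --> (2 * pi)^-1.
  apply/cvgrPdist_le => e e0.
  have /cvgrPdist_le /(_ _ e0) : (t ^+ 2 * n.+1%:R^-1) @[n --> \oo] --> (0 : R).
    by rewrite -[X in _ --> X](mulr0 (t ^+ 2)); apply: cvgMr; exact: cvg_harmonic.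
  apply: filterS => n; rewrite sub0r normrN ger0_norm; last first.
    by rewrite mulr_ge0 ?sqr_ge0.
  move=> H; rewrite distrC (le_trans (fejer_near0 _)) // expr_div_n (le_trans _ H) //.
  rewrite ler_wpM2l ?sqr_ge0 // lef_pV2 ?posrE ?exprn_gt0 ?ltr0n //.
  by rewrite expr2 ler_peMr // ler1n.
have c2 : (fejer (t / n.+1%:R))^-1 @[n --> \oo] --> 2 * pi.
  rewrite -[X in _ --> X]invrK; apply: cvgV => //.
  by rewrite invr_eq0 mulf_neq0 // pnatr_eq0.
have c3 : fejer t * (fejer (t / n.+1%:R))^-1 @[n --> \oo] --> 2 * pi * fejer t.
  by rewrite mulrC; apply: cvgMr.
apply: cvg_trans c3; apply: near_eq_cvg.
have : \forall n \near \oo, fejer (t / n.+1%:R) != 0.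
  have q0 : 0 < (2 * pi : R)^-1 by rewrite invr_gt0 mulr_gt0 // pi_gt0.
  have /cvgrPdist_lt /(_ _ q0) := c1; apply: filterS => n H.
  by apply/eqP => F0; move: H; rewrite F0 subr0 gtr0_norm // ltxx.
by apply: filterS => n Fn; rewrite -(E n) mulrAC mulfV // mul1r.
Qed.

Lemma fejer_dif_le h k t : `|iter k (dif h) (@fejer R) t| <= `|h| ^+ k.
Proof.
have twop : 1 <= 2 * pi :> R by have := pi_ge2 R; lra.
have : `|2 * pi * iter k (dif h) (@fejer R) t| <= `|h| ^+ k.
  rewrite -iter_difZ.
  have cF := @iter_dif_cvg h k _ _ fejer_approx_cvg t.
  apply/ler_addgt0Pr => e e0; have /cvgrPdist_le/(_ _ e0)[N _ /(_ N (leqnn N))] := cF.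
  move: (iter _ _ (fun _ => _) t) => a.
  move=> /(le_trans (lerB_dist _ _)); rewrite lerBlDr addrC => /le_trans; apply.
  by rewrite lerD2r fejer_approx_dif_le.
apply: le_trans; rewrite normrM ler_peMl // ger0_norm //; lra.
Qed.

(** Lipschitz continuity is the case [k = 1] of the difference bound, with step [s - t]; the
    removable singularity at 0 needs no separate treatment. *)
Lemma continuous_fejer : continuous (@fejer R).
Proof.
move=> t; apply/cvgrPdist_le => e e0; near=> s.
have := fejer_dif_le (s - t) 1 t; rewrite /= /dif expr1 distrC.
rewrite (_ : t + (s - t) = s); last by ring.
move=> /le_trans; apply; rewrite distrC.
by near: s; apply: cvgr_dist_le; [exact: cvg_id|].
Unshelve. all: by end_near. Qed.

(** Leibniz rule for differences: only three terms, since third differences of [t ^+ 2] vanish. The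
    truncated predecessors for [k < 2] are harmless, their coefficients being zero. *)
Lemma leibniz_sqr h k (f : R -> R) t :
  iter k (dif h) (fun t => t ^+ 2 * f t) t =
  t ^+ 2 * iter k (dif h) f t +
  k%:R * (2 * t * h + h ^+ 2) * iter k.-1 (dif h) f (t + h) +
  k%:R * k.-1%:R * h ^+ 2 * iter k.-2 (dif h) f (t + h + h).
Proof.
elim: k t => [|k IH] t; first by rewrite !mul0r !addr0.
rewrite iter_difSr !IH; case: k {IH} => [|[|k]].
- by rewrite /= /dif; ring.
- by rewrite /= /dif; ring.
- rewrite /= -!iterS !iter_difSr -!natr1.
  move: (iter k _ _ (t + h)) => a.
  by rewrite /dif; ring.
Qed.

Lemma dif_one_sub_cos_le h k t : `|h| <= 1 ->
  `|iter k (dif h) (fun t => t ^+ 2 * fejer t) t| <= `|h| ^+ k.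
Proof.
move=> h1; have p0 := pi_gt0 R.
have -> : (fun t => t ^+ 2 * fejer t) = fun t => pi^-1 * (1 - cos t).
  by apply/funext => s; rewrite fejer_sqr mulrC.
rewrite iter_difZ normrM gtr0_norm ?invr_gt0 //.
case: k => [|k].
  rewrite expr0 /= ger0_norm ?one_sub_cos_ge0 // ler_pdivrMl // mulr1.
  by have := cos_geN1 t; have := pi_ge2 R; lra.
have -> : iter k.+1 (dif h) (fun t => 1 - cos t) t = - iter k.+1 (dif h) cos t.
  elim: k t => [|k IH] t; first by rewrite /= /dif; ring.
  by rewrite iter_difSr !IH [in RHS]iter_difSr; ring.
rewrite normrN ler_pdivrMl //; apply: (@le_trans _ _ (`|h| ^+ k.+1)); last first.
  by rewrite ler_peMl ?exprn_ge0 //; have := pi_ge2 R; lra.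
have -> : iter k.+1 (dif h) cos t =
    complex.Re (iter k.+1 (dif h) (fun t => expi (1 * t)) t).
  elim: k.+1 t => [|j IH] t; first by rewrite /= mul1r.
  by rewrite !iter_difSr !IH; case: (iter _ _ _ _) => a b; case: (iter _ _ _ _).
rewrite (le_trans (Re_le_nrm _)) // iter_dif_expi nrmM nrm_expi mulr1 nrmX mul1r.
by rewrite lerXn2r ?nnegrE ?nrm_ge0 // nrm_expi_sub1.
Qed.

Lemma fejer_dif_sqr_le h k t : 0 < h <= 1 ->
  t ^+ 2 * `|iter k (dif h) (@fejer R) t| <= h ^+ k +
  k%:R * (2 * `|t| + 1) * (h * `|iter k.-1 (dif h) (@fejer R) (t + h)|) +
  k%:R * k.-1%:R * (h ^+ 2 * `|iter k.-2 (dif h) (@fejer R) (t + h + h)|).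
Proof.
move=> /andP[h0 h1].
have -> : t ^+ 2 * `|iter k (dif h) (@fejer R) t| = `|t ^+ 2 * iter k (dif h) (@fejer R) t|.
  by rewrite normrM [X in _ = X * _]ger0_norm ?sqr_ge0.
have := leibniz_sqr h k (@fejer R) t; set L := iter k _ (fun _ => _) t.
set a := t ^+ 2 * _; set b := _ * iter k.-1 _ _ _; set c := _ * iter k.-2 _ _ _ => E.
have -> : a = L - b - c by rewrite E; ring.
rewrite (le_trans (ler_normB _ _)) // (le_trans (lerD (ler_normB _ _) (lexx _))) //.
apply: lerD; first apply: lerD.
- have := @dif_one_sub_cos_le h k t; rewrite (ger0_norm (ltW h0)); exact.
- have : `|2 * t * h + h ^+ 2| <= (2 * `|t| + 1) * h.
    have e1 : `|2 * t * h| = 2 * `|t| * h.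
      by rewrite !normrM normr_nat (ger0_norm (ltW h0)).
    have e2 : `|h ^+ 2| <= h by rewrite ger0_norm ?sqr_ge0 // expr2 ler_piMl // ltW.
    by rewrite (le_trans (ler_normD _ _)) // e1; lra.
  rewrite /b; move: (2 * t * h + h ^+ 2) => z H.
  rewrite !normrM normr_nat -!mulrA ler_wpM2l // [leRHS]mulrA.
  by rewrite ler_wpM2r.
- rewrite /c; move: (h ^+ 2) (sqr_ge0 h) => z z0.
  by rewrite !normrM !normr_nat (ger0_norm z0) -!mulrA.
Qed.

Lemma natr_pred_expr h k : k%:R * (h * h ^+ k.-1) = k%:R * h ^+ k.
Proof. by case: k => [|k]; rewrite ?mul0r // -exprS. Qed.

Lemma natr_pred2_expr h k : k%:R * k.-1%:R * (h ^+ 2 * h ^+ k.-2) = k%:R * k.-1%:R * h ^+ k.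
Proof. by case: k => [|[|k]]; rewrite ?mulr0 ?mul0r // -exprD. Qed.

(** The quadratic bound involves [|t|] times a lower difference, so decay is gained one power at a
    time: dividing it by [|t|] gives linear decay here, which [fejer_dif_ker_le] feeds back to
    obtain quadratic decay. *)
Lemma fejer_dif_lin_le h k t : 0 < h <= 1 ->
  `|t| * `|iter k (dif h) (@fejer R) t| <= (k%:R + 2) ^+ 2 * h ^+ k.
Proof.
move=> hh; have /andP[h0 h1] := hh.
have F j s : `|iter j (dif h) (@fejer R) s| <= h ^+ j.
  by have := fejer_dif_le h j s; rewrite [X in X ^+ _](ger0_norm (ltW h0)).
have hk := exprn_gt0 k h0; have kR := ler0n R k.
have [t1|t1] := leP `|t| 1.
  apply: (@le_trans _ _ (1 * h ^+ k)); first by rewrite ler_pM.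
  by rewrite ler_wpM2r ?(ltW hk) //; nra.
have t0 : 0 < `|t| by rewrite (lt_trans ltr01).
rewrite -(ler_pM2l t0) mulrA -expr2 real_normK ?num_real //.
rewrite (le_trans (fejer_dif_sqr_le _ _ hh)) //.
have A : k%:R * (2 * `|t| + 1) * (h * `|iter k.-1 (dif h) (@fejer R) (t + h)|) <=
    (2 * `|t| + 1) * (k%:R * h ^+ k).
  rewrite -natr_pred_expr [k%:R * (2 * _ + _)]mulrC -!mulrA.
  apply: ler_wpM2l; first by have := normr_ge0 t; lra.
  by rewrite !ler_wpM2l // ltW.
have B : k%:R * k.-1%:R * (h ^+ 2 * `|iter k.-2 (dif h) (@fejer R) (t + h + h)|) <=
    k%:R * k%:R * h ^+ k.
  apply: (@le_trans _ _ (k%:R * k.-1%:R * h ^+ k)).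
    by rewrite -natr_pred2_expr !ler_wpM2l // ?sqr_ge0.
  by rewrite ler_wpM2r ?(ltW hk) // ler_wpM2l // ler_nat leq_pred.
apply: (le_trans (lerD (lerD (lexx _) A) B)).
move: (h ^+ k) (k%:R) `|t| hk kR t1 t0 => H K T H0 K0 T1 T0.
have -> : H + (2 * T + 1) * (K * H) + K * K * H = (1 + (2 * T + 1) * K + K * K) * H by ring.
rewrite mulrA ler_wpM2r ?(ltW H0) //; nra.
Qed.

(** Bernstein's inequality with an integrable majorant. The decay costs a factor polynomial in [k],
    which is absorbed by enlarging [h] to [8 * h]. *)
Lemma fejer_dif_ker_le h k t : 0 < h <= 1 ->
  `|iter k (dif h) (@fejer R) t| <= 8 * (8 * h) ^+ k * ker1 t.
Proof.
move=> hh; have /andP[h0 h1] := hh.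
have F j s : `|iter j (dif h) (@fejer R) s| <= h ^+ j.
  by have := fejer_dif_le h j s; rewrite [X in X ^+ _](ger0_norm (ltW h0)).
have hk := exprn_gt0 k h0; have kR := ler0n R k.
have A : k%:R * (2 * `|t| + 1) * (h * `|iter k.-1 (dif h) (@fejer R) (t + h)|) <=
    (2 * ((k%:R + 1) ^+ 2 + 1) + 1) * (k%:R * h ^+ k).
  case: k hk kR => [|k] hk kR; first by rewrite !mul0r mulr0.
  rewrite /= -mulrA [X in _ <= X]mulrCA ler_wpM2l //.
  have T : `|t| * `|iter k (dif h) (@fejer R) (t + h)| <= ((k.+1%:R + 1) ^+ 2 + 1) * h ^+ k.
    have T1 := @fejer_dif_lin_le h k (t + h) hh.
    have : `|t| <= `|t + h| + 1.
      by rewrite -[X in `|X| <= _](addrK h) (le_trans (ler_normB _ _)) // lerD2l (ger0_norm (ltW h0)).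
    move=> /(ler_wpM2r (normr_ge0 (iter k (dif h) (@fejer R) (t + h)))) /le_trans; apply.
    rewrite mulrDl mul1r mulrDl mul1r lerD // (le_trans T1) //.
    by rewrite (_ : k.+1%:R + 1 = k%:R + 2 :> R) // -[k.+1%:R]natr1; ring.
  rewrite (exprS h k) [leRHS]mulrCA [leLHS]mulrCA; apply: ler_wpM2l; first exact: ltW.
  by have := F k (t + h); lra.
have B : k%:R * k.-1%:R * (h ^+ 2 * `|iter k.-2 (dif h) (@fejer R) (t + h + h)|) <=
    k%:R * k%:R * h ^+ k.
  apply: (@le_trans _ _ (k%:R * k.-1%:R * h ^+ k)).
    by rewrite -natr_pred2_expr !ler_wpM2l // ?sqr_ge0.
  by rewrite ler_wpM2r ?(ltW hk) // ler_wpM2l // ler_nat leq_pred.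
(* Since [8 = 2 ^ 3] and [k + 1 <= 2 ^ k], the factor [8 ^+ k] dominates the cubic growth. *)
have k8 : (k%:R + 1) ^+ 3 <= 8 ^+ k :> R.
  have -> : 8 ^+ k = (2 ^+ k) ^+ 3 :> R by rewrite exprAC; congr (_ ^+ k); ring.
  rewrite lerXn2r ?nnegrE ?addr_ge0 ?exprn_ge0 // natr1 -natrX ler_nat.
  exact: ltn_expl.
rewrite /ker1 ler_pdivlMr ?ltr_pwDl ?sqr_ge0 // mulrDr mulr1 [_ * t ^+ 2]mulrC.
apply: (le_trans (lerD (F k t) (le_trans (fejer_dif_sqr_le k t hh) (lerD (lerD (lexx _) A) B)))).
rewrite exprMn; move: (h ^+ k) (k%:R) (8 ^+ k) hk kR k8 => H K E H0 K0 KE.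
apply: (@le_trans _ _ (8 * (K + 1) ^+ 3 * H)); last by rewrite [leRHS]mulrA ler_wpM2r ?(ltW H0) // ler_wpM2l.
have -> : H + (H + (2 * ((K + 1) ^+ 2 + 1) + 1) * (K * H) + K * K * H) =
  (2 + (2 * ((K + 1) ^+ 2 + 1) + 1) * K + K * K) * H by ring.
rewrite ler_wpM2r ?(ltW H0) // !exprS expr0; nra.
Qed.

End fejer_kernel.

(** * Complex integrands and Fejer windows *)

Section Cmeas.
Context {R : realType}.
Local Notation C := R[i].

Definition Cmeas d (f : 'rV[R]_d -> C) : Prop :=
  measurable_fun setT ((fun t => complex.Re (f t)) : Rd d -> R) /\
  measurable_fun setT ((fun t => complex.Im (f t)) : Rd d -> R).

Lemma CmeasD d (f g : 'rV[R]_d -> C) : Cmeas f -> Cmeas g -> Cmeas (fun t => f t + g t).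
Proof.
move=> [f1 f2] [g1 g2]; split.
  rewrite (_ : (fun t => _) = fun t => complex.Re (f t) + complex.Re (g t)).
    exact: measurable_funD.
  by apply/funext => t; case: (f t) => a b; case: (g t).
rewrite (_ : (fun t => _) = fun t => complex.Im (f t) + complex.Im (g t)).
  exact: measurable_funD.
by apply/funext => t; case: (f t) => a b; case: (g t).
Qed.

Lemma CmeasM d (f g : 'rV[R]_d -> C) : Cmeas f -> Cmeas g -> Cmeas (fun t => f t * g t).
Proof.
move=> [f1 f2] [g1 g2]; split.
  rewrite (_ : (fun t => _) = fun t =>
     complex.Re (f t) * complex.Re (g t) - complex.Im (f t) * complex.Im (g t)).
    by apply: measurable_funB; exact: measurable_funM.
  by apply/funext => t; case: (f t) => a b; case: (g t).
rewrite (_ : (fun t => _) = fun t =>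
   complex.Re (f t) * complex.Im (g t) + complex.Im (f t) * complex.Re (g t)).
  by apply: measurable_funD; exact: measurable_funM.
by apply/funext => t; case: (f t) => a b; case: (g t).
Qed.

Lemma Cmeas_cst d (a : C) : Cmeas (fun _ : 'rV[R]_d => a).
Proof. by split; exact: measurable_cst. Qed.

Lemma Cmeas_real d (f : 'rV[R]_d -> R) : measurable_fun setT (f : Rd d -> R) ->
  Cmeas (fun t => (f t)%:C).
Proof. by move=> mf; split => //=; exact: measurable_cst. Qed.

Lemma CmeasZ d (a : C) (f : 'rV[R]_d -> C) : Cmeas f -> Cmeas (fun t => a * f t).
Proof. by move=> mf; apply: CmeasM => //; exact: Cmeas_cst. Qed.

Lemma CmeasB d (f g : 'rV[R]_d -> C) : Cmeas f -> Cmeas g -> Cmeas (fun t => f t - g t).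
Proof.
move=> mf mg; have := CmeasD mf (CmeasZ (-1) mg).
by congr Cmeas; apply/funext => t; rewrite mulN1r.
Qed.

Lemma Cmeas_prod d n (F : 'I_n -> 'rV[R]_d -> C) : (forall i, Cmeas (F i)) ->
  Cmeas (fun t => \prod_(i < n) F i t).
Proof.
elim: n F => [|n IH] F mF.
  have := Cmeas_cst d 1; congr Cmeas; apply/funext => t; by rewrite big_ord0.
have := CmeasM (mF ord0) (IH (fun i => F (lift ord0 i)) (fun i => mF _)).
by congr Cmeas; apply/funext => t; rewrite big_ord_recl.
Qed.

Lemma Cmeas_coord d (g : R -> C) (j : 'I_d) :
  measurable_fun setT (fun s => complex.Re (g s)) ->
  measurable_fun setT (fun s => complex.Im (g s)) ->
  Cmeas (fun t : 'rV[R]_d => g (t ord0 j)).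
Proof. by move=> m1 m2; split; [exact: (measurable_coord j m1)|exact: (measurable_coord j m2)]. Qed.

Lemma Cmeas_nrm d (f : 'rV[R]_d -> C) : Cmeas f ->
  measurable_fun setT ((fun t => nrm (f t)) : Rd d -> R).
Proof.
move=> [f1 f2]; rewrite (_ : (fun t => nrm (f t)) = fun t =>
    Num.sqrt (complex.Re (f t) ^+ 2 + complex.Im (f t) ^+ 2)).
  apply: (measurableT_comp (continuous_measurable_fun (@sqrt_continuous R))).
  by apply: measurable_funD; exact: measurable_funX.
by apply/funext => t; rewrite /nrm normc_def.
Qed.

Lemma Cmeas_L1 d (f : 'rV[R]_d -> C) (g : 'rV[R]_d -> R) : Cmeas f -> domRd g ->
  (forall t, nrm (f t) <= g t) -> L1 f /\ L1norm f <= RintRd g.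
Proof.
move=> mf dg fg; have mn := Cmeas_nrm mf.
have dn : domRd (fun t => nrm (f t)).
  by apply: domRd_le dg => // t; rewrite ger0_norm ?nrm_ge0.
split; last exact: le_RintRd.
case: (mf) => f1 f2; split; [exact/measurable_RdE|exact/measurable_RdE|].
rewrite (intRd_domE dn); have := integrable_domRd dn => /integrableP[_].
by under eq_integral => t _ do rewrite /= ger0_norm ?nrm_ge0 //.
Qed.

Lemma domRd_ReIm d (f : 'rV[R]_d -> C) (g : 'rV[R]_d -> R) : Cmeas f -> domRd g ->
  (forall t, nrm (f t) <= g t) ->
  domRd (fun t => complex.Re (f t)) /\ domRd (fun t => complex.Im (f t)).
Proof.
move=> [f1 f2] dg fg; split; apply: (domRd_le _ _ dg) => // t.
  exact: le_trans (Re_le_nrm _) (fg t).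
exact: le_trans (Im_le_nrm _) (fg t).
Qed.

(** The factor 2 comes from estimating the real and imaginary parts separately. *)
Lemma nrm_cintRd_le d (f : 'rV[R]_d -> C) (g : 'rV[R]_d -> R) : Cmeas f -> domRd g ->
  (forall t, nrm (f t) <= g t) -> nrm (cintRd f) <= 2 * RintRd g.
Proof.
move=> mf dg fg; have [d1 d2] := domRd_ReIm mf dg fg.
rewrite (le_trans (nrm_le_ReIm _)) // mulrDl mul1r lerD //=; apply: norm_RintRd_le => // t.
  exact: le_trans (Re_le_nrm _) (fg t).
exact: le_trans (Im_le_nrm _) (fg t).
Qed.

Lemma cintRdB d (f f' : 'rV[R]_d -> C) (g g' : 'rV[R]_d -> R) :
  Cmeas f -> domRd g -> (forall t, nrm (f t) <= g t) ->
  Cmeas f' -> domRd g' -> (forall t, nrm (f' t) <= g' t) ->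
  cintRd (fun t => f t - f' t) = cintRd f - cintRd f'.
Proof.
move=> mf dg fg mf' dg' fg'; have [d1 d2] := domRd_ReIm mf dg fg.
have [d1' d2'] := domRd_ReIm mf' dg' fg'.
rewrite /cintRd.
rewrite (_ : (fun t => complex.Re _) = fun t => complex.Re (f t) - complex.Re (f' t)); last first.
  by apply/funext => t; case: (f t) => a b; case: (f' t).
rewrite (_ : (fun t => complex.Im _) = fun t => complex.Im (f t) - complex.Im (f' t)); last first.
  by apply/funext => t; case: (f t) => a b; case: (f' t).
by rewrite !RintRdB.
Qed.

Lemma cintRdZr d (f : 'rV[R]_d -> R) (a : C) : domRd f ->
  cintRd (fun t => (f t)%:C * a) = (RintRd f)%:C * a.
Proof.
move=> df; case: a => a b; rewrite /cintRd.
rewrite (_ : (fun t => complex.Re _) = fun t => a * f t); last first.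
  by apply/funext => t /=; rewrite mul0r subr0 mulrC.
rewrite (_ : (fun t => complex.Im _) = fun t => b * f t); last first.
  by apply/funext => t /=; rewrite mul0r addr0 mulrC.
rewrite !RintRdZ //; apply/eqP; rewrite eq_complex /= !mul0r subr0 addr0.
by rewrite !(mulrC (RintRd f)) !eqxx.
Qed.

End Cmeas.

(** * Dilated Fejer windows and their concentration at the origin *)

Section windows.
Context {R : realType}.
Local Notation C := R[i].
Local Notation lam := (@lebesgue_measure R).

Lemma measurable_fejer : measurable_fun setT (@fejer R).
Proof. exact: continuous_measurable_fun (@continuous_fejer R). Qed.

Lemma continuous_expi_Re (x : R) : continuous (fun s : R => complex.Re (expi (x * s))).
Proof.
move=> s; apply: (@continuous_comp _ _ _ (fun s => x * s) cos); last exact: continuous_cos.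
exact: mulrl_continuous.
Qed.

Lemma continuous_expi_Im (x : R) : continuous (fun s : R => complex.Im (expi (x * s))).
Proof.
move=> s; apply: (@continuous_comp _ _ _ (fun s => x * s) sin); last exact: continuous_sin.
exact: mulrl_continuous.
Qed.

Definition chi d (n : 'rV[int]_d) (t : 'rV[R]_d) : C :=
  \prod_(j < d) expi ((n ord0 j)%:~R * t ord0 j).

Lemma nrm_chi d n (t : 'rV[R]_d) : nrm (chi n t) = 1.
Proof. by rewrite nrm_prod big1 // => j _; rewrite nrm_expi. Qed.

Lemma Cmeas_chi d n : Cmeas (@chi d n).
Proof.
apply: Cmeas_prod => j.
apply: (Cmeas_coord (g := fun s => expi ((n ord0 j)%:~R * s))).
  exact: (continuous_measurable_fun (@continuous_expi_Re (n ord0 j)%:~R)).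
exact: (continuous_measurable_fun (@continuous_expi_Im (n ord0 j)%:~R)).
Qed.

Definition fejerS (N : nat) (s : R) : R := N%:R * fejer (N%:R * s).

Lemma fejerS_ge0 N s : 0 <= fejerS N s.
Proof. by rewrite mulr_ge0 // fejer_ge0. Qed.

Lemma continuous_fejerS N : continuous (fejerS N).
Proof.
have cc : continuous (@fejer R \o (fun x => N%:R * x)).
  by move=> x; apply: continuous_comp; [exact: mulrl_continuous|exact: continuous_fejer].
by move=> s; apply: cvgMr; exact: cc.
Qed.

Lemma measurable_fejerS N : measurable_fun setT (fejerS N).
Proof. exact: continuous_measurable_fun (@continuous_fejerS N). Qed.

Lemma fejerS_le N s : (0 < N)%N -> fejerS N s <= 2 * N%:R * ker1 s.
Proof.
move=> N0; rewrite /fejerS [2 * _]mulrC -mulrA ler_wpM2l // (le_trans (fejer_le_ker _)) //.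
rewrite ler_wpM2l // /ker1 lef_pV2 ?posrE ?ltr_pwDl ?sqr_ge0 // lerD2l exprMn.
by rewrite ler_peMl ?sqr_ge0 // -natrX ler1n expn_gt0 N0.
Qed.

(** Here [s ^+ 2 * fejerS N s <= N^-1], while [|s| >= delta] gives
    [1 + s ^+ 2 <= (1 + delta ^- 2) * s ^+ 2]. The majorant apart from [1 / N] does not depend on
    [N]. *)
Lemma fejerS_tail N (delta s : R) : (0 < N)%N -> 0 < delta -> delta <= `|s| ->
  fejerS N s <= (1 + delta ^- 2) / N%:R * ker1 s.
Proof.
move=> N0 d0 ds; have NR : 0 < N%:R :> R by rewrite ltr0n.
have s2 : delta ^+ 2 <= s ^+ 2.
  by rewrite -[s ^+ 2]real_normK ?num_real // lerXn2r ?nnegrE // ltW.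
have d2 : 0 < delta ^+ 2 by rewrite exprn_gt0.
have s0 : 0 < s ^+ 2 by exact: lt_le_trans s2.
rewrite /ker1 ler_pdivlMr ?ltr_pwDl ?sqr_ge0 // ler_pdivlMr // /fejerS.
have H := fejer_sqr_le (N%:R * s); rewrite exprMn in H.
have : N%:R * fejer (N%:R * s) * (1 + s ^+ 2) * N%:R =
  N%:R ^+ 2 * s ^+ 2 * fejer (N%:R * s) * (1 + (s ^+ 2)^-1).
  by field; rewrite -sqrf_eq0 lt0r_neq0.
move=> ->; rewrite -[leRHS]mul1r ler_pM //.
- by rewrite mulr_ge0 ?fejer_ge0 // mulr_ge0 ?sqr_ge0.
- by rewrite addr_ge0 // invr_ge0 ltW.
- by rewrite lerD2l lef_pV2 ?posrE.
Qed.

Lemma integral_fejerS_lty N : (0 < N)%N -> (\int[lam]_s (fejerS N s)%:E < +oo)%E.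
Proof.
move=> N0; have k := @integral_ker1_lty R.
apply: (@le_lt_trans _ _ (\int[lam]_s ((2 * N%:R)%:E * (ker1 s)%:E))%E).
  apply: ge0_le_integral => //.
  - by move=> s _; rewrite lee_fin fejerS_ge0.
  - by apply/measurable_EFinP; exact: measurable_fejerS.
  - by apply: measurable_funeM; apply/measurable_EFinP; exact: measurable_ker1.
  - by move=> s _; rewrite lee_fin fejerS_le.
rewrite ge0_integralZl_EFin //.
- by rewrite lte_mul_pinfty.
- by move=> s _; rewrite lee_fin ker1_ge0.
- by apply/measurable_EFinP; exact: measurable_ker1.
Qed.

Definition fejer_mass : R := fine (\int[lam]_s (fejer s)%:E)%E.

Lemma fejerS1 : fejerS 1 = @fejer R.
Proof. by apply/funext => s; rewrite /fejerS !mul1r. Qed.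

Lemma fejer_mass_gt0 : 0 < fejer_mass.
Proof.
have l := integral_fejerS_lty (ltn0Sn 0); rewrite fejerS1 in l.
have mf : measurable_fun setT (fun s : R => (fejer s)%:E).
  by apply/measurable_EFinP; exact: measurable_fejer.
have f0 s : (0 <= (fejer (s : R))%:E)%E by rewrite lee_fin fejer_ge0.
apply: fine_gt0; rewrite l andbT.
(* On [[0, 1/4]] the kernel is at least [(2 pi)^-1 - s ^+ 2 >= 1/8 - 1/16], whence the constant
   [1/16]. *)
apply: (@lt_le_trans _ _ (\int[lam]_(s in `[0%R, (4^-1)%R]) (16^-1)%:E)%E).
  have E := @lebesgue_measure_itv R `[0%R, (4^-1)%R].
  rewrite /= lte_fin invr_gt0 ltr0n /= sube0 in E.
  rewrite integral_cst // [X in (_ * X)%E]E.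
  by rewrite -EFinM lte_fin mulr_gt0 // invr_gt0.
apply: (@le_trans _ _ (\int[lam]_(s in `[0%R, (4^-1)%R]) (fejer s)%:E)%E); last first.
  exact: ge0_subset_integral.
apply: ge0_le_integral => //.
  by apply/measurable_EFinP; apply: measurable_funTS; exact: measurable_fejer.
move=> s /=; rewrite in_itv /= lee_fin => /andP[s0 s4].
have := fejer_near0 s; rewrite ler_distlC => /andP[_ H].
have s2 : s ^+ 2 <= 16^-1 by rewrite (_ : 16^-1 = 4^-1 ^+ 2) ?lerXn2r ?nnegrE //; field.
have p8 : 8^-1 <= (2 * pi : R)^-1.
  rewrite lef_pV2 ?posrE ?mulr_gt0 ?pi_gt0 //; have := pihalf_lt2 R; lra.
by lra.
Qed.

Lemma fejerS_mass N : (0 < N)%N -> fine (\int[lam]_s (fejerS N s)%:E)%E = fejer_mass.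
Proof.
move=> N0; have NR : 0 < N%:R :> R by rewrite ltr0n.
rewrite /fejer_mass; congr fine; apply/esym.
pose S := fun x : R => N%:R * x.
have dF : derive1 S = fun=> N%:R.
  apply/funext => x; rewrite derive1E.
  have := @is_deriveZ _ _ _ (@id R) N%:R x 1 1 (is_derive_id _ _).
  by rewrite /GRing.scale /= mulr1 => H; apply: derive_val.
rewrite (@increasing_ge0_integration_by_substitutionT R S (@fejer R)).
- by apply: eq_integral => s _; rewrite dF /fejerS /= mulrC.
- by move=> x y xy; rewrite /S ltr_pM2l.
- by rewrite dF => x; exact: cvg_cst.
- by rewrite dF; apply: is_cvg_cst.
- by rewrite dF; apply: is_cvg_cst.
- by move=> x; apply: derivableM.
- exact: gt0_cvgMrNy.
- exact: gt0_cvgMry.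
- exact: continuous_fejer.
- exact: fejer_ge0.
Qed.

Definition fwin d (N : nat) (t : 'rV[R]_d) : R := \prod_(j < d) fejerS N (t ord0 j).

Lemma fwin_ge0 d N (t : 'rV[R]_d) : 0 <= fwin N t.
Proof. by apply: prodr_ge0 => j _; exact: fejerS_ge0. Qed.

Lemma domRd_fwin d N : (0 < N)%N -> domRd (@fwin d N).
Proof.
move=> N0; split.
  by apply: (@measurable_prod_coord _ d (fun=> fejerS N)) => j; exact: measurable_fejerS.
exists ((2 * N%:R) ^+ d) => t; rewrite ger0_norm ?fwin_ge0 // -[X in _ ^+ X]card_ord.
rewrite -prodr_const -big_split /=; apply: ler_prod => j _.
by rewrite fejerS_ge0 fejerS_le.
Qed.

Lemma RintRd_fwin d N : (0 < N)%N -> RintRd (@fwin d N) = fejer_mass ^+ d.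
Proof.
move=> N0; rewrite /RintRd (@intRd_prod _ d (fun=> fejerS N)) /=.
- under eq_bigr do rewrite fejerS_mass //.
  by rewrite prodr_const card_ord.
- by move=> j; exact: measurable_fejerS.
- by move=> j s; exact: fejerS_ge0.
- by move=> j; exact: integral_fejerS_lty.
Qed.

(** The window with its [j0]-th factor replaced by the majorant of [fejerS_tail] stripped of
    [1 / N]. Its integral is the same for all [N]. *)
Definition fwin_tail d N (delta : R) (j0 : 'I_d) (t : 'rV[R]_d) : R :=
  \prod_(j < d) (if j == j0 then (1 + delta ^- 2) * ker1 (t ord0 j) else fejerS N (t ord0 j)).

Definition tail_const d (delta : R) : R :=
  (1 + delta ^- 2) * fine (\int[lam]_s (ker1 s)%:E)%E * fejer_mass ^+ d.-1.

Lemma fwin_tail_ge0 d N delta j0 (t : 'rV[R]_d) : 0 < delta -> 0 <= fwin_tail N delta j0 t.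
Proof.
move=> d0; apply: prodr_ge0 => j _; case: eqP => _; last exact: fejerS_ge0.
by rewrite mulr_ge0 ?ker1_ge0 // addr_ge0 // invr_ge0 exprn_ge0 // ltW.
Qed.

Lemma domRd_fwin_tail d N delta (j0 : 'I_d) : (0 < N)%N -> 0 < delta ->
  domRd (fwin_tail N delta j0).
Proof.
move=> N0 d0; have D0 : 0 <= 1 + delta ^- 2.
  by rewrite addr_ge0 // invr_ge0 exprn_ge0 // ltW.
split.
  apply: (@measurable_prod_coord _ d (fun j s => if j == j0 then (1 + delta ^- 2) * ker1 s else fejerS N s)).
  move=> j; case: eqP => _; last exact: measurable_fejerS.
  by apply: measurable_funM => //; exact: measurable_ker1.
exists (\prod_(j < d) (if j == j0 then 1 + delta ^- 2 else 2 * N%:R)) => t.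
rewrite ger0_norm ?fwin_tail_ge0 // -big_split /=; apply: ler_prod => j _.
by case: eqP => _; rewrite ?lexx ?fejerS_ge0 ?fejerS_le // mulr_ge0 ?ker1_ge0.
Qed.

Lemma RintRd_fwin_tail d N delta (j0 : 'I_d) : (0 < N)%N -> 0 < delta ->
  RintRd (fwin_tail N delta j0) = tail_const d delta.
Proof.
move=> N0 d0; have D0 : 0 <= 1 + delta ^- 2.
  by rewrite addr_ge0 // invr_ge0 exprn_ge0 // ltW.
have IE : (\int[lam]_s ((1 + delta ^- 2) * ker1 s)%:E =
    (1 + delta ^- 2)%:E * \int[lam]_s (ker1 s)%:E)%E.
  under eq_integral do rewrite EFinM.
  rewrite ge0_integralZl_EFin //.
  - by move=> s _; rewrite lee_fin ker1_ge0.
  - by apply/measurable_EFinP; exact: measurable_ker1.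
rewrite /RintRd (@intRd_prod _ d (fun j s => if j == j0 then (1 + delta ^- 2) * ker1 s else fejerS N s)) /=.
- rewrite (bigD1 j0) //= eqxx IE /tail_const fineM //; last first.
    rewrite ge0_fin_numE ?integral_ker1_lty //.
    by apply: integral_ge0 => s _; rewrite lee_fin ker1_ge0.
  congr (_ * _); under eq_bigr => j jj0 do rewrite (negbTE jj0) fejerS_mass //.
  by rewrite prodr_const cardC1 card_ord.
- move=> j; case: eqP => _; last exact: measurable_fejerS.
  by apply: measurable_funM => //; exact: measurable_ker1.
- by move=> j s; case: eqP => _; [rewrite mulr_ge0 ?ker1_ge0|exact: fejerS_ge0].
- move=> j; case: eqP => _; last exact: integral_fejerS_lty.
  by rewrite IE lte_mul_pinfty // integral_ker1_lty.
Qed.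

Lemma fwin_le_tail d N (delta : R) (j0 : 'I_d) (t : 'rV[R]_d) : (0 < N)%N -> 0 < delta ->
  delta <= `|t ord0 j0| -> fwin N t <= N%:R^-1 * fwin_tail N delta j0 t.
Proof.
move=> N0 d0 dt; rewrite /fwin /fwin_tail (bigD1 j0) //= [in leRHS](bigD1 j0) //= eqxx mulrA.
rewrite (eq_bigr (fun j => if j == j0 then (1 + delta ^- 2) * ker1 (t ord0 j) else fejerS N (t ord0 j))); last first.
  by move=> j /negbTE ->.
rewrite ler_wpM2r //.
  apply: prodr_ge0 => j /negbTE ->; exact: fejerS_ge0.
by rewrite mulrA [_^-1 * _]mulrC fejerS_tail.
Qed.

Lemma nrm_lt_coord d (t : 'rV[R]_d) (e : R) : 0 < e ->
  (forall j, `|t ord0 j| < e) -> `|t| < e.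
Proof.
move=> e0 te; have : ball (0 : 'rV[R]_d) e t.
  by split => // i j; rewrite (ord1 i) /ball /= mxE sub0r normrN.
by rewrite mx_norm_ball /ball_ /= sub0r normrN.
Qed.

(** Near the origin [q] is at most [eps]; elsewhere some coordinate exceeds [delta], and each of the
    [d] slabs carries window mass of order [1 / N]. The threshold precedes [F], [q] and [s], which
    makes the later commutator bound uniform in the window centre and in the right-hand operator. *)
Lemma fwin_concentrated d (eps Q delta : R) : 0 < eps -> 0 <= Q -> 0 < delta ->
  exists N0, forall N, (N0 <= N)%N -> (0 < N)%N -> forall (F : 'rV[R]_d -> C) (q : 'rV[R]_d -> R) (s : R),
    0 <= s -> Cmeas F -> (forall t, nrm (F t) <= s * (fwin N t * q t)) ->
    (forall t, `|t| < delta -> q t <= eps) -> (forall t, q t <= Q) ->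
    nrm (cintRd F) <= 2 * (s * (eps * fejer_mass ^+ d + eps)).
Proof.
move=> e0 Q0 d0; have T0 : 0 <= tail_const d delta.
  rewrite mulr_ge0 ?exprn_ge0 ?(ltW fejer_mass_gt0) // mulr_ge0 //.
    by rewrite addr_ge0 // invr_ge0 exprn_ge0 // ltW.
  by apply: fine_ge0; apply: integral_ge0 => s _; rewrite lee_fin ker1_ge0.
(* The value beyond which [N] makes the total slab contribution at most [eps]. *)
pose B := Q * (d%:R * tail_const d delta) / eps.
have B0 : 0 <= B by apply: divr_ge0; [rewrite mulr_ge0 // mulr_ge0 // ler0n|exact: ltW].
exists (Num.truncn B).+1 => N NB N0 F q s s0 mF Fq q1 q2.
have NR : 0 < N%:R :> R by rewrite ltr0n.
have HN : Q * (d%:R * tail_const d delta) / N%:R <= eps.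
  rewrite ler_pdivrMr // [_ * N%:R]mulrC -ler_pdivrMr // -/B.
  by rewrite (le_trans (ltW (Num.Theory.truncnS_gt B))) // ler_nat.
pose g t := eps * fwin N t + Q / N%:R * \sum_(j < d) fwin_tail N delta j t.
have dsum : domRd (fun t => \sum_(j < d) fwin_tail N delta j t).
  have : forall r : seq 'I_d, domRd (fun t => \sum_(j <- r) fwin_tail N delta j t).
    elim => [|j r IH].
      have := domRdZ 0 (domRd_fwin d N0); congr domRd; apply/funext => t.
      by rewrite big_nil mul0r.
    have := domRdD (@domRd_fwin_tail d N delta j N0 d0) IH; congr domRd; apply/funext => t.
    by rewrite big_cons.
  exact.
have Isum : RintRd (fun t => \sum_(j < d) fwin_tail N delta j t) = d%:R * tail_const d delta.
  have : forall r : seq 'I_d, domRd (fun t => \sum_(j <- r) fwin_tail N delta j t) /\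
      RintRd (fun t => \sum_(j <- r) fwin_tail N delta j t) = (size r)%:R * tail_const d delta.
    elim => [|j r [dr IH]].
      have E : (fun t : 'rV[R]_d => \sum_(j <- [::]) fwin_tail N delta j t) =
          (fun t => 0 * fwin N t) by apply/funext => t; rewrite big_nil mul0r.
      rewrite E RintRdZ ?mul0r; last exact: domRd_fwin.
      by split => //; apply: domRdZ; exact: domRd_fwin.
    have E : (fun t : 'rV[R]_d => \sum_(j <- j :: r) fwin_tail N delta j t) =
       fun t => fwin_tail N delta j t + \sum_(j <- r) fwin_tail N delta j t.
      by apply/funext => t; rewrite big_cons.
    have dj := @domRd_fwin_tail d N delta j N0 d0.
    rewrite E RintRdD // IH RintRd_fwin_tail //; split; first exact: domRdD.
    by rewrite /= -natr1 mulrDl mul1r addrC.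
  move=> /(_ (enum 'I_d)) [_]; rewrite size_enum_ord => <-; congr RintRd.
  by apply/funext => t; rewrite big_enum.
have dg : domRd g by apply: domRdD; apply: domRdZ => //; exact: domRd_fwin.
have Fg t : nrm (F t) <= s * g t.
  apply: (le_trans (Fq t)); rewrite ler_wpM2l // /g.
  have f0 := fwin_ge0 N t.
  have S0 : 0 <= \sum_(j < d) fwin_tail N delta j t.
    by apply: sumr_ge0 => j _; exact: fwin_tail_ge0.
  have [/forallP H|/forallPn[j]] := boolP [forall j, `|t ord0 j| < delta].
    rewrite ler_wpDr ?mulr_ge0 ?invr_ge0 ?(ltW NR) // mulrC ler_wpM2r // q1 //.
    exact: nrm_lt_coord.
  rewrite -leNgt => H; rewrite ler_wpDl ?mulr_ge0 ?(ltW e0) //.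
  rewrite mulrC (le_trans (ler_wpM2r f0 (q2 t))) // -mulrA ler_wpM2l //.
  rewrite (le_trans (fwin_le_tail N0 d0 H)) // ler_wpM2l ?invr_ge0 ?(ltW NR) //.
  rewrite (bigD1 j) //= lerDl; apply: sumr_ge0 => i _; exact: fwin_tail_ge0.
rewrite (le_trans (nrm_cintRd_le mF (domRdZ s dg) Fg)) // ler_wpM2l // RintRdZ // ler_wpM2l //.
rewrite /g RintRdD ?RintRdZ ?RintRd_fwin ?Isum //; try exact: domRd_fwin.
- by rewrite lerD2l mulrAC.
- by apply: domRdZ; exact: domRd_fwin.
- exact: domRdZ.
Qed.

End windows.

(** * Density in L^1 *)

Section L1_theory.
Context {R : realType}.
Local Notation C := R[i].
Variable d : nat.
Local Notation mu := (@mu_Rd R d).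
Implicit Types (f g : 'rV[R]_d -> C) (h : 'rV[R]_d -> R) (E : set (@Rd R d)).

Lemma L1P f : L1 f <-> Cmeas f /\ mu.-integrable setT (EFin \o (fun t => nrm (f t))).
Proof.
have E (mf : Cmeas f) : intRd (fun t => (nrm (f t))%:E) = (\int[mu]_t `|(nrm (f t))%:E|)%E.
  rewrite intRd_ge0E.
  - by apply: eq_integral => t _; rewrite gee0_abs // lee_fin nrm_ge0.
  - by apply/measurable_EFinP; exact: Cmeas_nrm.
  - by move=> t; rewrite lee_fin nrm_ge0.
split=> [[/measurable_RdE f1 /measurable_RdE f2 fy]|[mf /integrableP[_ fy]]].
  have mf : Cmeas f by split.
  split => //; apply/integrableP; split; first by apply/measurable_EFinP; exact: Cmeas_nrm.
  by move: fy; rewrite -E.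
case: (mf) => f1 f2; split; [exact/measurable_RdE|exact/measurable_RdE|].
by rewrite E.
Qed.

Lemma L1normE f : L1 f -> L1norm f = fine (\int[mu]_t (nrm (f t))%:E)%E.
Proof.
move=> /L1P[mf _]; rewrite /L1norm /RintRd intRd_ge0E //.
- by apply/measurable_EFinP; exact: Cmeas_nrm.
- by move=> t; rewrite lee_fin; exact: (nrm_ge0 (f t)).
Qed.

Lemma L1_lin (a : C) f g : L1 f -> L1 g -> L1 (fun t => a * f t + g t).
Proof.
move=> /L1P[mf intf] /L1P[mg intg]; apply/L1P.
have m : Cmeas (fun t => a * f t + g t) by apply: CmeasD => //; exact: CmeasZ.
split => //; have := integrableD measurableT (integrableZl measurableT (nrm a) intf) intg.
apply: le_integrable => //; first by apply/measurable_EFinP; exact: Cmeas_nrm.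
move=> t _ /=; rewrite lee_fin ger0_norm ?nrm_ge0 // ger0_norm; last first.
  by rewrite addr_ge0 ?mulr_ge0 ?nrm_ge0.
by rewrite (le_trans (nrmD _ _)) // nrmM.
Qed.

Lemma L1_real h : mu.-integrable setT (EFin \o h) -> L1 (fun t => (h t)%:C).
Proof.
move=> ih; apply/L1P; split.
  by apply: Cmeas_real; apply/measurable_EFinP; case/integrableP : ih.
have := integrable_abse ih; congr (mu.-integrable _ _).
by apply/funext => t /=; rewrite nrm_real.
Qed.

Lemma L1norm_real h : mu.-integrable setT (EFin \o h) ->
  L1norm (fun t => (h t)%:C) = fine (\int[mu]_t `|(h t)%:E|)%E.
Proof.
move=> ih; rewrite L1normE; last exact: L1_real.
by congr fine; apply: eq_integral => t _; rewrite nrm_real.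
Qed.

Definition Q (n : nat) : set (@Rd R d) := ball (0 : 'rV[R]_d) n.+1%:R.

Lemma open_Q n : open (Q n : set 'rV[R]_d).
Proof. exact: ball_open. Qed.

Lemma mem_Q n (t : 'rV[R]_d) : Q n t <-> forall j, `|t ord0 j| < n.+1%:R.
Proof.
split=> [[_ H] j|H]; first by have := H ord0 j; rewrite /ball /= mxE sub0r normrN.
by split => // i j; rewrite (ord1 i) /ball /= mxE sub0r normrN.
Qed.

Lemma measurable_openRd (U : set 'rV[R]_d) : open U -> measurable (U : set (@Rd R d)).
Proof. exact: sub_sigma_algebra. Qed.

Lemma measurable_indRd E : measurable E -> measurable_fun setT (\1_E : @Rd R d -> R).
Proof. by move=> mE; exact: measurable_indic. Qed.

Lemma domRd_indic E n : measurable E -> E `<=` Q n -> domRd (\1_E : 'rV[R]_d -> R).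
Proof.
move=> mE EQ; split; first exact: measurable_indRd.
exists ((1 + n.+1%:R ^+ 2) ^+ d) => t; rewrite indicE.
have [tE|tE] := boolP (t \in E); last first.
  by rewrite normr0 mulr_ge0 ?kerRd_ge0 // exprn_ge0 // addr_ge0 // sqr_ge0.
have /mem_Q tQ := EQ _ (set_mem tE).
rewrite normr1 -[X in _ ^+ X]card_ord -prodr_const -big_split /=.
elim/big_ind : _ => // [x y x1 y1|j _]; first exact: mulr_ege1.
rewrite ler_pdivlMr ?mul1r ?ltr_pwDl ?sqr_ge0 // lerD2l.
by rewrite -[leLHS]real_normK ?num_real // lerXn2r ?nnegrE // ltW.
Qed.

Lemma mu_Q_lty E n : measurable E -> E `<=` Q n -> (mu E < +oo)%E.
Proof.
move=> mE EQ; have /integrableP[_] := integrable_domRd (domRd_indic mE EQ).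
under eq_integral => t _ do rewrite /= ger0_norm //.
by rewrite integral_indic // setIT.
Qed.

Lemma integrable_indic E : measurable E -> (mu E < +oo)%E ->
  mu.-integrable setT (EFin \o (\1_E : @Rd R d -> R)).
Proof.
move=> mE Ey; apply/integrableP; split; first by apply/measurable_EFinP; exact: measurable_indRd.
under eq_integral => t _ do rewrite /= ger0_norm //.
by rewrite integral_indic // setIT.
Qed.

Lemma indic_diff (E F : set (@Rd R d)) t : F `<=` E ->
  \1_E t - \1_F t = \1_(E `\` F) t :> R.
Proof.
move=> FE; rewrite !indicE in_setD; have [tF|tF] := boolP (t \in F).
  by rewrite (mem_set (FE _ (set_mem tF))) /= subrr.
by rewrite andbT subr0.
Qed.

Lemma L1norm_indicB (E F : set (@Rd R d)) : measurable E -> measurable F -> F `<=` E ->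
  (mu E < +oo)%E ->
  L1norm (fun t => (\1_E t : R)%:C + -1 * (\1_F t : R)%:C) = fine (mu (E `\` F)).
Proof.
move=> mE mF FE Ey.
have mD : measurable (E `\` F) by exact: measurableD.
have Dy : (mu (E `\` F) < +oo)%E.
  by apply: le_lt_trans Ey; apply: le_measure; rewrite ?inE //; exact: subDsetl.
rewrite (_ : (fun t => _) = fun t => (\1_(E `\` F) t : R)%:C).
  rewrite L1norm_real; last exact: integrable_indic.
  congr fine; under eq_integral => t _ do rewrite /= ger0_norm //.
  by rewrite integral_indic // setIT.
by apply/funext => t; rewrite mulN1r -rmorphB /=; congr (_%:C); exact: indic_diff.
Qed.

(* Dynkin's lemma carries the property from bounded open sets to bounded
   measurable sets, linearity and closedness do the rest. *)
Section density.
Variable good : ('rV[R]_d -> C) -> Prop.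
Hypothesis good_lin : forall (a : C) f g, L1 f -> L1 g -> good f -> good g ->
  good (fun t => a * f t + g t).
Hypothesis good_closed : forall f, L1 f -> (forall e : R, 0 < e -> exists g,
  [/\ L1 g, good g & L1norm (fun t => f t + -1 * g t) <= e]) -> good f.
Hypothesis good_open : forall (U : set 'rV[R]_d) n, open U -> U `<=` Q n ->
  good (fun t => (\1_U t : R)%:C).

Let ind E : 'rV[R]_d -> C := fun t => (\1_E t : R)%:C.

Let L1_ind E : measurable E -> (mu E < +oo)%E -> L1 (ind E).
Proof. by move=> mE Ey; apply: L1_real; exact: integrable_indic. Qed.

Let good_sets := [set E : set (@Rd R d) | measurable E /\ forall n, good (ind (E `&` Q n))].

Let mQ n : measurable (Q n).
Proof. by apply: measurable_openRd; exact: open_Q. Qed.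

Let cvg0_fine (u : nat -> \bar R) : u @ \oo --> (0%R : R)%:E -> forall e : R, 0 < e ->
  exists n, fine (u n) <= e.
Proof.
move=> u0 e e0; have /fine_cvgP[ufin ucvg] := u0.
have /cvgrPdist_le /(_ _ e0)[N _ HN] := ucvg.
exists N; have := HN N (leqnn N); rewrite /= sub0r normrN; exact: le_trans (ler_norm _).
Qed.

Lemma good_measurable E n : measurable E -> good (ind (E `&` Q n)).
Proof.
move=> mE; suff : good_sets E by case.
have H : <<s (@open 'rV[R]_d) >> `<=` good_sets; last exact: H.
apply: lambda_system_subset => //.
- by move=> A B oA oB; exact: openI.
- split => //.
  + split => // k; apply: (@good_open _ k); last exact: subIsetr.
    by rewrite setTI; exact: open_Q.
  + move=> A B BA [mA kA] [mB kB]; split; first exact: measurableD.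
    move=> k; have mAQ := measurableI _ _ mA (mQ k); have mBQ := measurableI _ _ mB (mQ k).
    have lA := mu_Q_lty mAQ (@subIsetr _ _ _); have lB := mu_Q_lty mBQ (@subIsetr _ _ _).
    have := good_lin (-1) (L1_ind mBQ lB) (L1_ind mAQ lA) (kB k) (kA k).
    congr good; apply/funext => t; rewrite /ind mulN1r -rmorphN -rmorphD /=; congr (_%:C).
    rewrite addrC (_ : (A `\` B) `&` Q k = (A `&` Q k) `\` (B `&` Q k)); last first.
      apply/seteqP; split=> x /= [].
        by move=> [Ax nBx] Qx; split => // -[].
      by move=> [Ax Qx] nB; split => //; split => // Bx; apply: nB.
    by apply: indic_diff; exact: setSI.
  + move=> F; change (nat -> set (@Rd R d)) in (type of F) => ndF kF.
    have mF k : measurable (F k) by case: (kF k).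
    have mU : measurable (\bigcup_k F k) by exact: bigcupT_measurable.
    split => // k; have mUQ := measurableI _ _ mU (mQ k).
    have lU := mu_Q_lty mUQ (@subIsetr _ _ _).
    apply: good_closed; first exact: L1_ind.
    pose G m := (\bigcup_k F k `&` Q k) `\` (F m `&` Q k).
    have mG m : measurable (G m) by apply: measurableD => //; exact: measurableI.
    have G0 : \bigcap_m G m = set0.
      rewrite -subset0 => t Gt; have [[[m _ Fmt] Qt] _] := Gt 0%N I.
      by have [_] := Gt m I; apply; split.
    have : mu (G m) @[m --> \oo] --> mu (\bigcap_m G m).
      apply: nonincreasing_cvg_mu => //.
      * by apply: le_lt_trans lU; apply: le_measure; rewrite ?inE //; exact: subDsetl.
      * by rewrite G0.
      * move=> m m' mm'; apply/subsetPset; apply: setDS; apply: setSI.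
        exact/subsetPset/ndF.
    rewrite G0 measure0 => /cvg0_fine cG e e0; have [m Hm] := cG e e0.
    have mFQ := measurableI _ _ (mF m) (mQ k); have lF := mu_Q_lty mFQ (@subIsetr _ _ _).
    exists (ind (F m `&` Q k)); split; [exact: L1_ind|by case: (kF m)|].
    rewrite L1norm_indicB //; apply: setSI; exact: bigcup_sup.
- move=> U oU; split; first exact: measurable_openRd.
  by move=> k; apply: (@good_open _ k); [apply: openI => //; exact: open_Q|exact: subIsetr].
Qed.

Lemma good_finite E : measurable E -> (mu E < +oo)%E -> good (ind E).
Proof.
move=> mE Ey; apply: good_closed; first exact: L1_ind.
pose G m := E `\` (E `&` Q m).
have mEQ m : measurable (E `&` Q m) by exact: measurableI.
have mG m : measurable (G m) by exact: measurableD.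
have ndQ m m' : (m <= m')%N -> Q m `<=` Q m'.
  move=> mm' t /mem_Q H; apply/mem_Q => j; apply: lt_le_trans (H j) _.
  by rewrite ler_nat ltnS.
have G0 : \bigcap_m G m = set0.
  rewrite -subset0 => t Gt; have [Et _] := Gt 0%N I.
  pose B := \sum_(j < d) `|t ord0 j|.
  have [_] := Gt (Num.truncn B) I; apply; split => //; apply/mem_Q => j.
  apply: le_lt_trans (Num.Theory.truncnS_gt B); rewrite /B (bigD1 j) //= lerDl.
  exact: sumr_ge0.
have : mu (G m) @[m --> \oo] --> mu (\bigcap_m G m).
  apply: nonincreasing_cvg_mu => //.
  - by apply: le_lt_trans Ey; apply: le_measure; rewrite ?inE //; exact: subDsetl.
  - by rewrite G0.
  - by move=> m m' mm'; apply/subsetPset; apply: setDS; apply: setIS; exact: ndQ.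
rewrite G0 measure0 => /cvg0_fine cG e e0; have [m Hm] := cG e e0.
exists (ind (E `&` Q m)); split.
- apply: L1_ind => //; apply: le_lt_trans Ey; apply: le_measure; rewrite ?inE //.
- exact: (@good_measurable E m mE).
- by rewrite L1norm_indicB //; exact: subIsetl.
Qed.

Let good0 : good (fun=> 0).
Proof.
have m0 := @measurable0 _ (@Rd R d).
have := @good_finite set0 m0; rewrite measure0 ltry => /(_ isT).
by congr good; apply/funext => t; rewrite /ind indic0.
Qed.

Let L1_0 : L1 (fun _ : 'rV[R]_d => 0 : C).
Proof.
have m0 := @measurable0 _ (@Rd R d).
have := @L1_ind set0 m0; rewrite measure0 ltry => /(_ isT).
by congr L1; apply/funext => t; rewrite /ind indic0.
Qed.

Import HBSimple.

Lemma good_sfun (g : {sfun (@Rd R d) >-> R}) : mu.-integrable setT (fun t => (g t)%:E) ->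
  good (fun t => (g t)%:C).
Proof.
move=> ig; pose s := fset_set ((g : _ -> R) @` setT).
(* Markov's inequality. The value zero is excluded: its level set may have infinite measure, and it
   contributes nothing to the sum below. *)
have key r : r != 0 -> (mu (g @^-1` [set r]) < +oo)%E.
  move=> r0; have mr : measurable (g @^-1` [set r]) by exact: measurable_sfunP.
  have : (\int[mu]_t (`|r|%:E * (\1_(g @^-1` [set r]) t)%:E) < +oo)%E.
    case/integrableP : ig => mg; apply: le_lt_trans; apply: ge0_le_integral => //.
    - by apply: measurable_funeM; apply/measurable_EFinP; exact: measurable_indRd.
    - exact: measurableT_comp.
    - move=> t _ /=; rewrite lee_fin indicE.
      have [/set_mem /= ->|_] := boolP (t \in _); first by rewrite mulr1.
      by rewrite mulr0.
  rewrite ge0_integralZl_EFin //; last first.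
    by apply/measurable_EFinP; exact: measurable_indRd.
  rewrite integral_indic // setIT => H; rewrite ltey; apply/eqP => E.
  have : (`|r|%:E * +oo < +oo)%E by rewrite -[X in (_ * X < _)%E]E.
  by rewrite gt0_muley ?ltxx // lte_fin normr_gt0.
have : forall (I : seq R), L1 (fun t => \sum_(r <- I) r%:C * ind (g @^-1` [set r]) t) /\
    good (fun t => \sum_(r <- I) r%:C * ind (g @^-1` [set r]) t).
  elim => [|r I [LI kI]].
    rewrite (_ : (fun t => _) = fun=> 0) //; by apply/funext => t; rewrite big_nil.
  have [->|r0] := eqVneq r 0.
    rewrite (_ : (fun t => _) = fun t => \sum_(r <- I) r%:C * ind (g @^-1` [set r]) t) //.
    by apply/funext => t; rewrite big_cons mul0r add0r.
  rewrite (_ : (fun t => _) = fun t => r%:C * ind (g @^-1` [set r]) t +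
      \sum_(r <- I) r%:C * ind (g @^-1` [set r]) t); last first.
    by apply/funext => t; rewrite big_cons.
  have mr : measurable (g @^-1` [set r]) by exact: measurable_sfunP.
  have Lr := L1_ind mr (key r r0).
  split; first exact: L1_lin.
  by apply: good_lin => //; apply: good_finite => //; exact: key.
move=> /(_ (finmap.enum_fset s))[_].
congr good; apply/funext => t; rewrite fimfunE fsbig_finite // rmorph_sum /=.
by apply: eq_bigr => i _; rewrite rmorphM.
Qed.

Lemma good_real h : mu.-integrable setT (EFin \o h) -> good (fun t => (h t)%:C).
Proof.
move=> ih; apply: good_closed; first exact: L1_real.
have [g [ig _ gcvg]] := approximation_sfun_integrable measurableT ih.
move=> e e0; have [n Hn] := cvg0_fine gcvg e0.
exists (fun t => (g n t)%:C); split; [exact: L1_real|exact: (good_sfun (ig n))|].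
rewrite (_ : (fun t => _) = fun t => (h t - g n t)%:C); last first.
  by apply/funext => t; rewrite mulN1r -rmorphB.
rewrite L1norm_real //; have := integrableB measurableT ih (ig n).
by congr (mu.-integrable _ _).
Qed.

Theorem L1_density f : L1 f -> good f.
Proof.
move=> Lf; have /L1P[[mr mi] inf] := Lf.
have ir : mu.-integrable setT (EFin \o (fun t => complex.Re (f t))).
  apply: le_integrable inf => //; first exact/measurable_EFinP.
  by move=> t _ /=; rewrite lee_fin [leRHS]ger0_norm ?nrm_ge0 // Re_le_nrm.
have ii : mu.-integrable setT (EFin \o (fun t => complex.Im (f t))).
  apply: le_integrable inf => //; first exact/measurable_EFinP.
  by move=> t _ /=; rewrite lee_fin [leRHS]ger0_norm ?nrm_ge0 // Im_le_nrm.
have := good_lin 'i%C (L1_real ii) (L1_real ir) (good_real ii) (good_real ir).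
by congr good; apply/funext => t; rewrite [RHS]complexE addrC.
Qed.

End density.

End L1_theory.

(** * Convolution and translation in L^1 *)

Section reflection.
Context {R : realType}.
Local Notation C := R[i].
Local Notation lam := (@lebesgue_measure R).

Lemma measurable_reflect1 (a : R) : measurable_fun setT (fun s : measurableTypeR R => a - s : measurableTypeR R).
Proof. by apply: measurable_funB; [exact: measurable_cst|exact: measurable_id]. Qed.

(** Uniqueness of Lebesgue measure reduces the claim to half-open intervals. Reflection moves the
    closed end to the other side, which does not change the length. *)
Lemma lebesgue_measure_reflect (a : R) (A : set R) : measurable A ->
  lam A = lam ((fun s => a - s) @^-1` A).
Proof.
move=> mA.
pose m : {measure set (measurableTypeR R) -> \bar R} :=
  measure_function_pushforward__canonical__measure_function_Measure
    lam (measurable_reflect1 a).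
apply: (@lebesgue_measure_unique R m) => // _ [[x y]] _ <-.
rewrite /m /= /pushforward.
have -> : (fun s : R => a - s) @^-1` `]x, y]%classic = `[a - y, a - x[%classic.
  apply/seteqP; split => s /=; rewrite !in_itv /= => /andP[? ?]; apply/andP; split; lra.
rewrite !lebesgue_measure_itv /= !lte_fin.
have -> : (a - y < a - x) = (x < y) by rewrite ltrD2l ltrN2.
case: ifP => // _; rewrite -!EFinB; congr (_%:E); lra.
Qed.

Lemma lebesgue_integral_reflect (a : R) (F : R -> \bar R) : measurable_fun setT F ->
  (forall s, 0 <= F s)%E -> (\int[lam]_s F (a - s)%R = \int[lam]_s F s)%E.
Proof.
move=> mF F0.
have := @ge0_integral_pushforward _ _ _ _ R _ (measurable_reflect1 a) lam setT F measurableT mF (fun y _ => F0 y).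
rewrite preimage_setT => <-; apply: eq_measure_integral; first exact: measurable_reflect1.
move=> mr A mA _.
by rewrite [RHS](lebesgue_measure_reflect a).
Qed.

Lemma consV_reflect d (t : 'rV[R]_d.+1) (s : R) (v : 'rV[R]_d) :
  t - consV (s, v) = consV (t ord0 ord0 - s, (unconsV t).2 - v).
Proof.
apply/rowP => j; have [j' ->|->] := unliftP ord0 j.
  by rewrite mxE consVS mxE consVS !mxE.
by rewrite mxE consV0 mxE consV0.
Qed.

Lemma measurable_reflect d (t : 'rV[R]_d) :
  measurable_fun setT ((fun s => t - s) : @Rd R d -> @Rd R d).
Proof.
apply: measurable_fun_openP => U oU; apply: sub_sigma_algebra.
apply: (open_comp _ oU) => s _; apply: continuousB; [exact: cst_continuous|exact: cvg_id].
Qed.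

Lemma intRd_reflect d (t : 'rV[R]_d) (f : 'rV[R]_d -> \bar R) :
  measurable_fun setT (f : @Rd R d -> \bar R) -> (forall s, 0 <= f s)%E ->
  intRd (fun s => f (t - s)) = intRd f.
Proof.
elim: d t f => [|d IH] t f mf f0.
  by rewrite /=; congr f; apply/rowP => -[].
rewrite /=.
have E s : intRd (fun v : 'rV[R]_d => f (t - row_mx (const_mx s : 'rV[R]_1) v)) =
    intRd (fun v : 'rV[R]_d => f (consV (t ord0 ord0 - s, v))).
  have := IH (unconsV t).2 (fun v => f (consV (t ord0 ord0 - s, v))) _ _.
  rewrite -[intRd (fun s0 : 'rV_d => _)](_ : intRd (fun v : 'rV[R]_d => f (t - row_mx (const_mx s : 'rV[R]_1) v)) = _).
    apply => //; exact: (measurableT_comp mf (@measurable_consVr R d (t ord0 ord0 - s))).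
  by congr intRd; apply/funext => v; rewrite -consV_reflect.
under eq_integral do rewrite E.
rewrite (lebesgue_integral_reflect (t ord0 ord0) (F := fun s => intRd (fun v : 'rV[R]_d => f (consV (s, v))))) //.
- have mfc : measurable_fun setT ((fun p => f (@consV R d p)) : measurableTypeR R * @Rd R d -> \bar R).
    exact: (measurableT_comp mf (@measurable_consV R d)).
  have := @measurable_fun_fubini_tonelli_F _ _ _ _ R (@mu_Rd R d) _ mfc (fun p => f0 _).
  congr (measurable_fun _ _); apply/funext => s; rewrite /fubini_F intRd_ge0E //.
  exact: (measurableT_comp mf (@measurable_consVr R d s)).
- move=> s; rewrite intRd_ge0E //; first by apply: integral_ge0.
  exact: (measurableT_comp mf (@measurable_consVr R d s)).
Qed.

(** Peetre's inequality. It keeps [domRd] stable under reflections, and hence under translations,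
    each being a product of two reflections. *)
Lemma ker1_reflect (t s : R) : ker1 (t - s) <= 2 * (1 + t ^+ 2) * ker1 s.
Proof.
rewrite /ker1 ler_pdivlMr ?ltr_pwDl ?sqr_ge0 // mulrC ler_pdivrMr ?ltr_pwDl ?sqr_ge0 //.
have := sqr_ge0 (t - (t - s)); have := sqr_ge0 (t + (t - s)).
have := sqr_ge0 (t * (t - s)); nra.
Qed.

Lemma domRd_reflect d (t : 'rV[R]_d) (f : 'rV[R]_d -> R) : domRd f -> domRd (fun s => f (t - s)).
Proof.
move=> [mf [M fM]]; split; first exact: (measurableT_comp mf (@measurable_reflect d t)).
exists (`|M| * \prod_(j < d) (2 * (1 + t ord0 j ^+ 2))) => s.
apply: (le_trans (fM _)); rewrite -mulrA; apply: (@le_trans _ _ (`|M| * kerRd (t - s))).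
  by rewrite ler_wpM2r ?kerRd_ge0 // ler_norm.
rewrite ler_wpM2l // -big_split /=; apply: ler_prod => j _.
by rewrite ker1_ge0 /= !mxE ker1_reflect.
Qed.

Lemma RintRd_reflect d (t : 'rV[R]_d) (f : 'rV[R]_d -> R) : domRd f ->
  RintRd (fun s => f (t - s)) = RintRd f.
Proof.
move=> df; have pos g : domRd g -> (forall s, 0 <= g s) ->
    RintRd (fun s => g (t - s)) = RintRd g.
  move=> [mg _] g0; rewrite /RintRd (@intRd_reflect d t (fun s => (g s)%:E)) //.
  by apply/measurable_EFinP.
(* [intRd_reflect] rests on Tonelli and covers nonnegative functions only, hence the split into
   positive and negative parts. *)
pose p s := (`|f s| + f s) / 2; pose n s := (`|f s| - f s) / 2.
have half g : domRd g -> domRd (fun s => g s / 2).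
  by move=> /(domRdZ 2^-1); congr domRd; apply/funext => s; rewrite mulrC.
have dp : domRd p by apply: half; apply: domRdD => //; exact: domRd_norm.
have dn : domRd n by apply: half; apply: domRdB => //; exact: domRd_norm.
have E : f = fun s => p s - n s by apply/funext => s; rewrite /p /n; lra.
transitivity (RintRd (fun s => p (t - s)) - RintRd (fun s => n (t - s))).
  rewrite -RintRdB; [|exact: domRd_reflect|exact: domRd_reflect].
  by congr RintRd; apply/funext => s; rewrite {1}E.
rewrite !pos //.
- by rewrite -RintRdB // -E.
- by move=> s; rewrite divr_ge0 // subr_ge0 ler_norm.
- by move=> s; rewrite divr_ge0 //; have := ler_norm (- f s); rewrite normrN; lra.
Qed.

Lemma RintRd_shift d (t : 'rV[R]_d) (f : 'rV[R]_d -> R) : domRd f ->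
  RintRd (fun s => f (s + t)) = RintRd f.
Proof.
move=> df; rewrite -(RintRd_reflect t df) -(RintRd_reflect 0 (domRd_reflect t df)).
by congr RintRd; apply/funext => s; rewrite sub0r opprK addrC.
Qed.

Lemma domRd_shift d (t : 'rV[R]_d) (f : 'rV[R]_d -> R) : domRd f -> domRd (fun s => f (s + t)).
Proof.
move=> df; have := domRd_reflect 0 (domRd_reflect t df).
by congr domRd; apply/funext => s; rewrite sub0r opprK addrC.
Qed.

(** Through [mod_conv] this lets a window be exchanged with the action of a bounded function. *)
Lemma conv_comm d (f g : 'rV[R]_d -> C) : Cmeas f -> Cmeas g ->
  (exists M : R, forall t, nrm (f t) <= M * kerRd t) -> (exists M : R, forall t, nrm (g t) <= M) ->
  Defs.conv f g = Defs.conv g f.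
Proof.
move=> mf mg [M fM] [N gN]; apply/funext => t.
have mgr : Cmeas (fun s => g (t - s)).
  by case: mg => m1 m2; split; [exact: (measurableT_comp m1 (@measurable_reflect d t))
    |exact: (measurableT_comp m2 (@measurable_reflect d t))].
have dk : domRd (fun s => (`|M| * `|N|) * @kerRd R d s) by apply: domRdZ; exact: domRd_kerRd.
have [|d1 d2] := domRd_ReIm (CmeasM mf mgr) dk.
  move=> s; rewrite nrmM [X in _ <= X](_ : _ = (`|M| * kerRd s) * `|N|); last by ring.
  apply: ler_pM; rewrite ?nrm_ge0 //.
    by apply: (le_trans (fM s)); rewrite ler_wpM2r ?kerRd_ge0 // ler_norm.
  exact: le_trans (gN _) (ler_norm _).
rewrite /Defs.conv /cintRd -(RintRd_reflect t d1) -(RintRd_reflect t d2).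
congr (_ +i* _); congr RintRd; apply/funext => s; rewrite subKr mulrC //.
Qed.

Lemma L1norm_shift_open d (U : set 'rV[R]_d) n : open U -> U `<=` Q n ->
  forall e : R, 0 < e -> exists2 delta : R, 0 < delta & forall t : 'rV[R]_d, `|t| < delta ->
    L1 (Defs.shift (fun s => (\1_U s : R)%:C) t) /\
    L1norm (fun s => Defs.shift (fun s => (\1_U s : R)%:C) t s + -1 * (\1_U s : R)%:C) <= e.
Proof.
move=> oU UQ e e0.
(* Points whose ball of radius [1 / (m + 1)] stays inside [U]. The complement of [W m] is open, so
   [W m] is measurable, and the sets [W m] exhaust [U]. *)
pose W m : set (@Rd R d) := [set s | forall t : 'rV[R]_d, `|t| < m.+1%:R^-1 -> U (s + t)].
have mU : measurable (U : set (@Rd R d)) by exact: measurable_openRd.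
have mW m : measurable (W m).
  rewrite -[W m]setCK; apply: measurableC; apply: measurable_openRd.
  have -> : ~` W m = \bigcup_(y in ~` U) ball (y : 'rV[R]_d) (m.+1%:R^-1).
    apply/seteqP; split => s /=.
      move=> /existsNP[t /not_implyP[tm nU]]; exists (s + t) => //.
      by rewrite mx_norm_ball /ball_ /= addrC addKr.
    move=> [y nU]; rewrite mx_norm_ball /ball_ /= => ys Ws; apply: nU.
    by have := Ws (y - s) ys; rewrite addrC subrK.
  by apply: bigcup_open => y _; exact: ball_open.
have WU m : W m `<=` U.
  by move=> s /(_ 0); rewrite addr0 normr0; apply; rewrite invr_gt0.
have lU : (mu_Rd d (U : set (@Rd R d)) < +oo)%E by exact: mu_Q_lty mU UQ.
pose G m := (U : set (@Rd R d)) `\` W m.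
have mG m : measurable (G m) by exact: measurableD.
have G0 : \bigcap_m G m = set0.
  rewrite -subset0 => s Gs; have [Us _] := Gs 0%N I.
  have /nbhs_ballP[r /= r0 Hr] : nbhs (s : 'rV[R]_d) U by exact: open_nbhs_nbhs.
  have [k Hk] := ltr_add_invr r0; rewrite add0r in Hk.
  have [_] := Gs k I; apply => t tk; apply: Hr; rewrite mx_norm_ball /ball_ /=.
  by rewrite opprD addrA subrr sub0r normrN (lt_trans tk).
have : mu_Rd d (G m) @[m --> \oo] --> mu_Rd d (\bigcap_m G m).
  apply: nonincreasing_cvg_mu => //.
  - by apply: le_lt_trans lU; apply: le_measure; rewrite ?inE //; exact: subDsetl.
  - by rewrite G0.
  - move=> m m' mm'; apply/subsetPset; apply: setDS => s Ws t tm; apply: Ws.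
    by apply: lt_le_trans tm _; rewrite lef_pV2 ?posrE ?ltr0n // ler_nat ltnS.
rewrite G0 measure0 => /fine_cvgP[_] /cvgrPdist_le /(_ (e / 2)).
rewrite divr_gt0 // => /(_ isT)[m _ /(_ m (leqnn m))]; rewrite /= sub0r normrN => Hm.
have GQ : G m `<=` Q n by move=> s [/UQ].
have dU := domRd_indic mU UQ; have dG := domRd_indic (mG m) GQ.
have IG : RintRd (\1_(G m) : 'rV[R]_d -> R) <= e / 2.
  rewrite RintRdE // /Rintegral integral_indic // setIT.
  exact: le_trans (ler_norm _) Hm.
exists (m.+1%:R^-1) => [|t tm]; first by rewrite invr_gt0.
set f := (fun s : 'rV[R]_d => (\1_U s : R)%:C).
have dUt := domRd_shift t dU.
have mf : Cmeas f by apply: Cmeas_real; case: dU.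
have mft : Cmeas (Defs.shift f t) by apply: (@Cmeas_real _ d (fun s => \1_U (s + t))); case: dUt.
have Lft : L1 (Defs.shift f t).
  apply: (Cmeas_L1 mft dUt _).1 => s; rewrite /Defs.shift /f nrm_real ger0_norm //.
split => //.
(* The absolute value of the difference is the signed difference plus twice the part where a point
   leaves [U]. The signed part integrates to zero by translation invariance, and leaving [U] under a
   short translation happens only on [G m]. *)
pose g s : R := (\1_U (s + t) - \1_U s) + 2 * \1_(G m) s.
have dg : domRd g by apply: domRdD; [exact: domRdB|exact: domRdZ].
have mff : Cmeas (fun s => Defs.shift f t s + -1 * f s) by apply: CmeasD => //; exact: CmeasZ.
have H s : nrm (Defs.shift f t s + -1 * f s) <= g s.
  rewrite /Defs.shift /f mulN1r -rmorphB /= nrm_real /g.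
  have [Us|Us] := pselect (U s); have [Ut|Ut] := pselect (U (s + t)).
  - by rewrite !indicE (mem_set Us) (mem_set Ut) subrr normr0 add0r mulr_ge0.
  - have Gs : G m s by split => // Ws; apply: Ut; exact: Ws.
    rewrite !indicE (mem_set Us) (memNset Ut) (mem_set Gs) /= sub0r normrN normr1; lra.
  - by rewrite !indicE (memNset Us) (mem_set Ut) /= subr0 normr1 lerDl mulr_ge0.
  - by rewrite !indicE (memNset Us) (memNset Ut) /= subrr normr0 add0r mulr_ge0.
apply: (le_trans (Cmeas_L1 mff dg H).2); rewrite /g RintRdD //.
- rewrite RintRdB // RintRdZ // RintRd_shift // subrr add0r; lra.
- exact: domRdB.
- exact: domRdZ.
Qed.

End reflection.

(** * L^1-modules *)

Section dimension.
Context {R : realType} {d : nat}.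
Local Notation C := R[i].
Local Notation BS := (completeNormedModType C).
Local Notation bl := is_bounded_linear.

Section module.
Variables U V : BS.
Variable T : 'rV[R]_d -> (U -> V) -> (U -> V).
Variable act : ('rV[R]_d -> C) -> (U -> V) -> (U -> V).
Hypothesis rep : is_isometric_rep T.
Hypothesis mod : is_L1_module T act.
Implicit Types (A B : U -> V) (f g : 'rV[R]_d -> C) (t : 'rV[R]_d).

Lemma T_bl t A : bl A -> bl (T t A).
Proof. by case: rep => + _ _ _ _; apply. Qed.

Lemma T_norm t A : bl A -> opnorm (T t A) = opnorm A.
Proof. by case: rep => _ _ + _ _; apply. Qed.

Lemma T0 A : bl A -> T 0 A = A.
Proof. by case: rep => _ _ _ + _; apply. Qed.

Lemma TD s t A : bl A -> T (s + t) A = T s (T t A).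
Proof. by case: rep => _ _ _ _; apply. Qed.

Lemma T_lin t a A B : bl A -> bl B -> T t (opadd (opscale a A) B) = opadd (opscale a (T t A)) (T t B).
Proof. by case: rep => _ + _ _ _; apply. Qed.

Lemma T_sub t A B : bl A -> bl B -> T t (opsub A B) = opsub (T t A) (T t B).
Proof. by move=> bA bB; rewrite /opsub T_lin. Qed.

Lemma T_zero t : T t (@opzero R U V) = @opzero R U V.
Proof.
have b0 := @bl_opzero R U V.
by apply: opnorm0_eq; rewrite ?T_norm ?opnorm_opzero //; exact: T_bl.
Qed.

Lemma T_scale t a A : bl A -> T t (opscale a A) = opscale a (T t A).
Proof.
move=> bA; have := T_lin t a bA (@bl_opzero R U V); rewrite T_zero.
have E (B : U -> V) : opadd B (@opzero R U V) = B by apply/funext => u; rewrite /opadd /opzero addr0.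
by rewrite !E.
Qed.

Lemma act_bl f A : L1 f -> bl A -> bl (act f A).
Proof. exact: (mod_closed mod). Qed.

Lemma act_subl f g A : L1 f -> L1 g -> bl A ->
  act (fun t => f t + -1 * g t) A = opsub (act f A) (act g A).
Proof.
move=> Lf Lg bA; rewrite /opsub -(mod_linl mod) //; congr (act _ A).
by apply/funext => t; rewrite addrC.
Qed.

Lemma L1_sub f g : L1 f -> L1 g -> L1 (fun t => f t + -1 * g t).
Proof.
move=> Lf Lg; have := L1_lin (-1) Lg Lf.
by congr L1; apply/funext => t; rewrite addrC.
Qed.

Lemma act_subr f A B : L1 f -> bl A -> bl B -> act f (opsub A B) = opsub (act f A) (act f B).
Proof. by move=> Lf bA bB; rewrite /opsub (mod_linr mod). Qed.

Lemma act_zero f : L1 f -> act f (@opzero R U V) = @opzero R U V.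
Proof.
move=> Lf; have b0 := @bl_opzero R U V; have bf := act_bl Lf b0.
apply: opnorm0_eq => //; apply/eqP; rewrite eq_le opnorm_ge0 // andbT.
by have := mod_norm mod Lf b0; rewrite opnorm_opzero mulr0.
Qed.

Lemma act_scale f a A : L1 f -> bl A -> act f (opscale a A) = opscale a (act f A).
Proof.
move=> Lf bA; have := mod_linr mod a Lf bA (@bl_opzero R U V); rewrite act_zero //.
have E (B : U -> V) : opadd B (@opzero R U V) = B by apply/funext => u; rewrite /opadd /opzero addr0.
by rewrite !E.
Qed.

Lemma L1_cst0 : L1 (fun _ : 'rV[R]_d => 0 : C).
Proof.
have dk := @domRd_kerRd R d; have [|//] := Cmeas_L1 (Cmeas_cst d (0 : C)) dk.
by move=> t; rewrite nrm0 kerRd_ge0.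
Qed.

Lemma act_fun0 A : bl A -> act (fun=> 0) A = @opzero R U V.
Proof.
move=> bA; have := act_subl L1_cst0 L1_cst0 bA.
rewrite (_ : (fun t : 'rV[R]_d => _) = fun=> 0); last by apply/funext => t; rewrite mulr0 addr0.
by move=> ->; apply/funext => u; rewrite opsubE subrr.
Qed.

Lemma L1_sum I (r : seq I) (c : I -> C) (F : I -> 'rV[R]_d -> C) : (forall i, L1 (F i)) ->
  L1 (fun t => \sum_(i <- r) c i * F i t).
Proof.
move=> LF; elim: r => [|i r IH].
  by have := L1_cst0; congr L1; apply/funext => t; rewrite big_nil.
have := L1_lin (c i) (LF i) IH.
by congr L1; apply/funext => t; rewrite big_cons.
Qed.

Lemma act_suml I (r : seq I) (c : I -> C) (F : I -> 'rV[R]_d -> C) A :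
  (forall i, L1 (F i)) -> bl A ->
  act (fun t => \sum_(i <- r) c i * F i t) A = opsum r c (fun i => act (F i) A).
Proof.
move=> LF bA; elim: r => [|i r IH].
  rewrite opsum_nil -(act_fun0 bA); congr (act _ A).
  by apply/funext => t; rewrite big_nil.
rewrite opsum_cons -IH -(mod_linl mod) //; last exact: L1_sum.
by congr (act _ A); apply/funext => t; rewrite big_cons.
Qed.

Lemma act_sumr I (r : seq I) (c : I -> C) (F : I -> U -> V) f :
  L1 f -> (forall i, bl (F i)) -> act f (opsum r c F) = opsum r c (fun i => act f (F i)).
Proof.
move=> Lf bF; elim: r => [|i r IH]; first by rewrite !opsum_nil act_zero.
by rewrite !opsum_cons (mod_linr mod) // ?IH //; exact: bl_sum.
Qed.

(** Since [T t A - T t0 A = T t0 (T (t - t0) A - A)] and [T t0] is isometric, continuity at the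
    origin suffices. *)
Lemma Tc_intro A : bl A ->
  (forall e : R, 0 < e -> exists2 delta : R, 0 < delta &
     forall t, `|t| < delta -> opnorm (opsub (T t A) A) <= e) -> T_continuous T A.
Proof.
move=> bA H t0 e e0; have [|delta d0 Hd] := H (e / 2); first by rewrite divr_gt0.
exists delta => // t td; rewrite -opsubEf.
have -> : opsub (T t A) (T t0 A) = T t0 (opsub (T (t - t0) A) A).
  by rewrite T_sub //; [rewrite -TD // addrC subrK|exact: T_bl].
rewrite T_norm; last by apply: bl_sub => //; exact: T_bl.
by apply: le_lt_trans (Hd _ td) _; rewrite ltr_pdivrMr // ltr_pMr // ltr1n.
Qed.

Lemma Tc_elim A (e : R) : bl A -> T_continuous T A -> 0 < e ->
  exists2 delta : R, 0 < delta & forall t, `|t| < delta -> opnorm (opsub (T t A) A) <= e.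
Proof.
move=> bA cA e0; have [delta d0 H] := cA 0 e e0; exists delta => // t td.
by have := H t; rewrite subr0 T0 // -opsubEf => /(_ td)/ltW.
Qed.

(** The axiom [mod_shift] converts continuity of translation of [f] in L^1 into [T]-continuity of
    [f A], whether or not [A] is [T]-continuous. *)
Lemma Tc_act f A : L1 f -> bl A ->
  (forall e : R, 0 < e -> exists2 delta : R, 0 < delta & forall t, `|t| < delta ->
     L1 (Defs.shift f t) /\ L1norm (fun s => Defs.shift f t s + -1 * f s) <= e) ->
  T_continuous T (act f A).
Proof.
move=> Lf bA H; apply: Tc_intro; first exact: act_bl.
move=> e e0; have A0 : 0 < opnorm A + 1 by rewrite ltr_wpDl // opnorm_ge0.
have [|delta d0 Hd] := H (e / (opnorm A + 1)); first by rewrite divr_gt0.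
exists delta => // t td; have [Lft Hft] := Hd t td.
rewrite (mod_shift mod) // -act_subl //.
apply: (le_trans (mod_norm mod (L1_sub Lft Lf) bA)).
apply: (@le_trans _ _ (e / (opnorm A + 1) * opnorm A)).
  by rewrite ler_wpM2r // opnorm_ge0.
by rewrite -mulrA ler_piMr ?(ltW e0) // mulrC ler_pdivrMr // mul1r lerDl.
Qed.

Lemma Tc_lim A : bl A -> (forall e : R, 0 < e -> exists B,
  [/\ bl B, T_continuous T B & opnorm (opsub B A) <= e]) -> T_continuous T A.
Proof.
move=> bA H; apply: Tc_intro => // e e0.
have [|B [bB cB BA]] := H (e / 4); first by rewrite divr_gt0.
have [|delta d0 Hd] := @Tc_elim B (e / 4) bB cB; first by rewrite divr_gt0.
exists delta => // t td; have bT := T_bl t bA; have bTB := T_bl t bB.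
rewrite (le_trans (opnorm_triangle bT bTB bA)) //.
rewrite (le_trans (lerD (lexx _) (opnorm_triangle bTB bB bA))) //.
have -> : opnorm (opsub (T t A) (T t B)) = opnorm (opsub B A).
  by rewrite -T_sub // T_norm; [exact: opnorm_subC|exact: bl_sub].
by have := Hd t td; lra.
Qed.

Lemma Tc_lin a A B : bl A -> bl B -> T_continuous T A -> T_continuous T B ->
  T_continuous T (opadd (opscale a A) B).
Proof.
move=> bA bB cA cB; have bS : bl (opadd (opscale a A) B) by apply: bl_add => //; exact: bl_scale.
apply: Tc_intro => // e e0.
have a0 : 0 < nrm a + 1 by rewrite ltr_wpDl // nrm_ge0.
have [|d1 d10 H1] := @Tc_elim A (e / 2 / (nrm a + 1)) bA cA; first by rewrite !divr_gt0.
have [|d2 d20 H2] := @Tc_elim B (e / 2) bB cB; first by rewrite divr_gt0.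
exists (Num.min d1 d2) => [|t]; first by rewrite lt_min d10.
rewrite lt_min => /andP[t1 t2].
have -> : opsub (T t (opadd (opscale a A) B)) (opadd (opscale a A) B) =
    opadd (opscale a (opsub (T t A) A)) (opsub (T t B) B).
  apply/funext => u; rewrite T_lin // /opadd /opscale !opsubE scalerBr.
  by rewrite opprD addrACA.
have b1 := bl_sub (T_bl t bA) bA; have b2 := bl_sub (T_bl t bB) bB.
rewrite (le_trans (opnorm_add (bl_scale a b1) b2)) // [leRHS]splitr lerD ?H2 //.
rewrite (le_trans (opnorm_scale_le _ b1)) //.
apply: (@le_trans _ _ (nrm a * (e / 2 / (nrm a + 1)))); first by rewrite ler_wpM2l ?nrm_ge0 // H1.
by rewrite mulrCA ler_piMr ?divr_ge0 ?(ltW e0) // ler_pdivrMr // mul1r lerDl.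
Qed.

Lemma Tc_zero : T_continuous T (@opzero R U V).
Proof.
have b0 := @bl_opzero R U V; apply: Tc_intro => // e e0; exists 1 => // t _.
rewrite T_zero; apply: opnorm_le; first exact: ltW.
by move=> u; rewrite opsubE subrr nrm0 mulr_ge0 ?nrm_ge0 // ltW.
Qed.

(** * Localisation in frequency *)

Definition ev (j : 'I_d) (h : R) : 'rV[R]_d := \row_i (if i == j then h else 0).

Definition dop (z : C) (e : 'rV[R]_d) A : U -> V := opsub (opscale z (T e A)) A.

Lemma dop_bl z e A : bl A -> bl (dop z e A).
Proof. by move=> bA; apply: bl_sub => //; apply: bl_scale; exact: T_bl. Qed.

Lemma iter_dop_bl z e k A : bl A -> bl (iter k (dop z e) A).
Proof. by move=> bA; elim: k => // k IH; exact: dop_bl. Qed.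

Lemma dop_lin z e a A B : bl A -> bl B ->
  dop z e (opadd (opscale a A) B) = opadd (opscale a (dop z e A)) (dop z e B).
Proof.
move=> bA bB; rewrite /dop T_lin //; apply/funext => u.
rewrite !opsubE /opadd /opscale !opsubE scalerDr scalerBr !scalerA [z * a]mulrC.
by rewrite opprD addrACA.
Qed.

Lemma iter_dop_lin z e k a A B : bl A -> bl B ->
  iter k (dop z e) (opadd (opscale a A) B) =
  opadd (opscale a (iter k (dop z e) A)) (iter k (dop z e) B).
Proof.
move=> bA bB; elim: k => // k IH.
by rewrite !iterS IH dop_lin //; exact: iter_dop_bl.
Qed.

Lemma act_dop f z e A : L1 f -> bl A -> act f (dop z e A) = dop z e (act f A).
Proof.
move=> Lf bA; have bT := T_bl e bA; rewrite /dop act_subr //; last exact: bl_scale.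
by rewrite act_scale // (mod_shift' mod).
Qed.

(** The kernel through which [(z T(h e_j) - 1)^k], with [z = e^{-i n_j h}], acts on [phi1 n A]: a
    [k]-th difference replaces the [j]-th Fejer factor, while the modulation is left alone. *)
Definition phi_dif (j : 'I_d) (h : R) (k : nat) (n : 'rV[int]_d) : 'rV[R]_d -> C :=
  fun t => \prod_(i < d) ((if i == j then iter k (dif h) (@fejer R) (t ord0 i)
                           else fejer (t ord0 i))%:C * expi ((n ord0 i)%:~R * t ord0 i)).

Lemma phi_dif0 j h n : phi_dif j h 0 n = phi1 n.
Proof. by apply/funext => t; apply: eq_bigr => i _; case: eqP. Qed.

Lemma continuous_iter_dif h k : continuous (iter k (dif h) (@fejer R)).
Proof.
elim: k => [|k IH] s; first exact: continuous_fejer.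
rewrite iterS /dif; apply: cvgB; last exact: IH.
have cc : continuous (iter k (dif h) (@fejer R) \o (fun x => x + h)).
  move=> x; apply: continuous_comp; last exact: IH.
  by apply: cvgD; [exact: cvg_id|exact: cvg_cst].
exact: cc.
Qed.

Lemma Cmeas_phi_dif j h k n : Cmeas (phi_dif j h k n).
Proof.
have mi l : measurable_fun setT (iter l (dif h) (@fejer R)).
  exact: continuous_measurable_fun (@continuous_iter_dif h l).
have := CmeasM (@Cmeas_real R d (fun t => \prod_(i < d)
  (if i == j then iter k (dif h) (@fejer R) (t ord0 i) else fejer (t ord0 i))) _) (Cmeas_chi n).
have E : (fun t : 'rV[R]_d => (\prod_(i < d)
    (if i == j then iter k (dif h) (@fejer R) (t ord0 i) else fejer (t ord0 i)))%:C * chi n t) =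
    phi_dif j h k n.
  by apply/funext => t; rewrite /chi /phi_dif rmorph_prod -big_split.
rewrite E; apply.
apply: (@measurable_prod_coord R d (fun i s => if i == j then iter k (dif h) (@fejer R) s else fejer s)).
by move=> i; case: eqP => _; [exact: mi|exact: measurable_fejer].
Qed.

Lemma nrm_phi_dif_le j h k n t : 0 < h <= 1 ->
  nrm (phi_dif j h k n t) <= (8 * 2 ^+ d) * (8 * h) ^+ k * kerRd t.
Proof.
move=> hh; have /andP[h0 _] := hh.
have h8 : 0 <= (8 * h) ^+ k by rewrite exprn_ge0 // mulr_ge0 // ltW.
rewrite nrm_prod (bigD1 j) //= eqxx nrmM nrm_expi mulr1 nrm_real.
rewrite /kerRd [in leRHS](bigD1 j) //=.
have P : \prod_(i < d | i != j) nrm ((if i == j then iter k (dif h) (@fejer R) (t ord0 i)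
     else fejer (t ord0 i))%:C * expi ((n ord0 i)%:~R * t ord0 i)) <=
    2 ^+ d * \prod_(i < d | i != j) ker1 (t ord0 i).
  apply: (@le_trans _ _ (\prod_(i < d | i != j) (2 * ker1 (t ord0 i)))).
    apply: ler_prod => i ij; rewrite nrm_ge0 (negbTE ij) nrmM nrm_expi mulr1 nrm_real.
    by rewrite ger0_norm ?fejer_ge0 // fejer_le_ker.
  rewrite big_split /= prodr_const ler_wpM2r //; first by apply: prodr_ge0 => i _; exact: ker1_ge0.
  by rewrite ler_weXn2l ?ler1n // -[X in (_ <= X)%N](card_ord d) max_card.
apply: (le_trans (ler_pM (normr_ge0 _) _ (fejer_dif_ker_le k (t ord0 j) hh) P)).
  by apply: prodr_ge0 => i _; exact: nrm_ge0.
rewrite le_eqVlt; apply/orP; left; apply/eqP; ring.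
Qed.

Lemma L1_phi_dif j h k n : 0 < h <= 1 -> L1 (phi_dif j h k n) /\
  L1norm (phi_dif j h k n) <= (8 * 2 ^+ d) * (8 * h) ^+ k * kerRd_int d.
Proof.
move=> hh; have dk := domRdZ ((8 * 2 ^+ d) * (8 * h) ^+ k) (@domRd_kerRd R d).
have := Cmeas_L1 (Cmeas_phi_dif j h k n) dk (fun t => nrm_phi_dif_le j k n t hh).
by rewrite RintRdZ ?RintRd_kerRd //; exact: domRd_kerRd.
Qed.

Definition phi_rest (j : 'I_d) (n : 'rV[int]_d) (t : 'rV[R]_d) : C :=
  \prod_(i < d | i != j) ((fejer (t ord0 i))%:C * expi ((n ord0 i)%:~R * t ord0 i)).

Lemma phi_difE j h k (n : 'rV[int]_d) t : phi_dif j h k n t =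
  (iter k (dif h) (@fejer R) (t ord0 j))%:C * expi ((n ord0 j)%:~R * t ord0 j) * phi_rest j n t.
Proof.
rewrite /phi_dif (bigD1 j) //= eqxx; congr (_ * _).
by apply: eq_bigr => i /negbTE ->.
Qed.

(** The phase cancels the one that the translation produces in the modulation, so only the Fejer
    factor is differenced. *)
Lemma phi_dif_shift j h k (n : 'rV[int]_d) t :
  expi (- ((n ord0 j)%:~R * h)) * Defs.shift (phi_dif j h k n) (ev j h) t + -1 * phi_dif j h k n t =
  phi_dif j h k.+1 n t.
Proof.
rewrite /Defs.shift !phi_difE !mxE eqxx.
have -> : phi_rest j n (t + ev j h) = phi_rest j n t.
  by apply: eq_bigr => i /negbTE ij; rewrite !mxE ij addr0.
have aux (a b c x y P : C) : a * b = 1 ->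
    a * (x * (c * b) * P) + -1 * (y * c * P) = (x - y) * c * P.
  move=> E; rewrite [LHS](_ : _ = (a * b) * (x * c * P) - y * c * P); last by ring.
  by rewrite E; ring.
rewrite mulrDr expiD iter_difSr rmorphB /=; apply: aux.
by rewrite -expiD addNr expi0.
Qed.

Lemma iter_dop_phi j h k (n : 'rV[int]_d) A : 0 < h <= 1 -> bl A ->
  iter k (dop (expi (- ((n ord0 j)%:~R * h))) (ev j h)) (act (phi1 n) A) =
  act (phi_dif j h k n) A.
Proof.
move=> hh bA; elim: k => [|k IH]; first by rewrite phi_dif0.
have [Lk _] := L1_phi_dif j k n hh; have [Lk1 _] := L1_phi_dif j k.+1 n hh.
rewrite iterS IH /dop (mod_shift mod) //.
have Ls : L1 (Defs.shift (phi_dif j h k n) (ev j h)).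
  have := L1_lin (expi ((n ord0 j)%:~R * h)) Lk1 (L1_lin (expi ((n ord0 j)%:~R * h)) Lk L1_cst0).
  congr L1; apply/funext => t; rewrite -phi_dif_shift.
  have E : expi ((n ord0 j)%:~R * h) * expi (- ((n ord0 j)%:~R * h)) = 1 :> C.
    by rewrite -expiD subrr expi0.
  by rewrite addr0 mulrDr mulrA E mul1r mulN1r mulrN subrK.
have -> : phi_dif j h k.+1 n = fun t => (expi (- ((n ord0 j)%:~R * h)) *
    Defs.shift (phi_dif j h k n) (ev j h) t + 0) + -1 * phi_dif j h k n t.
  by apply/funext => t; rewrite addr0 phi_dif_shift.
rewrite act_subl //; last exact: L1_lin L1_cst0.
rewrite (mod_linl mod) //; last exact: L1_cst0.
rewrite act_fun0 //; congr opsub; apply/funext => u.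
by rewrite /opadd /opzero addr0.
Qed.

(** Here 8 comes from [fejer_dif_ker_le] in the differenced coordinate and [2 ^+ d] bounds the
    factors 2 of [fejer_le_ker] in the others. *)
Definition phi_const : R := 8 * 2 ^+ d * kerRd_int d.

Lemma phi_const_ge0 : 0 <= phi_const.
Proof. by rewrite mulr_ge0 ?kerRd_int_ge0 // mulr_ge0 // exprn_ge0. Qed.

(* [loc] replaces the spectrum: it says that [A] lives on the frequencies where
   [z * T e] differs from [1] by at most [delta]. *)
Definition loc (z : C) (e : 'rV[R]_d) (K delta : R) A : Prop :=
  forall k, opnorm (iter k (dop z e) A) <= K * delta ^+ k.

Lemma loc_phi j h (n : 'rV[int]_d) A : 0 < h <= 1 -> bl A ->
  loc (expi (- ((n ord0 j)%:~R * h))) (ev j h) (phi_const * opnorm A) (8 * h) (act (phi1 n) A).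
Proof.
move=> hh bA k; rewrite iter_dop_phi //.
have [Lk Hk] := L1_phi_dif j k n hh.
rewrite (le_trans (mod_norm mod Lk bA)) //.
rewrite (_ : phi_const * _ * _ = phi_const * (8 * h) ^+ k * opnorm A); last by ring.
rewrite ler_wpM2r ?opnorm_ge0 // (le_trans Hk) // /phi_const.
by rewrite le_eqVlt; apply/orP; left; apply/eqP; ring.
Qed.

(** Put [E = phi_n A] and let [z1] be its own phase. Then [(z1 - z) E = z (z1 T - 1) E - z1 (z T -
    1) E], where the first difference has radius [8 * h] and the second, which commutes with the
    action, has radius [delta]. Iterating bounds [|z1 - z|^k ||E||] by a constant times
    [(8 h + delta)^k], which forces [E = 0]. *)
Lemma loc_vanish j h (n : 'rV[int]_d) z K delta A : 0 < h <= 1 -> bl A -> 0 <= K -> 0 <= delta ->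
  loc z (ev j h) K delta A -> nrm z = 1 ->
  8 * h + delta < nrm (expi (- ((n ord0 j)%:~R * h)) - z) ->
  act (phi1 n) A = @opzero R U V.
Proof.
move=> hh bA K0 de0 lA nz lt; set z1 := expi _ in lt.
have /andP[h0 _] := hh.
have L : L1 (@phi1 R d n) by rewrite -(phi_dif0 j h n); have [] := L1_phi_dif j 0 n hh.
have nz1 : nrm z1 = 1 by rewrite nrm_expi.
have h8 : 0 <= 8 * h by rewrite mulr_ge0 // ltW.
(* Both kinds of difference may already have been applied: [i] counts those at [z1], and [B] with
   [K'] accounts for those at [z]. Raising one of the two at each step sums to the binomial
   expansion of [(8 h + delta) ^ k]. *)
have key k : forall i B (K' : R), bl B -> 0 <= K' -> loc z (ev j h) K' delta B ->
    nrm (z1 - z) ^+ k * opnorm (iter i (dop z1 (ev j h)) (act (phi1 n) B)) <=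
    phi_const * K' * (8 * h) ^+ i * (8 * h + delta) ^+ k.
  elim: k => [|k IH] i B K' bB K'0 lB.
    rewrite expr0 mul1r mulr1; have := loc_phi j n hh bB i.
    move=> /le_trans; apply; rewrite ler_wpM2r ?exprn_ge0 // ler_wpM2l ?phi_const_ge0 //.
    by have := lB 0%N; rewrite expr0 mulr1.
  have bE B' : bl B' -> bl (iter i (dop z1 (ev j h)) (act (phi1 n) B')).
    by move=> bB'; apply: iter_dop_bl; exact: act_bl.
  have bD : bl (dop z (ev j h) B) by exact: dop_bl.
  have lD : loc z (ev j h) (K' * delta) delta (dop z (ev j h) B).
    by move=> m; rewrite -iterSr; have := lB m.+1; rewrite exprS mulrA.
  pose E := iter i (dop z1 (ev j h)) (act (phi1 n) B).
  have bEE : bl E by exact: bE.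
  have ID : opscale (z1 - z) E = opsub (opscale z (dop z1 (ev j h) E))
      (opscale z1 (iter i (dop z1 (ev j h)) (act (phi1 n) (dop z (ev j h) B)))).
    have -> : iter i (dop z1 (ev j h)) (act (phi1 n) (dop z (ev j h) B)) = dop z (ev j h) E.
      have LL : act (phi1 n) (dop z (ev j h) B) = dop z (ev j h) (act (phi1 n) B) by exact: act_dop.
      rewrite LL /dop /opsub; have := iter_dop_lin z1 (ev j h) i.
      move=> H; rewrite [opadd _ _](_ : _ = opadd (opscale z (T (ev j h) (act (phi1 n) B)))
          (opadd (opscale (-1) (act (phi1 n) B)) (@opzero R U V))); last first.
        by apply/funext => u; rewrite /opadd /opzero addr0 addrC.
      have ba := act_bl L bB; have bT := T_bl (ev j h) ba; have b0 := @bl_opzero R U V.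
      rewrite H //; last by apply: bl_add => //; exact: bl_scale.
      rewrite H // -/E.
      have -> : iter i (dop z1 (ev j h)) (@opzero R U V) = @opzero R U V.
        elim: (i) => // m IHm; rewrite iterS IHm /dop T_zero; apply/funext => u.
        by rewrite opsubE /opscale /opzero scaler0 subrr.
      have -> : iter i (dop z1 (ev j h)) (T (ev j h) (act (phi1 n) B)) = T (ev j h) E.
        rewrite /E; elim: (i) => // m IHm; rewrite !iterS IHm /dop.
        have bm := iter_dop_bl z1 (ev j h) m ba.
        by rewrite T_sub ?T_scale //; [exact: T_bl|apply: bl_scale; exact: T_bl].
      by apply/funext => u; rewrite /opadd /opzero addr0 addrC.
    apply/funext => u; rewrite opsubE /opscale /dop !opsubE /opscale !scalerBr !scalerA.
    by rewrite [z1 * z]mulrC opprB [RHS]addrC addrA subrK scalerBl.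
  have N : nrm (z1 - z) * opnorm E <= opnorm (dop z1 (ev j h) E) +
      opnorm (iter i (dop z1 (ev j h)) (act (phi1 n) (dop z (ev j h) B))).
    rewrite -opnorm_scale // ID (le_trans (opnorm_sub _ _)) //.
    - by apply: bl_scale; exact: dop_bl.
    - by apply: bl_scale; exact: bE.
    - by rewrite !opnorm_scale ?nz ?nz1 ?mul1r //; [exact: bE|exact: dop_bl].
  rewrite exprSr -mulrA; apply: (le_trans (ler_wpM2l (exprn_ge0 k (nrm_ge0 _)) N)).
  rewrite mulrDr; have H1 := IH i.+1 B K' bB K'0 lB.
  have H2 := IH i (dop z (ev j h) B) (K' * delta) bD (mulr_ge0 K'0 de0) lD.
  rewrite iterS -/E in H1; apply: (le_trans (lerD H1 H2)).
  by rewrite le_eqVlt; apply/orP; left; apply/eqP; rewrite !exprS; ring.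
have bE : bl (act (phi1 n) A) by exact: act_bl.
apply: opnorm0_eq => //; apply/eqP; rewrite eq_le opnorm_ge0 // andbT leNgt; apply/negP => E0.
have n0 : 0 < nrm (z1 - z) by rewrite (le_lt_trans _ lt) // addr_ge0.
pose q := (8 * h + delta) / nrm (z1 - z).
have q0 : 0 <= q by rewrite divr_ge0 ?nrm_ge0 // addr_ge0.
have q1 : q < 1 by rewrite ltr_pdivrMr // mul1r.
have Hq k : opnorm (act (phi1 n) A) <= phi_const * K * q ^+ k.
  have := key k 0%N A K bA K0 lA; rewrite expr0 mulr1 /= mulrC.
  by rewrite -ler_pdivlMr ?exprn_gt0 // /q expr_div_n mulrA.
have /cvgrPdist_lt /(_ _ E0)[m _ /(_ m (leqnn m))] : (phi_const * K * q ^+ k) @[k --> \oo] --> (0 : R).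
  rewrite -[X in _ --> X](mulr0 (phi_const * K)); apply: cvgMr; apply: cvg_expr.
  by rewrite ger0_norm.
rewrite /= sub0r normrN ger0_norm; last by rewrite mulr_ge0 ?exprn_ge0 // mulr_ge0 ?phi_const_ge0.
by rewrite ltNge Hq.
Qed.

End module.

End dimension.

(** * Composition of operators *)

Section composition.
Context {R : realType} {d : nat}.
Local Notation C := R[i].
Local Notation BS := (completeNormedModType C).
Local Notation bl := is_bounded_linear.

Section three.
Variables U V W : BS.
Variables (TUV : 'rV[R]_d -> (U -> V) -> (U -> V)) (TVW : 'rV[R]_d -> (V -> W) -> (V -> W))
  (TUW : 'rV[R]_d -> (U -> W) -> (U -> W)).
Variables (aUV : ('rV[R]_d -> C) -> (U -> V) -> (U -> V))
  (aVW : ('rV[R]_d -> C) -> (V -> W) -> (V -> W))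
  (aUW : ('rV[R]_d -> C) -> (U -> W) -> (U -> W)).
Hypotheses (rUV : is_isometric_rep TUV) (rVW : is_isometric_rep TVW) (rUW : is_isometric_rep TUW).
Hypotheses (mUV : is_L1_module TUV aUV) (mVW : is_L1_module TVW aVW) (mUW : is_L1_module TUW aUW).
Hypothesis mult : rep_mult TUV TVW TUW.
Implicit Types (A : U -> V) (B : V -> W).

(** The identity [x y - 1 = (x - 1)(y - 1) + (x - 1) + (y - 1)], available because [T] is
    multiplicative on compositions. *)
Lemma dop_comp z1 z2 e A B : bl A -> bl B ->
  dop TUW (z1 * z2) e (fun u => B (A u)) =
  opadd (opscale 1 (fun u => dop TVW z2 e B (dop TUV z1 e A u)))
    (opadd (opscale 1 (fun u => dop TVW z2 e B (A u))) (fun u => B (dop TUV z1 e A u))).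
Proof.
move=> bA bB; have bTB := T_bl rVW e bB; have bTA := T_bl rUV e bA.
apply/funext => u; rewrite /dop mult // /opadd /opscale !opsubE !scale1r.
rewrite (blB _ _ bTB) (blB _ _ bB) !(blZ _ _ bTB) !(blZ _ _ bB) scalerBr scalerA [z2 * z1]mulrC.
set p := (z1 * z2) *: _; set q := z2 *: TVW e B (A u); set r := z1 *: B _; set s := B (A u).
have -> : p - q - (r - s) + (q - s + (r - s)) = p - s; last by [].
by rewrite [q - s + _]addrC addrA subrK addrA subrK.
Qed.

(** The three terms of [dop_comp] contribute [d1 * d2], [d2] and [d1], in all
    [(1 + d1)(1 + d2) - 1]. The induction quantifies over both operators because differences replace
    them. *)
Lemma loc_comp z1 z2 e (K1 K2 d1 d2 : R) A B : bl A -> bl B ->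
  0 <= d1 -> 0 <= d2 -> 0 <= K1 -> 0 <= K2 ->
  loc TUV z1 e K1 d1 A -> loc TVW z2 e K2 d2 B ->
  loc TUW (z1 * z2) e (K1 * K2) (d1 + d2 + d1 * d2) (fun u => B (A u)).
Proof.
move=> bA bB d10 d20 K10 K20 lA lB k.
elim: k A B K1 K2 bA bB K10 K20 lA lB => [|k IH] A B K1 K2 bA bB K10 K20 lA lB.
  rewrite expr0 mulr1 /= (le_trans (opnorm_comp bA bB)) // mulrC.
  apply: ler_pM; rewrite ?opnorm_ge0 //.
    by have := lA 0%N; rewrite expr0 mulr1.
  by have := lB 0%N; rewrite expr0 mulr1.
have bdA := dop_bl rUV z1 e bA; have bdB := dop_bl rVW z2 e bB.
have ldA : loc TUV z1 e (K1 * d1) d1 (dop TUV z1 e A).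
  by move=> m; rewrite -iterSr; have := lA m.+1; rewrite exprS mulrA.
have ldB : loc TVW z2 e (K2 * d2) d2 (dop TVW z2 e B).
  by move=> m; rewrite -iterSr; have := lB m.+1; rewrite exprS mulrA.
have Kd1 : 0 <= K1 * d1 by exact: mulr_ge0.
have Kd2 : 0 <= K2 * d2 by exact: mulr_ge0.
have b1 := bl_comp bdA bdB; have b2 := bl_comp bA bdB; have b3 := bl_comp bdA bB.
have b23 := bl_add (bl_scale 1 b2) b3.
have bi := iter_dop_bl rUW (z1 * z2) e k.
rewrite iterSr dop_comp // (iter_dop_lin rUW) // (iter_dop_lin rUW) //.
rewrite (le_trans (opnorm_add _ _)) //; [exact: bl_scale (bi _ b1)|
  by apply: bl_add; [exact: bl_scale (bi _ b2)|exact: bi]|].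
rewrite (le_trans (lerD (lexx _) (opnorm_add (bl_scale 1 (bi _ b2)) (bi _ b3)))) //.
rewrite !opnorm_scale //; [|exact: bi|exact: bi].
rewrite nrm1 !mul1r.
have H1 := IH _ _ _ _ bdA bdB Kd1 Kd2 ldA ldB.
have H2 := IH _ _ _ _ bA bdB K10 Kd2 lA ldB.
have H3 := IH _ _ _ _ bdA bB Kd1 K20 ldA lB.
apply: (le_trans (lerD H1 (lerD H2 H3))).
by rewrite le_eqVlt; apply/orP; left; apply/eqP; rewrite exprS; ring.
Qed.

Lemma Tc_comp A B : bl A -> bl B -> T_continuous TUV A -> T_continuous TVW B ->
  T_continuous TUW (fun u => B (A u)).
Proof.
move=> bA bB cA cB; have bC := bl_comp bA bB.
apply: (Tc_intro rUW) => // e e0.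
have B0 : 0 < opnorm B + 1 by rewrite ltr_wpDl // opnorm_ge0.
have A0 : 0 < opnorm A + 1 by rewrite ltr_wpDl // opnorm_ge0.
have [|d1 d10 H1] := @Tc_elim _ _ _ _ _ rUV A (e / 2 / (opnorm B + 1)) bA cA; first by rewrite !divr_gt0.
have [|d2 d20 H2] := @Tc_elim _ _ _ _ _ rVW B (e / 2 / (opnorm A + 1)) bB cB; first by rewrite !divr_gt0.
exists (Num.min d1 d2) => [|t]; first by rewrite lt_min d10.
rewrite lt_min => /andP[t1 t2].
have bTA := T_bl rUV t bA; have bTB := T_bl rVW t bB.
have s1 := bl_sub bTA bA; have s2 := bl_sub bTB bB.
have -> : opsub (TUW t (fun u => B (A u))) (fun u => B (A u)) =
   opadd (fun u => TVW t B (opsub (TUV t A) A u)) (fun u => opsub (TVW t B) B (A u)).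
  apply/funext => u; rewrite mult // /opadd !opsubE (blB _ _ bTB).
  by rewrite addrA subrK.
rewrite (le_trans (opnorm_add (bl_comp s1 bTB) (bl_comp bA s2))) //.
rewrite (le_trans (lerD (opnorm_comp s1 bTB) (opnorm_comp bA s2))) // (T_norm rVW) //.
rewrite [leRHS]splitr lerD //.
  apply: (@le_trans _ _ (opnorm B * (e / 2 / (opnorm B + 1)))).
    by rewrite ler_wpM2l ?opnorm_ge0 // H1.
  by rewrite mulrCA ler_piMr ?divr_ge0 ?(ltW e0) // ler_pdivrMr // mul1r lerDl.
apply: (@le_trans _ _ (e / 2 / (opnorm A + 1) * opnorm A)).
  by rewrite ler_wpM2r ?opnorm_ge0 // H2.
by rewrite -mulrA ler_piMr ?divr_ge0 ?(ltW e0) // mulrC ler_pdivrMr // mul1r lerDl.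
Qed.

End three.

(* With [h = pi / |a - b|] the two phases are opposite, while a gap of [64]
   keeps the localisation radius [8 * h] below [1/2]. *)
Lemma expi_far (a b : int) : (64 <= `|(a - b)%R|%N)%N ->
  exists h : R, [/\ 0 < h <= 1, 8 * h <= 2^-1 &
    nrm (expi (- (a%:~R * h)) - expi (- (b%:~R * h)) : C) = 2].
Proof.
move=> ab; pose q : R := `|(a - b)%R|%N%:R; have q64 : 64 <= q by rewrite (ler_nat R 64).
have q0 : 0 < q by lra.
have p4 : (pi : R) <= 4 by have := pihalf_lt2 R; lra.
have hq : pi / q <= 16^-1 by rewrite ler_pdivrMr //; lra.
exists (pi / q); split.
- by rewrite divr_gt0 ?pi_gt0 //=; lra.
- by move: (pi / q) hq => x; lra.
- have E : expi (- (a%:~R * (pi / q))) = expi (- (b%:~R * (pi / q))) * -1 :> C.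
    have -> : - (a%:~R * (pi / q)) = - (b%:~R * (pi / q)) + - ((a - b)%:~R * (pi / q)) :> R.
      by rewrite intrD mulrNz; ring.
    rewrite expiD; congr (_ * _).
    have [ab0|ab0] := leP 0 (a - b).
      have -> : (a - b)%:~R = q by rewrite /q pmulrn abszE ger0_norm.
      by rewrite mulrCA divff ?mulr1 ?expiNpi // gt_eqF.
    have -> : (a - b)%:~R = - q.
      by rewrite /q pmulrn abszE ltr0_norm // mulrNz opprK.
    by rewrite mulNr opprK mulrCA divff ?mulr1 ?expipi // gt_eqF.
  rewrite E (_ : _ - _ = (-2)%:C * expi (- (b%:~R * (pi / q)))).
    by rewrite nrmM nrm_expi mulr1 nrm_real normrN normr_nat.
  by rewrite rmorphN rmorph_nat; ring.
Qed.

Section vanish.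
Variables U V W : BS.
Variables (TUV : 'rV[R]_d -> (U -> V) -> (U -> V)) (TVW : 'rV[R]_d -> (V -> W) -> (V -> W))
  (TUW : 'rV[R]_d -> (U -> W) -> (U -> W)).
Variables (aUV : ('rV[R]_d -> C) -> (U -> V) -> (U -> V))
  (aVW : ('rV[R]_d -> C) -> (V -> W) -> (V -> W))
  (aUW : ('rV[R]_d -> C) -> (U -> W) -> (U -> W)).
Hypotheses (rUV : is_isometric_rep TUV) (rVW : is_isometric_rep TVW) (rUW : is_isometric_rep TUW).
Hypotheses (mUV : is_L1_module TUV aUV) (mVW : is_L1_module TVW aVW) (mUW : is_L1_module TUW aUW).
Hypothesis mult : rep_mult TUV TVW TUW.

(** With [x = 8 * h <= 1/2] the composition has radius [2 x + x ^ 2] about the phase of [m + l], and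
    [phi_n] adds [x]. The total is at most [7/4], below the distance 2 of the opposite phases
    supplied by [expi_far]. *)
Lemma vanish_comp (n m l : 'rV[int]_d) (j : 'I_d) (A : U -> V) (B : V -> W) : bl A -> bl B ->
  (64 <= `|(n ord0 j - (m ord0 j + l ord0 j))%R|%N)%N ->
  aUW (phi1 n) (fun u => aVW (phi1 l) B (aUV (phi1 m) A u)) = @opzero R U W.
Proof.
move=> bA bB /expi_far[h [hh h8 hn]].
have L k : L1 (@phi1 R d k) by rewrite -(phi_dif0 j h k); have [] := L1_phi_dif j 0 k hh.
have lA := loc_phi mUV j m hh bA; have lB := loc_phi mVW j l hh bB.
have /andP[h0 _] := hh; have h80 : 0 <= 8 * h by lra.
have cA : 0 <= @phi_const R d * opnorm A by rewrite mulr_ge0 ?phi_const_ge0 ?opnorm_ge0.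
have cB : 0 <= @phi_const R d * opnorm B by rewrite mulr_ge0 ?phi_const_ge0 ?opnorm_ge0.
have bA' := act_bl mUV (L m) bA; have bB' := act_bl mVW (L l) bB.
have := loc_comp rUV rVW rUW mult bA' bB' h80 h80 cA cB lA lB.
rewrite -expiD -opprD -mulrDl -intrD => lC.
apply: (loc_vanish rUW mUW hh _ _ _ lC); rewrite ?nrm_expi //.
- exact: bl_comp.
- exact: mulr_ge0.
- by apply: addr_ge0; [lra|exact: mulr_ge0].
- by rewrite hn; move: (8 * h) h8 h80 => x x1 x0; nra.
Qed.

Lemma vanish_act (n m : 'rV[int]_d) (j : 'I_d) (A : U -> V) : bl A ->
  (64 <= `|(n ord0 j - m ord0 j)%R|%N)%N ->
  aUV (phi1 n) (aUV (phi1 m) A) = @opzero R U V.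
Proof.
move=> bA /expi_far[h [hh h8 hn]].
have L k : L1 (@phi1 R d k) by rewrite -(phi_dif0 j h k); have [] := L1_phi_dif j 0 k hh.
have /andP[h0 _] := hh; have h80 : 0 <= 8 * h by lra.
apply: (loc_vanish rUV mUV hh _ _ h80 (loc_phi mUV j m hh bA)); rewrite ?nrm_expi //.
- exact: (act_bl mUV (L m) bA).
- by rewrite mulr_ge0 ?phi_const_ge0 ?opnorm_ge0.
- by rewrite hn; lra.
Qed.

(** An invariant operator is localised at the phase 1 with radius zero; the convention [0 ^+ 0 = 1]
    makes the case [k = 0] of [loc] the plain norm bound. *)
Lemma vanish_inv (n : 'rV[int]_d) (j : 'I_d) (A : U -> V) : bl A ->
  (forall t, TUV t A = A) -> (64 <= `|n ord0 j|%N)%N -> aUV (phi1 n) A = @opzero R U V.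
Proof.
move=> bA inv n64; have [|h [hh h8 hn]] := @expi_far (n ord0 j) 0; first by rewrite subr0.
rewrite mul0r oppr0 expi0 in hn.
have dA k : opnorm (iter k (dop TUV 1 (ev j h)) A) <= opnorm A * 0 ^+ k.
  case: k => [|k]; first by rewrite expr0 mulr1.
  rewrite iterSr expr0n mulr0.
  have -> : dop TUV 1 (ev j h) A = @opzero R U V.
    by apply/funext => u; rewrite /dop opsubE /opscale inv scale1r subrr.
  have -> : iter k (dop TUV 1 (ev j h)) (@opzero R U V) = @opzero R U V.
    elim: k => // k IH; rewrite iterS IH /dop (T_zero rUV); apply/funext => u.
    by rewrite opsubE /opscale /opzero scaler0 subrr.
  by rewrite opnorm_opzero.
apply: (loc_vanish rUV mUV hh bA (opnorm_ge0 bA) (lexx 0) dA); rewrite ?nrm1 // hn.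
by lra.
Qed.

End vanish.

(* The paper's [phi_{N,a}] with [n = N a]: the transform of [gwin N n] is
   [prod_k hat phi ((l_k - n_k) / N)]. *)
Definition gwin (N : nat) (n : 'rV[int]_d) (t : 'rV[R]_d) : C := (fwin N t)%:C * chi n t.

Lemma nrm_gwin N n t : nrm (gwin N n t) = fwin N t.
Proof. by rewrite nrmM nrm_chi mulr1 nrm_real ger0_norm // fwin_ge0. Qed.

Lemma Cmeas_gwin N n : (0 < N)%N -> Cmeas (gwin N n).
Proof.
move=> N0; apply: CmeasM; last exact: Cmeas_chi.
by apply: Cmeas_real; case: (@domRd_fwin R d N N0).
Qed.

Lemma L1_gwin N n : (0 < N)%N -> L1 (gwin N n) /\ L1norm (gwin N n) <= fejer_mass ^+ d.
Proof.
move=> N0; have := Cmeas_L1 (Cmeas_gwin n N0) (@domRd_fwin R d N N0) (fun t => _).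
by rewrite RintRd_fwin //; apply => t; rewrite nrm_gwin.
Qed.

Lemma continuous_rV (f : 'rV[R]_d -> R) :
  (forall t0 (e : R), 0 < e -> exists2 delta : R, 0 < delta &
     forall t, `|t - t0| < delta -> `|f t - f t0| <= e) -> continuous f.
Proof.
move=> H; apply/continuousP => A; rewrite !openE => oA t /oA /nbhs_ballP[e /= e0 He].
have [|delta d0 Hd] := H t (e / 2); first by rewrite divr_gt0.
apply/nbhs_ballP; exists delta => //= s; rewrite mx_norm_ball /ball_ /= distrC => /Hd ts.
apply: He; rewrite /ball /= distrC; apply: le_lt_trans ts _.
by rewrite ltr_pdivrMr // ltr_pMr // ltr1n.
Qed.

Lemma Cmeas_cont (F : 'rV[R]_d -> C) :
  (forall t0 (e : R), 0 < e -> exists2 delta : R, 0 < delta &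
     forall t, `|t - t0| < delta -> nrm (F t - F t0) <= e) -> Cmeas F.
Proof.
move=> H; split; apply: continuous_measurable_Rd; apply: continuous_rV => t0 e e0.
- have [delta d0 Hd] := H t0 e e0; exists delta => // t /Hd; apply: le_trans.
  by apply: le_trans (Re_le_nrm _); case: (F t) => a b; case: (F t0).
- have [delta d0 Hd] := H t0 e e0; exists delta => // t /Hd; apply: le_trans.
  by apply: le_trans (Im_le_nrm _); case: (F t) => a b; case: (F t0).
Qed.

Lemma functional_sub (V : BS) (ys : V -> C) (u w : V) :
  (forall (a : C) (u w : V), ys (a *: u + w) = a * ys u + ys w) -> ys (u - w) = ys u - ys w.
Proof. by move=> lin; rewrite addrC -scaleN1r lin mulN1r addrC. Qed.

Lemma Cmeas_orbit (U V : BS) (T : 'rV[R]_d -> (U -> V) -> (U -> V)) (A : U -> V) (u : U)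
    (ys : V -> C) (M : R) : is_isometric_rep T -> bl A -> T_continuous T A ->
  (forall (a : C) (u w : V), ys (a *: u + w) = a * ys u + ys w) ->
  0 <= M -> (forall v, nrm (ys v) <= M * nrm v) ->
  Cmeas (fun t => ys (T (- t) A u)).
Proof.
move=> rep bA cA lin M0 ysM; apply: Cmeas_cont => t0 e e0.
have s0 : 0 < M * nrm u + 1 by rewrite ltr_wpDl // mulr_ge0 ?nrm_ge0.
have [|delta d0 Hd] := cA (- t0) (e / (M * nrm u + 1)); first by rewrite divr_gt0.
exists delta => // t td; rewrite -(functional_sub _ _ lin) (le_trans (ysM _)) //.
have : `|- t - - t0| < delta by rewrite opprK addrC distrC.
move=> /Hd /ltW; rewrite -opsubEf => H.
have bs : bl (opsub (T (- t) A) (T (- t0) A)) by apply: bl_sub; exact: T_bl.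
have := opnormP u bs; rewrite opsubE => H2.
apply: (@le_trans _ _ (M * (e / (M * nrm u + 1) * nrm u))).
  by rewrite ler_wpM2l // (le_trans H2) // ler_wpM2r ?nrm_ge0.
by rewrite mulrCA -mulrA ler_piMr ?(ltW e0) // mulrC ler_pdivrMr // mul1r lerDl.
Qed.

(** * Commutators with windows and the approximate identity *)

Section commutator.
Variables U V W : BS.
Variables (TUV : 'rV[R]_d -> (U -> V) -> (U -> V)) (TVW : 'rV[R]_d -> (V -> W) -> (V -> W))
  (TUW : 'rV[R]_d -> (U -> W) -> (U -> W)).
Variables (aUV : ('rV[R]_d -> C) -> (U -> V) -> (U -> V))
  (aUW : ('rV[R]_d -> C) -> (U -> W) -> (U -> W)).
Hypotheses (rUV : is_isometric_rep TUV) (rVW : is_isometric_rep TVW) (rUW : is_isometric_rep TUW).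
Hypotheses (mUV : is_L1_module TUV aUV) (mUW : is_L1_module TUW aUW).
Hypothesis mult : rep_mult TUV TVW TUW.

(** By multiplicativity the commutator, tested on a functional, is the integral of the window
    against [(T(-t) B - B) (T(-t) A u)]. The modulation has modulus one, so the centre [n] drops
    out, and [A] enters only through its norm: the threshold depends on [B] and [eps] alone. *)
Lemma commutator_small (B : V -> W) (eps : R) : bl B -> T_continuous TVW B -> 0 < eps ->
  exists N0, forall N, (N0 <= N)%N -> (0 < N)%N -> forall n (A : U -> V),
    bl A -> T_continuous TUV A ->
    opnorm (opsub (aUW (gwin N n) (fun u => B (A u))) (fun u => B (aUV (gwin N n) A u)))
      <= eps * opnorm A.
Proof.
move=> bB cB e0; pose m : R := fejer_mass ^+ d.
have m0 : 0 <= m by rewrite exprn_ge0 // ltW // fejer_mass_gt0.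
(* Chosen so that the bound [2 * (e1 * m + e1)] of [fwin_concentrated] equals [eps]. *)
pose e1 := eps / (2 * (m + 1)).
have e10 : 0 < e1 by rewrite divr_gt0 // mulr_gt0 // ltr_wpDl.
have [delta d0 Hd] := Tc_elim rVW bB cB e10.
have [N0 HN0] := @fwin_concentrated R d e1 (2 * opnorm B) delta e10 (mulr_ge0 (ler0n _ 2) (opnorm_ge0 bB)) d0.
exists N0 => N NN N1 n A bA cA.
have [Lg _] := L1_gwin n N1; have bBA := bl_comp bA bB.
have cBA := Tc_comp rUV rVW rUW mult bA bB cA cB.
have b1 := act_bl mUW Lg bBA; have b2 := bl_comp (act_bl mUV Lg bA) bB.
apply: opnorm_le; first by rewrite mulr_ge0 ?opnorm_ge0 // ltW.
move=> u; set v := opsub _ _ u.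
have [ys [fys ysn ysv]] := hahn_banach_functional v.
have [lin _] := fys.
have -> : nrm v = nrm (ys v) by rewrite ysv nrm_real ger0_norm ?nrm_ge0.
have ysn1 w : nrm (ys w) <= 1 * nrm w by rewrite mul1r.
pose ysB w := ys (B w).
have linB (a : C) (x y : V) : ysB (a *: x + y) = a * ysB x + ysB y.
  by rewrite /ysB blD // blZ // lin.
have ysBn w : nrm (ysB w) <= opnorm B * nrm w by rewrite (le_trans (ysn _)) // opnormP.
have fysB : is_functional ysB.
  split => // u0 e ee; have B0 : 0 < opnorm B + 1 by rewrite ltr_wpDl // opnorm_ge0.
  exists (e / (opnorm B + 1)); first by rewrite divr_gt0.
  move=> w wu; rewrite -(functional_sub _ _ linB); apply: (le_lt_trans (ysBn _)).
  apply: (@le_lt_trans _ _ ((opnorm B + 1) * nrm (w - u0))).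
    by rewrite ler_wpM2r ?nrm_ge0 // lerDl.
  by rewrite mulrC -ltr_pdivlMr.
pose F1 t := gwin N n t * ys (TUW (- t) (fun u => B (A u)) u).
pose F2 t := gwin N n t * ysB (TUV (- t) A u).
have -> : ys v = cintRd F1 - cintRd F2.
  rewrite /v opsubE (functional_sub _ _ lin) (mod_integral mUW Lg bBA cBA u fys).
  by rewrite -/(ysB _) (mod_integral mUV Lg bA cA u fysB).
have mF1 : Cmeas F1.
  apply: CmeasM; first exact: Cmeas_gwin.
  exact: (Cmeas_orbit u rUW bBA cBA lin ler01 ysn1).
have mF2 : Cmeas F2.
  apply: CmeasM; first exact: Cmeas_gwin.
  exact: (Cmeas_orbit u rUV bA cA linB (opnorm_ge0 bB) ysBn).
pose g1 t := (opnorm (fun u => B (A u)) * nrm u) * @fwin R d N t.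
pose g2 t := (opnorm B * (opnorm A * nrm u)) * @fwin R d N t.
have dg1 : domRd g1 by apply: domRdZ; exact: domRd_fwin.
have dg2 : domRd g2 by apply: domRdZ; exact: domRd_fwin.
have H1 t : nrm (F1 t) <= g1 t.
  rewrite nrmM nrm_gwin mulrC ler_wpM2r ?fwin_ge0 // (le_trans (ysn _)) //.
  by rewrite (le_trans (opnormP _ (T_bl rUW _ bBA))) // (T_norm rUW).
have H2 t : nrm (F2 t) <= g2 t.
  rewrite nrmM nrm_gwin mulrC ler_wpM2r ?fwin_ge0 // (le_trans (ysBn _)) //.
  rewrite ler_wpM2l ?opnorm_ge0 //.
  by rewrite (le_trans (opnormP _ (T_bl rUV _ bA))) // (T_norm rUV).
rewrite -(cintRdB mF1 dg1 H1 mF2 dg2 H2).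
pose q t := opnorm (opsub (TVW (- t) B) B).
pose s := opnorm A * nrm u.
have s0 : 0 <= s by rewrite mulr_ge0 ?opnorm_ge0 ?nrm_ge0.
have HF t : nrm (F1 t - F2 t) <= s * (fwin N t * q t).
  rewrite /F1 /F2 -mulrBr nrmM nrm_gwin [leRHS]mulrCA ler_wpM2l ?fwin_ge0 //.
  rewrite mult // /ysB -(functional_sub _ _ lin) (le_trans (ysn _)) //.
  have bs := bl_sub (T_bl rVW (- t) bB) bB.
  have := opnormP (TUV (- t) A u) bs; rewrite opsubE => /le_trans; apply.
  rewrite mulrC ler_wpM2r ?opnorm_ge0 //.
  by rewrite (le_trans (opnormP _ (T_bl rUV _ bA))) // (T_norm rUV).
have q1 t : `|t| < delta -> q t <= e1 by move=> td; apply: Hd; rewrite normrN.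
have q2 t : q t <= 2 * opnorm B.
  rewrite (le_trans (opnorm_sub (T_bl rVW (- t) bB) bB)) // (T_norm rVW) //; lra.
have := HN0 N NN N1 _ q s s0 (CmeasB mF1 mF2) HF q1 q2.
move=> /le_trans; apply; rewrite -/m [leRHS](_ : _ = s * eps); last by rewrite /s; ring.
rewrite mulrCA ler_wpM2l // /e1.
have -> : eps / (2 * (m + 1)) * m + eps / (2 * (m + 1)) = eps / 2.
  by field; rewrite gt_eqF // ltr_wpDl.
by rewrite mulrC divfK.
Qed.

End commutator.

Lemma act_gwin_id (U : BS) (T : 'rV[R]_d -> (U -> U) -> (U -> U))
    (act : ('rV[R]_d -> C) -> (U -> U) -> (U -> U)) N :
  is_isometric_rep T -> is_L1_module T act -> (forall t, T t id = id) -> (0 < N)%N ->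
  act (gwin N 0) id = opscale (fejer_mass ^+ d)%:C id.
Proof.
move=> rep mod inv N0; have [Lg _] := L1_gwin 0 N0; have bi := @bl_id R U.
have ci : T_continuous T id.
  apply: (Tc_intro rep) => // e e0; exists 1 => // t _; rewrite inv.
  apply: opnorm_le (ltW e0) _ => u; rewrite opsubE subrr nrm0.
  by rewrite mulr_ge0 ?nrm_ge0 // ltW.
apply/funext => u; apply/eqP; rewrite -subr_eq0; apply/eqP; apply: nrm_eq0.
set v := _ - _; have [ys [fys ysn ysv]] := hahn_banach_functional v.
have [lin _] := fys; have -> : nrm v = nrm (ys v) by rewrite ysv nrm_real ger0_norm ?nrm_ge0.
have ys0 : ys 0 = 0.
  by have := lin (-1) 0 0; rewrite scaler0 addr0 mulN1r addNr.
have E : ys (act (gwin N 0) id u) = (fejer_mass ^+ d)%:C * ys u.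
  rewrite (mod_integral mod Lg bi ci u fys) -(RintRd_fwin d N0) -cintRdZr; last exact: domRd_fwin.
  congr cintRd; apply/funext => t; rewrite inv /gwin (_ : chi 0 t = 1) ?mulr1 //.
  by rewrite /chi big1 // => j _; rewrite mxE mul0r expi0.
have ysZ a w : ys (a *: w) = a * ys w by have := lin a w 0; rewrite !addr0 ys0 addr0.
rewrite /v (functional_sub _ _ lin) E /opscale ysZ subrr.
exact: nrm0.
Qed.

(** The commutator estimate applied to [A] composed with the identity: the window acts on the
    invariant operator [id] as multiplication by its mass. *)
Lemma approx_identity (U V : BS) (T : 'rV[R]_d -> (U -> V) -> (U -> V))
    (act : ('rV[R]_d -> C) -> (U -> V) -> (U -> V))
    (TU : 'rV[R]_d -> (U -> U) -> (U -> U))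
    (aU : ('rV[R]_d -> C) -> (U -> U) -> (U -> U)) (A : U -> V) (eps : R) :
  is_isometric_rep T -> is_L1_module T act ->
  is_isometric_rep TU -> is_L1_module TU aU -> (forall t, TU t id = id) ->
  rep_mult TU T T -> bl A -> T_continuous T A -> 0 < eps ->
  exists N0, forall N, (N0 <= N)%N -> (0 < N)%N ->
    opnorm (opsub (act (gwin N 0) A) (opscale (fejer_mass ^+ d)%:C A)) <= eps.
Proof.
move=> rep mod repU modU inv mult bA cA e0.
have [N0 HN] := commutator_small repU rep rep modU mod mult bA cA e0.
exists N0 => N NN N1; have bi := @bl_id R U.
have ci : T_continuous TU id.
  apply: (Tc_intro repU) => // e ee0; exists 1 => // t _; rewrite inv.
  apply: opnorm_le (ltW ee0) _ => u; rewrite opsubE subrr nrm0.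
  by rewrite mulr_ge0 ?nrm_ge0 // ltW.
have := HN N NN N1 0 id bi ci; rewrite (act_gwin_id repU modU inv N1).
have -> : (fun u => A (opscale (fejer_mass ^+ d)%:C id u)) = opscale (fejer_mass ^+ d)%:C A.
  by apply/funext => u; rewrite /opscale blZ.
move=> /le_trans; apply; rewrite ler_piMr ?(ltW e0) //.
by apply: opnorm_le => // u; rewrite mul1r.
Qed.

End composition.

(** * Summation over the lattice *)

Section lattice.
Variable d : nat.
Local Notation Zd := 'rV[int]_d.
Implicit Types (j k l m n y : Zd) (K N r : nat).

Lemma ninf_leP k K : reflect (forall i, (`|k ord0 i|%N <= K)%N) (ninf k <= K)%N.
Proof.
apply: (iffP (bigmax_leqP _ _ _)) => H i; first exact: H.
by move=> _; exact: H.
Qed.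

Lemma ninf_ge k i : (`|k ord0 i|%N <= ninf k)%N.
Proof. exact: (leq_bigmax i). Qed.

Lemma ninf_attained k : ninf k = 0%N \/ exists i, ninf k = `|k ord0 i|%N.
Proof.
have [d0|d0] := posnP d.
  left; apply/eqP; rewrite -leqn0; apply/ninf_leP => i.
  by have := ltn_ord i; rewrite {2}d0.
right; have [|i Hi] := @bigop.eq_bigmax 'I_d (fun i => `|k ord0 i|%N); first by rewrite card_ord.
by exists i.
Qed.

Lemma ninf_triangle k l : (ninf (k + l) <= ninf k + ninf l)%N.
Proof.
apply/ninf_leP => i; rewrite mxE; apply: (@leq_trans (`|k ord0 i| + `|l ord0 i|)%N).
  by move: (k ord0 i) (l ord0 i) => a b; lia.
by apply: leq_add; exact: ninf_ge.
Qed.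

Lemma ninfN k : ninf (- k) = ninf k.
Proof. by apply: eq_bigr => i _; rewrite mxE abszN. Qed.

Lemma ninf_sub k l : (ninf (k - l) <= ninf k + ninf l)%N.
Proof. by rewrite -(ninfN l) ninf_triangle. Qed.

Definition boxs K : seq Zd :=
  [seq \row_i ((nat_of_ord (fun_of_fin f i))%:Z - K%:Z) | f <- enum {: {ffun 'I_d -> 'I_K.*2.+1}}].

Lemma mem_boxs k K : (k \in boxs K) = (ninf k <= K)%N.
Proof.
apply/mapP/idP => [[f _ ->]|/ninf_leP H].
  by apply/ninf_leP => i; rewrite mxE; case: (f i) => x /= xK; lia.
have lt i : (`|(k ord0 i + K%:Z)%R|%N < K.*2.+1)%N by have := H i; lia.
exists [ffun i => Ordinal (lt i)]; first by rewrite mem_enum.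
apply/rowP => i; rewrite mxE ffunE /=; have := H i; clear lt.
by move: (k ord0 i) => a; lia.
Qed.

Lemma uniq_boxs K : uniq (boxs K).
Proof.
rewrite map_inj_uniq ?enum_uniq // => f g /rowP H; apply/ffunP => i; apply: val_inj.
by have := H i; rewrite !mxE /=; lia.
Qed.

(** Rounding down locates the window of width [N] that contains the frequency [k], up to a remainder
    of norm at most [N]. *)
Definition vdiv N k : Zd := \row_i (k ord0 i %/ N%:Z)%Z.

(** Rounding towards zero, unlike [vdiv], divides the sup norm exactly, as radial sums require. *)
Definition vtrunc N k : Zd := \row_i (Num.sg (k ord0 i) * (`|k ord0 i|%N %/ N)%N%:Z).

Lemma absz_divz (a : int) N : (0 < N)%N -> (`|a|%N %/ N <= `|(a %/ N%:Z)%Z|%N <= `|a|%N)%N.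
Proof.
move=> N0; have := divz_eq a N%:Z; have := @modz_ge0 a N%:Z; have := @ltz_pmod a N%:Z.
have := divn_eq `|a|%N N; have := ltn_pmod `|a|%N N0.
move: (a %/ N%:Z)%Z (a %% N%:Z)%Z (`|a|%N %/ N)%N (`|a|%N %% N)%N => q r q' r'; nia.
Qed.

Lemma ninf_vdiv_le N k : (0 < N)%N -> (ninf (vdiv N k) <= ninf k)%N.
Proof.
move=> N0; apply/ninf_leP => i; rewrite mxE; have /andP[_ H] := absz_divz (k ord0 i) N0.
exact: leq_trans H (ninf_ge _ _).
Qed.

Lemma ninf_vdiv_ge N k : (0 < N)%N -> (ninf k %/ N <= ninf (vdiv N k))%N.
Proof.
move=> N0; rewrite -ltnS ltn_divLR //.
have [->|[i ->]] := ninf_attained k; first by rewrite muln_gt0 N0.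
have /andP[H _] := absz_divz (k ord0 i) N0; have := ninf_ge (vdiv N k) i; rewrite mxE => H2.
by rewrite -ltn_divLR // ltnS (leq_trans H).
Qed.

Lemma ninf_vtrunc N k : (0 < N)%N -> ninf (vtrunc N k) = (ninf k %/ N)%N.
Proof.
move=> N0.
have E i : `|vtrunc N k ord0 i|%N = (`|k ord0 i|%N %/ N)%N.
  rewrite mxE abszM absz_nat absz_sg; case: eqP => [->|_]; rewrite ?mul1n //.
  by rewrite absz0 div0n muln0.
apply/eqP; rewrite eqn_leq; apply/andP; split.
  by apply/ninf_leP => i; rewrite E leq_div2r // ninf_ge.
have [->|[i ->]] := ninf_attained k; first by rewrite div0n.
by rewrite -E ninf_ge.
Qed.

Lemma vdiv_rem N k : (0 < N)%N -> (ninf (k - N%:Z *: vdiv N k) <= N)%N.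
Proof.
move=> N0; apply/ninf_leP => i; rewrite !mxE.
have := divz_eq (k ord0 i) N%:Z; have := @modz_ge0 (k ord0 i) N%:Z.
have := @ltz_pmod (k ord0 i) N%:Z.
by move: (k ord0 i) (k ord0 i %/ N%:Z)%Z (k ord0 i %% N%:Z)%Z => a q x; nia.
Qed.

Lemma vtrunc_rem N k : (0 < N)%N -> (ninf (k - N%:Z *: vtrunc N k) <= N)%N.
Proof.
move=> N0; apply/ninf_leP => i; rewrite !mxE; move: (k ord0 i) => a.
have := divn_eq `|a|%N N; have := ltn_pmod `|a|%N N0.
move: (`|a|%N %/ N)%N (`|a|%N %% N)%N => q r rN E.
by have [a0|a0|a0] := ltrgt0P a; rewrite ?(ltr0_sg a0) ?(gtr0_sg a0); nia.
Qed.

(** * Radial majorants and their sums over boxes *)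

Section sums.
Context {R : realType}.
Implicit Types (f : Zd -> R) (u : nat -> R).

Lemma sum_subseq_le f (s s' : seq Zd) : uniq s -> {subset s <= s'} -> (forall j, 0 <= f j) ->
  \sum_(j <- s) f j <= \sum_(j <- s') f j.
Proof.
move=> us ss' f0; elim: s s' us ss' => [|x s IH] s' us ss'.
  by rewrite big_nil; apply: sumr_ge0.
have /andP[xs us'] := us; have xs' : x \in s' by apply: ss'; rewrite mem_head.
rewrite big_cons (perm_big _ (perm_to_rem xs')) /= big_cons lerD2l.
apply: IH => // y ys; have ys' := ss' y; rewrite inE ys orbT in ys'.
have := perm_mem (perm_to_rem xs') y; rewrite ys' // inE => /esym/orP[/eqP yx|//].
by move: xs; rewrite -yx ys.
Qed.

Lemma sum_uniq_le f (s : seq Zd) (X : R) : uniq s -> (forall j, 0 <= f j) ->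
  (forall K, \sum_(j <- boxs K) f j <= X) -> \sum_(j <- s) f j <= X.
Proof.
move=> us f0 fX; apply: le_trans (fX (\max_(j <- s) ninf j)%N).
apply: sum_subseq_le => // j js; rewrite mem_boxs.
exact: (@leq_bigmax_seq _ s xpredT (@ninf d) j js isT).
Qed.

Lemma sum_boxs_mono f K K' : (forall j, 0 <= f j) -> (K <= K')%N ->
  \sum_(j <- boxs K) f j <= \sum_(j <- boxs K') f j.
Proof.
move=> f0 KK'; apply: sum_subseq_le => //; first exact: uniq_boxs.
by move=> j; rewrite !mem_boxs => /leq_trans; apply.
Qed.

Lemma sum_boxs_restrict (V : nmodType) (F : Zd -> V) M K : (M <= K)%N ->
  \sum_(m <- boxs M) F m = \sum_(m <- boxs K | (ninf m <= M)%N) F m.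
Proof.
move=> MK; rewrite -[RHS]big_filter; apply: perm_big; apply: uniq_perm.
- exact: uniq_boxs.
- by rewrite filter_uniq // uniq_boxs.
- move=> m; rewrite mem_filter !mem_boxs; case: leqP => //= mM.
  by rewrite (leq_trans mM).
Qed.

Lemma sum_near f x r K : (forall j, 0 <= f j) ->
  \sum_(i <- boxs K | (ninf (i - x) <= r)%N) f i <= \sum_(i <- boxs r) f (x + i).
Proof.
move=> f0; rewrite -big_filter -(big_map (fun i => x + i) xpredT f) /=.
apply: sum_subseq_le => //; first by rewrite filter_uniq // uniq_boxs.
move=> i; rewrite mem_filter => /andP[ir _]; apply/mapP; exists (i - x); rewrite ?mem_boxs //.
by rewrite addrC subrK.
Qed.

(** All points of the fibre of [p] over [y] lie within [D] of [N y], so each value is repeated at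
    most as often as there are points in the box of radius [D]. *)
Lemma sum_fiber f (p : Zd -> Zd) N D (s s' : seq Zd) : uniq s ->
  (forall j, 0 <= f j) -> (forall j, j \in s -> p j \in s') ->
  (forall j, (ninf (j - N%:Z *: p j) <= D)%N) ->
  \sum_(j <- s) f (p j) <= (size (boxs D))%:R * \sum_(y <- s') f y.
Proof.
move=> us f0 ps rem; pose s1 := undup s'.
have us1 : uniq s1 by exact: undup_uniq.
apply: (@le_trans _ _ ((size (boxs D))%:R * \sum_(y <- s1) f y)); last first.
  by rewrite ler_wpM2l // sum_subseq_le // => y; rewrite mem_undup.
have -> : \sum_(j <- s) f (p j) = \sum_(j <- s) \sum_(y <- s1) (if y == p j then f y else 0).
  rewrite big_seq [RHS]big_seq; apply: eq_bigr => j js; rewrite -big_mkcond /=.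
  rewrite (big_rem (p j)) /=; last by rewrite mem_undup ps.
  rewrite eqxx big1_seq ?addr0 // => y /andP[/eqP -> ]; rewrite mem_rem_uniq // inE eqxx //.
rewrite exchange_big /= mulr_sumr; apply: ler_sum => y _.
rewrite -big_mkcond /= big_const_seq iter_addr_0 -[leLHS]mulr_natl ler_wpM2r // ler_nat.
rewrite -size_filter -(size_map (fun j => j - N%:Z *: y)); apply: uniq_leq_size.
  by rewrite map_inj_uniq ?filter_uniq // => a b /addIr.
move=> z /mapP[j]; rewrite mem_filter => /andP[/eqP yp _] ->.
by rewrite mem_boxs yp rem.
Qed.

(** A real-valued form of the Beurling condition: a nonincreasing majorant of the norm with bounded
    sums over boxes. *)
Definition radsum u (X : R) := [/\ forall a b : nat, (a <= b)%N -> u b <= u a, forall a : nat, 0 <= u a &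
  forall K, \sum_(j <- boxs K) u (ninf j) <= X].

Lemma radsum_div u X N : (0 < N)%N -> radsum u X ->
  radsum (fun k : nat => u (k %/ N)%N) ((size (boxs N))%:R * X).
Proof.
move=> N0 [um u0 uX]; split => // [k l kl|K]; first by apply: um; exact: leq_div2r.
under eq_bigr do rewrite -ninf_vtrunc //.
apply: (@le_trans _ _ ((size (boxs N))%:R * \sum_(j <- boxs K) u (ninf j))); last first.
  by rewrite ler_wpM2l.
apply: (@sum_fiber (fun y => u (ninf y)) (vtrunc N) N N (boxs K) (boxs K) (uniq_boxs K)) => //.
  move=> j; rewrite !mem_boxs ninf_vtrunc // => jK; exact: leq_trans (leq_div _ _) jK.
by move=> j; exact: vtrunc_rem.
Qed.

(** Outside the box of radius [2 r] one has [k - r >= k / 2], so halving dominates the shift; inside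
    that box the value is at most [u 0]. *)
Lemma radsum_shift u X r : radsum u X ->
  radsum (fun k : nat => u (k - r)%N) ((size (boxs 2))%:R * X + (size (boxs r.*2))%:R * u 0%N).
Proof.
move=> ru; have [um u0 uX] := ru; have [_ _ dX] := radsum_div (ltn0Sn 1) ru.
split => // [k l kl|K]; first by apply: um; exact: leq_sub2r.
pose v j : R := if (ninf j <= r.*2)%N then u 0%N else 0.
have v0 j : 0 <= v j by rewrite /v; case: ifP.
apply: (@le_trans _ _ (\sum_(j <- boxs K) (u (ninf j %/ 2)%N + v j))).
  apply: ler_sum => j _; rewrite /v; case: leqP => jr.
    by rewrite ler_wpDl // um.
  by rewrite addr0 um //; lia.
rewrite big_split /= lerD // (le_trans (sum_boxs_mono v0 (leq_maxl K r.*2))) //.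
rewrite /v -big_mkcond /= big_const_seq iter_addr_0 -[leLHS]mulr_natl ler_wpM2r // ler_nat.
rewrite -size_filter; apply: uniq_leq_size; first by rewrite filter_uniq // uniq_boxs.
by move=> j; rewrite mem_filter => /andP[jr _]; rewrite mem_boxs.
Qed.

(** Take a box whose sum comes within [tau] of the supremum of all box sums: no larger box can add
    more than [tau]. *)
Lemma radsum_tail u X (tau : R) : radsum u X -> 0 < tau ->
  exists M, forall K, \sum_(m <- boxs K | (M < ninf m)%N) u (ninf m) <= tau.
Proof.
move=> [um u0 uX] tau0.
pose S := [set \sum_(m <- boxs K) u (ninf m) | K in [set: nat]].
have hS : has_sup S.
  by split; [exists (\sum_(m <- boxs 0) u (ninf m)); exists 0%N|exists X => _ [K _ <-]].
have [_ [M _ <-] HM] := sup_adherent tau0 hS; exists M => K.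
pose K1 := maxn K M.
apply: (@le_trans _ _ (\sum_(m <- boxs K1 | (M < ninf m)%N) u (ninf m))).
  rewrite big_mkcond [leRHS]big_mkcond /=.
  apply: (@sum_boxs_mono (fun m => if (M < ninf m)%N then u (ninf m) else 0)).
    by move=> m; case: ifP.
  exact: leq_maxl.
have : \sum_(m <- boxs K1) u (ninf m) <= sup S.
  by apply: sup_ubound; [case: hS|exists K1].
rewrite (bigID (fun m => (ninf m <= M)%N)) /= -(sum_boxs_restrict _ (leq_maxr K M)).
rewrite (eq_bigl (fun m => (M < ninf m)%N)); last by move=> m; rewrite -ltnNge.
by move: HM; lra.
Qed.

Lemma radsumZ u X (c : R) : 0 <= c -> radsum u X -> radsum (fun k : nat => c * u k) (c * X).
Proof.
move=> c0 [um u0 uX]; split => [k l kl|k|K]; first by rewrite ler_wpM2l // um.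
  exact: mulr_ge0.
by rewrite -mulr_sumr ler_wpM2l.
Qed.

Lemma radsumD u X v Y : radsum u X -> radsum v Y -> radsum (fun k : nat => u k + v k) (X + Y).
Proof.
move=> [um u0 uX] [vm v0 vY]; split => [k l kl|k|K]; first by rewrite lerD ?um ?vm.
  exact: addr_ge0.
by rewrite big_split lerD.
Qed.

Lemma radsum_finite (c : R) r : 0 <= c ->
  radsum (fun k : nat => if (k <= r)%N then c else 0) ((size (boxs r))%:R * c).
Proof.
move=> c0; split => [k l kl|k|K]; last 2 first.
- by case: ifP.
- pose v (j : Zd) : R := if (ninf j <= r)%N then c else 0.
  have v0 j : 0 <= v j by rewrite /v; case: ifP.
  rewrite -/(v _) -big_mkcond /= big_const_seq iter_addr_0 -[leLHS]mulr_natl ler_wpM2r // ler_nat.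
  rewrite -size_filter; apply: uniq_leq_size; first by rewrite filter_uniq // uniq_boxs.
  by move=> j; rewrite mem_filter => /andP[jr _]; rewrite mem_boxs.
- by case: (leqP l r) => lr; case: (leqP k r) => kr //; lia.
Qed.

(* The supremum of the sums of [beta] over sets of at most [n] points is finite
   and, that class of sets being translation invariant, absorbs the convolution;
   this gives summability.  Splitting the convolution at half the radius then
   controls the radial supremum. *)
Section bootstrap.
Variables (beta : Zd -> R) (M0 : R) (c : nat -> R) (Cc : R) (e : Zd -> R) (es : nat -> R) (E eta : R).
Variables (N r : nat).
Hypothesis d_gt0 : (0 < d)%N.
Hypothesis N_gt0 : (0 < N)%N.
Hypothesis beta0 : forall j, 0 <= beta j.
Hypothesis betaM : forall j, beta j <= M0.
Hypothesis c_sum : radsum c Cc.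
Hypothesis e0 : forall m, 0 <= e m.
Hypothesis e_le : forall m, e m <= es (ninf m).
Hypothesis es_sum : radsum es E.
Hypothesis e_eta : forall K, \sum_(m <- boxs K) e m <= eta.
Hypothesis eta_small : eta * (size (boxs r))%:R * (size (boxs 2))%:R <= 2^-1.
Hypothesis ineq : forall j (delta : R), 0 < delta -> exists K,
  beta j <= c (ninf j) + delta + \sum_(m <- boxs K) e m * \sum_(i <- boxs r) beta (j - vdiv N m + i).

Let box_ge1 K : 1 <= (size (boxs K))%:R :> R.
Proof.
rewrite ler1n; have : (0 : Zd) \in boxs K.
  by rewrite mem_boxs; apply/ninf_leP => i; rewrite mxE.
by case: (boxs K).
Qed.

Let eta0 : 0 <= eta.
Proof. by apply: le_trans (e_eta 0); apply: sumr_ge0. Qed.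

Let eta_r : eta * (size (boxs r))%:R <= 2^-1.
Proof. by apply: le_trans eta_small; rewrite ler_peMr // mulr_ge0. Qed.

Let M00 : 0 <= M0. Proof. exact: le_trans (beta0 0) (betaM 0). Qed.

Let inner0 j m : 0 <= \sum_(i <- boxs r) beta (j - vdiv N m + i).
Proof. exact: sumr_ge0. Qed.

Lemma bootstrap_l1 (F : seq Zd) : uniq F -> \sum_(j <- F) beta j <= 2 * Cc.
Proof.
have [cm c0 cX] := c_sum.
pose n := size F; pose S := [set x : R | exists G : seq Zd,
  [/\ uniq G, (size G <= n)%N & x = \sum_(j <- G) beta j]].
have Sub x : S x -> x <= n%:R * M0.
  move=> [G [_ Gn ->]]; apply: (@le_trans _ _ ((size G)%:R * M0)); last first.
    by rewrite ler_wpM2r // ler_nat.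
  elim: G {Gn} => [|g G IH]; first by rewrite big_nil mul0r.
  by rewrite big_cons /= -natr1 mulrDl mul1r addrC lerD.
have Ss : has_sup S.
  split; first by exists 0; exists [::]; split => //; rewrite big_nil.
  by exists (n%:R * M0) => x /Sub.
have Sle G : uniq G -> (size G <= n)%N -> \sum_(j <- G) beta j <= sup S.
  by move=> uG Gn; apply: sup_ubound; [case: Ss|exists G].
suff H : sup S <= Cc + sup S / 2.
  move=> uF; apply: (le_trans (Sle F uF (leqnn _))); lra.
apply: ge_sup; first by case: Ss.
move=> _ [G [uG Gn ->]]; apply/ler_addgt0Pr => delta delta0.
have n0 : 0 < n.+1%:R :> R by rewrite ltr0n.
(* The errors at the at most [n] points of [G] must add up to at most [delta]; [n.+1] also covers
   [n = 0]. *)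
have dn : 0 < delta / n.+1%:R by rewrite divr_gt0.
have [K HK] : exists K, forall j, j \in G -> beta j <= c (ninf j) + delta / n.+1%:R +
    \sum_(m <- boxs K) e m * \sum_(i <- boxs r) beta (j - vdiv N m + i).
  elim: (G) => [|g G' [K HK]]; first by exists 0%N.
  have [K' HK'] := ineq g dn; exists (maxn K K') => j.
  rewrite inE => /orP[/eqP ->|jG].
    apply: (le_trans HK'); rewrite lerD2l; apply: sum_boxs_mono (leq_maxr _ _) => m.
    exact: mulr_ge0.
  apply: (le_trans (HK j jG)); rewrite lerD2l; apply: sum_boxs_mono (leq_maxl _ _) => m.
  exact: mulr_ge0.
apply: (@le_trans _ _ (\sum_(j <- G) (c (ninf j) + delta / n.+1%:R +
    \sum_(m <- boxs K) e m * \sum_(i <- boxs r) beta (j - vdiv N m + i)))).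
  by rewrite big_seq [leRHS]big_seq; apply: ler_sum => j jG; exact: HK.
rewrite !big_split /= addrAC; apply: lerD.
  apply: lerD.
  - exact: (@sum_uniq_le (fun j => c (ninf j))).
  - rewrite exchange_big /=.
    apply: (@le_trans _ _ (\sum_(m <- boxs K) e m * ((size (boxs r))%:R * sup S))).
      apply: ler_sum => m _; rewrite -mulr_sumr ler_wpM2l // exchange_big /=.
      rewrite mulr_natl -[X in _ *+ X](count_predT (boxs r)) -iter_addr_0 -big_const_seq /=.
      apply: ler_sum => i _.
      rewrite -(big_map (fun j => j - vdiv N m + i) xpredT beta) /=.
      apply: Sle; last by rewrite size_map.
      by rewrite map_inj_uniq // => a b /addIr /addIr.
    rewrite -mulr_suml mulrA mulrC.
    have S0 : 0 <= sup S.
      by apply: (@le_trans _ _ (\sum_(j <- [::]) beta j)); [rewrite big_nil|exact: Sle].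
    rewrite ler_wpM2l //; apply: le_trans eta_r; by rewrite ler_wpM2r.
rewrite big_const_seq count_predT iter_addr_0 -[leLHS]mulr_natl mulrA ler_pdivrMr // mulrC.
by rewrite ler_wpM2l ?(ltW delta0) // ler_nat (leq_trans Gn).
Qed.

Definition rsup (k : nat) : R := sup [set beta j | j in [set j | (k <= ninf j)%N]].

(** Positivity of [d] provides points of every norm, so the supremum is over a nonempty set. *)
Let rsup_has (k : nat) : has_sup [set beta j | j in [set j | (k <= ninf j)%N]].
Proof.
split; last by exists M0 => _ [j _ <-].
have kk : (k <= ninf (const_mx k%:Z : Zd))%N.
  by have := ninf_ge (const_mx k%:Z : Zd) (Ordinal d_gt0); rewrite mxE.
by exists (beta (const_mx k%:Z)); exists (const_mx k%:Z).
Qed.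

Lemma beta_le_rsup j (k : nat) : (k <= ninf j)%N -> beta j <= rsup k.
Proof. by move=> kj; apply: sup_ubound; [case: (rsup_has k)|exists j]. Qed.

Lemma rsup_ge0 (k : nat) : 0 <= rsup k.
Proof. by have [[x [j kj _]] _] := rsup_has k; exact: le_trans (beta0 j) (beta_le_rsup kj). Qed.

Lemma rsup_le (k : nat) (x : R) : (forall j, (k <= ninf j)%N -> beta j <= x) -> rsup k <= x.
Proof. by move=> H; apply: ge_sup; [case: (rsup_has k)|move=> _ [j kj <-]; exact: H]. Qed.

Let L := (size (boxs r))%:R * ((size (boxs N))%:R * (2 * Cc)).

Lemma rsup_ineq (k : nat) : rsup k <= c k + eta * (size (boxs r))%:R * rsup (k %/ 2)%N +
  L * es (k %/ 2 - r)%N.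
Proof.
have [cm c0 cX] := c_sum; have [em es0 eX] := es_sum.
apply: rsup_le => j kj; apply/ler_addgt0Pr => delta delta0.
have [K HK] := ineq j delta0; apply: (le_trans HK).
rewrite -!addrA lerD ?cm // [leRHS]addrA [leRHS]addrC lerD //.
pose b := rsup (k %/ 2)%N; pose x := es (k %/ 2 - r)%N.
have b0 : 0 <= b by exact: rsup_ge0.
have H m i : i \in boxs r -> e m * beta (j - vdiv N m + i) <=
    e m * b + x * beta (j - vdiv N m + i).
  (* If [m / N] and [r] together stay below [k - k / 2], the argument of [beta] keeps norm at least
     [k / 2]. Otherwise [m] has norm at least [k / 2 - r], and the radial majorant [es] of [e] is
     small. *)
  rewrite mem_boxs => ir; have [small|large] := leqP (ninf (vdiv N m) + r) (k - k %/ 2).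
    have : beta (j - vdiv N m + i) <= b.
      apply: beta_le_rsup.
      have := ninf_triangle (j - vdiv N m + i) (vdiv N m - i).
      rewrite (_ : j - vdiv N m + i + (vdiv N m - i) = j); last first.
        by rewrite -addrA (addrCA i) subrr addr0 subrK.
      by have := ninf_sub (vdiv N m) i; lia.
    move=> bb; rewrite ler_wpDr ?mulr_ge0 ?es0 // ler_wpM2l //.
  rewrite ler_wpDl ?mulr_ge0 // ler_wpM2r // (le_trans (e_le m)) // em //.
  by have := ninf_vdiv_le m N_gt0; lia.
apply: (@le_trans _ _ (\sum_(m <- boxs K) (e m * ((size (boxs r))%:R * b) +
    x * \sum_(i <- boxs r) beta (j - vdiv N m + i)))).
  apply: ler_sum => m _; rewrite mulr_sumr.
  apply: (@le_trans _ _ (\sum_(i <- boxs r) (e m * b + x * beta (j - vdiv N m + i)))).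
    by rewrite big_seq [leRHS]big_seq; apply: ler_sum => i ir; exact: H.
  rewrite big_split /= -[X in _ + X <= _]mulr_sumr lerD2r big_const_seq count_predT iter_addr_0 -[leLHS]mulr_natl.
  by rewrite mulrCA.
rewrite big_split /= -mulr_suml -[X in _ + X <= _]mulr_sumr; apply: lerD.
  by rewrite mulrA ler_wpM2r // ler_wpM2r.
rewrite [leRHS]mulrC; apply: ler_wpM2l; first exact: es0.
rewrite /L exchange_big /= mulr_natl.
rewrite -[X in _ *+ X](count_predT (boxs r)) -iter_addr_0 -big_const_seq.
apply: ler_sum => i _.
(* Rounding by [vdiv N] is at most as many to one as the box of radius [N] has points; the remaining
   sum runs over distinct points, where the summability of [beta] applies. *)
apply: (@le_trans _ _ ((size (boxs N))%:R * \sum_(y <- boxs K) beta (j - y + i))).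
  apply: (@sum_fiber (fun y => beta (j - y + i)) (vdiv N) N N (boxs K) (boxs K) (uniq_boxs K)) => //.
    by move=> m; rewrite !mem_boxs => mK; exact: leq_trans (ninf_vdiv_le m N_gt0) mK.
  by move=> m; exact: vdiv_rem.
rewrite ler_wpM2l // -(big_map (fun y => j - y + i) xpredT beta); apply: bootstrap_l1.
rewrite map_inj_uniq ?uniq_boxs // => a a' /addIr /addrI /oppr_inj //.
Qed.

Theorem bootstrap : exists X, radsum rsup X.
Proof.
have [cm c0 cX] := c_sum.
have rs := radsum_div (ltn0Sn 1) (radsum_shift r es_sum).
have [_ _ rsX] := rs; set X1 := (size (boxs 2))%:R * _ in rsX.
have L0 : 0 <= L.
  have Cc0 : 0 <= Cc by apply: le_trans (cX 0%N); apply: sumr_ge0.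
  by rewrite !mulr_ge0.
have rm (k l : nat) : (k <= l)%N -> rsup l <= rsup k.
  by move=> kl; apply: rsup_le => j lj; apply: beta_le_rsup; exact: leq_trans lj.
exists (2 * (Cc + L * X1)); split => //; first exact: rsup_ge0.
move=> K; set S := \sum_(j <- _) _.
suff : S <= Cc + 2^-1 * S + L * X1 by lra.
apply: (@le_trans _ _ (\sum_(j <- boxs K) (c (ninf j) +
  eta * (size (boxs r))%:R * rsup (ninf j %/ 2)%N + L * es (ninf j %/ 2 - r)%N))).
  by apply: ler_sum => j _; exact: rsup_ineq.
rewrite !big_split /= lerD //; last by rewrite -mulr_sumr ler_wpM2l.
rewrite lerD // -mulr_sumr.
(* Halving the radius costs the number of points of the box of radius 2, which is why that factor
   stands in [eta_small]; it lets [S] be absorbed into the left-hand side. *)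
have H : \sum_(j <- boxs K) rsup (ninf j %/ 2)%N <= (size (boxs 2))%:R * S.
  under eq_bigr do rewrite -(ninf_vtrunc _ (ltn0Sn 1)).
  apply: (@sum_fiber (fun y => rsup (ninf y)) (vtrunc 2) 2 2 (boxs K) (boxs K) (uniq_boxs K)).
  - by move=> j; exact: rsup_ge0.
    move=> j; rewrite !mem_boxs ninf_vtrunc // => jK; exact: leq_trans (leq_div _ _) jK.
  by move=> j; exact: vtrunc_rem.
apply: (le_trans (ler_wpM2l (mulr_ge0 eta0 (ler0n _ _)) H)).
rewrite mulrA ler_wpM2r //; apply: sumr_ge0 => j _; exact: rsup_ge0.
Qed.

End bootstrap.

End sums.

End lattice.

Lemma subrACA (V : zmodType) (x y z t : V) : x - y - (z - t) = x - z - (y - t).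
Proof. by rewrite !opprB addrACA [- y - z]addrC -addrACA. Qed.

(** * Wide windows as sums of narrow ones *)

Section windows.
Context {R : realType} {d : nat}.
Local Notation C := R[i].
Local Notation Zd := 'rV[int]_d.
Implicit Types (l m n p : Zd) (K N : nat).

Definition wt K l : R := \prod_(j < d) fwt K (l ord0 j).

Lemma wt_ge0 K l : (ninf l <= K)%N -> 0 <= wt K l.
Proof. by move=> /ninf_leP H; apply: prodr_ge0 => j _; exact: fwt_ge0. Qed.

Lemma wt_le1 K l : (ninf l <= K)%N -> wt K l <= 1.
Proof.
by move=> /ninf_leP H; apply: prodr_ile1 => j _; rewrite fwt_ge0 ?fwt_le1.
Qed.

Lemma one_sub_wt K l : (0 < K)%N -> (ninf l <= K)%N -> 1 - wt K l <= (d * ninf l)%:R / K%:R.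
Proof.
move=> K0 lK; have lj := elimT (ninf_leP l K) lK.
have KR : 0 < K%:R :> R by rewrite ltr0n.
have -> : (d * ninf l)%:R / K%:R = \sum_(j < d) ((ninf l)%:R / K%:R) :> R.
  by rewrite sumr_const card_ord natrM -[RHS]mulr_natl mulrA.
pose P (x s : R) := 0 <= x <= 1 /\ 1 - x <= s.
suff : P (wt K l) (\sum_(j < d) (ninf l)%:R / K%:R) by case.
apply: (big_rec2 P) => [|j x s _ [/andP[x0 x1] IH]].
  by split; rewrite ?subrr ?ler01 ?lexx.
have f0 : 0 <= fwt K (l ord0 j) :> R by exact: fwt_ge0.
have f1 : fwt K (l ord0 j) <= 1 :> R by exact: fwt_le1.
split; first by rewrite mulr_ge0 //= mulr_ile1.
have fl : 1 - fwt K (l ord0 j) <= (ninf l)%:R / K%:R :> R.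
  by rewrite /fwt subKr ler_pM2r ?invr_gt0 // ler_nat ninf_ge.
by nra.
Qed.

Lemma gwin1 n : gwin 1 n = @phi1 R d n.
Proof. by apply/funext => t; rewrite /gwin /fwin /chi /phi1 fejerS1 rmorph_prod -big_split. Qed.

Lemma fejerS_mulE K N (s : R) : (0 < K)%N -> ((fejerS (K * N) s)%:C : C) = (fejerS N s)%:C *
  \sum_(i < K.*2.+1) (fwt K (i%:Z - K%:Z))%:C * expi ((i%:Z - K%:Z)%:~R * (N%:R * s)).
Proof.
move=> K0; rewrite -cosum_expi // -rmorphM /=; congr (_%:C).
by rewrite /fejerS natrM -!mulrA -fejer_scale // mulrCA.
Qed.

(** The refinement equation in each coordinate, multiplied out: a window of width [K N] is a
    weighted sum of windows of width [N] with centres spaced by [N]. With [N = 1] it reduces wide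
    windows to [phi1]. *)
Lemma gwin_mulE K N n (t : 'rV[R]_d) : (0 < K)%N ->
  gwin (K * N) n t = \sum_(l <- boxs d K) (wt K l)%:C * gwin N (n + N%:Z *: l) t.
Proof.
move=> K0; rewrite /gwin /fwin !rmorph_prod /=.
rewrite (eq_bigr _ (fun j _ => fejerS_mulE N (t ord0 j) K0)) big_split /=.
rewrite bigA_distr_bigA /= big_map big_enum /= mulr_sumr mulr_suml.
apply: eq_bigr => f _; rewrite /wt rmorph_prod /= big_split /=.
have -> : chi (n + N%:Z *: \row_i ((nat_of_ord (f i))%:Z - K%:Z)) t =
    chi n t * \prod_(j < d) expi (((nat_of_ord (f j))%:Z - K%:Z)%:~R * (N%:R * t ord0 j)).
  rewrite /chi -big_split /=; apply: eq_bigr => j _; rewrite !mxE -expiD; congr expi.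
  by rewrite rmorphD rmorphM /= mulrDl [N%:~R * _]mulrC -mulrA.
under [X in _ = X * _]eq_bigr do rewrite mxE.
by rewrite [RHS]mulrCA -!mulrA; do 2!congr (_ * _); exact: mulrC.
Qed.

End windows.

(** * Windows acting on operators *)

Section operators.
Context {R : realType} {d : nat}.
Local Notation C := R[i].
Local Notation BS := (completeNormedModType C).
Local Notation bl := is_bounded_linear.
Local Notation Zd := 'rV[int]_d.
Local Notation cm := ((@fejer_mass R) ^+ d).

Lemma opsum0 (U V : BS) (I : eqType) (r : seq I) (c : I -> C) (F : I -> U -> V) :
  (forall i, i \in r -> F i = @opzero R U V) -> opsum r c F = @opzero R U V.
Proof.
move=> F0; apply/funext => u; rewrite /opsum big1_seq // => i /andP[_ /F0 ->].
by rewrite scaler0.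
Qed.

Section one.
Variables U V : BS.
Variables (T : 'rV[R]_d -> (U -> V) -> (U -> V)) (a : ('rV[R]_d -> C) -> (U -> V) -> (U -> V)).
Hypotheses (rep : is_isometric_rep T) (mod : is_L1_module T a).
Implicit Types (A : U -> V) (n m p : Zd).

Lemma act_gwin_mul K N n A : (0 < K)%N -> (0 < N)%N -> bl A ->
  a (gwin (K * N) n) A = opsum (boxs d K) (fun l => (wt K l)%:C) (fun l => a (gwin N (n + N%:Z *: l)) A).
Proof.
move=> K0 N0 bA; have LG l : L1 (@gwin R d N (n + N%:Z *: l)) by have [] := @L1_gwin R d N (n + N%:Z *: l) N0.
rewrite -(act_suml mod (boxs d K) (fun l => (wt K l)%:C) LG bA).
by congr (a _ A); apply/funext => t; exact: gwin_mulE.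
Qed.

Lemma act_gwinE N n A : (0 < N)%N -> bl A ->
  a (gwin N n) A = opsum (boxs d N) (fun l => (wt N l)%:C) (fun l => a (phi1 (n + l)) A).
Proof.
move=> N0 bA; rewrite -{1}(muln1 N) act_gwin_mul //; congr (opsum _ _ _).
by apply/funext => l; rewrite gwin1 scale1r.
Qed.

Lemma L1_phi1 n : L1 (@phi1 R d n).
Proof. by rewrite -gwin1; have [] := @L1_gwin R d 1 n isT. Qed.

Lemma opnorm_gwin N n A : (0 < N)%N -> bl A -> opnorm (a (gwin N n) A) <= cm * opnorm A.
Proof.
move=> N0 bA; have [Lg Hg] := @L1_gwin R d N n N0.
by apply: (le_trans (mod_norm mod Lg bA)); rewrite ler_wpM2r // opnorm_ge0.
Qed.

Lemma bl_gwin N n A : (0 < N)%N -> bl A -> bl (a (gwin N n) A).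
Proof. by move=> N0 bA; apply: (act_bl mod) => //; have [] := @L1_gwin R d N n N0. Qed.

Lemma bl_phi1 n A : bl A -> bl (a (phi1 n) A).
Proof. by move=> bA; apply: (act_bl mod) => //; exact: L1_phi1. Qed.

(** Each window expands into unit windows whose centres lie within its width, so a gap of [64]
    between the unit centres remains. *)
Lemma vanish_gact N1 N2 n p A : (0 < N1)%N -> (0 < N2)%N -> bl A ->
  (64 + N1 + N2 <= ninf (n - p))%N -> a (gwin N1 n) (a (gwin N2 p) A) = @opzero R U V.
Proof.
move=> N10 N20 bA; have [->|[j ->]] := ninf_attained (n - p); first by lia.
rewrite !mxE => far; rewrite act_gwinE //; last exact: bl_gwin.
apply: opsum0 => l; rewrite mem_boxs => /ninf_leP /(_ j) lj.
rewrite act_gwinE // (act_sumr mod); first last.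
- by move=> k; exact: bl_phi1.
- exact: L1_phi1.
apply: opsum0 => k; rewrite mem_boxs => /ninf_leP /(_ j) kj.
apply: (vanish_act rep mod (j := j)) => //; rewrite !mxE.
by move: (n ord0 j) (p ord0 j) (l ord0 j) (k ord0 j) far lj kj => *; lia.
Qed.

Lemma vanish_ginv N n A : (0 < N)%N -> bl A -> (forall t, T t A = A) ->
  (64 + N <= ninf n)%N -> a (gwin N n) A = @opzero R U V.
Proof.
move=> N0 bA inv; have [->|[j ->]] := ninf_attained n; first by lia.
move=> far; rewrite act_gwinE //.
apply: opsum0 => l; rewrite mem_boxs => /ninf_leP /(_ j) lj.
apply: (vanish_inv rep mod (j := j)) => //; rewrite !mxE.
by move: (n ord0 j) (l ord0 j) far lj => *; lia.
Qed.

(** The functions [f] with this property form a closed linear subspace, and translation is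
    L^1-continuous on indicators of bounded open sets. *)
Lemma Tc_act_L1 f A : L1 f -> bl A -> T_continuous T (a f A).
Proof.
move=> Lf bA.
apply: (@L1_density R d (fun f => L1 f -> T_continuous T (a f A))) => //.
- move=> z g h Lg Lh Tg Th _; rewrite (mod_linl mod) //.
  by apply: (Tc_lin rep); [exact: (act_bl mod)|exact: (act_bl mod)|exact: Tg|exact: Th].
- move=> g Lg H _; apply: (Tc_lim rep) => [|e e0]; first exact: (act_bl mod).
  have A0 : 0 < opnorm A + 1 by rewrite ltr_wpDl // opnorm_ge0.
  have [|h [Lh Th gh]] := H (e / (opnorm A + 1)); first by rewrite divr_gt0.
  exists (a h A); split; [exact: (act_bl mod)|exact: Th|].
  rewrite opnorm_subC -(act_subl mod) //.
  apply: (le_trans (mod_norm mod (L1_sub Lg Lh) bA)).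
  apply: (@le_trans _ _ (e / (opnorm A + 1) * opnorm A)).
    by rewrite ler_wpM2r // opnorm_ge0.
  rewrite -mulrA ler_piMr ?(ltW e0) // mulrC ler_pdivrMr // mul1r lerDl.
  exact: ler01.
- move=> O n oO OQ LO; apply: (Tc_act rep mod) => //; exact: L1norm_shift_open oO OQ.
Qed.

End one.

Section three.
Variables U V W : BS.
Variables (TUV : 'rV[R]_d -> (U -> V) -> (U -> V)) (TVW : 'rV[R]_d -> (V -> W) -> (V -> W))
  (TUW : 'rV[R]_d -> (U -> W) -> (U -> W)).
Variables (aUV : ('rV[R]_d -> C) -> (U -> V) -> (U -> V))
  (aVW : ('rV[R]_d -> C) -> (V -> W) -> (V -> W))
  (aUW : ('rV[R]_d -> C) -> (U -> W) -> (U -> W)).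
Hypotheses (rUV : is_isometric_rep TUV) (rVW : is_isometric_rep TVW) (rUW : is_isometric_rep TUW).
Hypotheses (mUV : is_L1_module TUV aUV) (mVW : is_L1_module TVW aVW) (mUW : is_L1_module TUW aUW).
Hypothesis mult : rep_mult TUV TVW TUW.
Implicit Types (A : U -> V) (B : V -> W) (n m p : Zd).

Lemma vanish_gcomp N n m p A B : (0 < N)%N -> bl A -> bl B ->
  (64 + N + N <= ninf (n - (p + m)))%N ->
  aUW (gwin N n) (fun u => aVW (phi1 m) B (aUV (gwin N p) A u)) = @opzero R U W.
Proof.
move=> N0 bA bB; have [->|[j ->]] := ninf_attained (n - (p + m)); first by lia.
rewrite !mxE => far; have bB' := bl_phi1 mVW m bB.
rewrite (act_gwinE mUW) //; last by apply: bl_comp => //; exact: (bl_gwin mUV).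
apply: opsum0 => l; rewrite mem_boxs => /ninf_leP /(_ j) lj.
rewrite (act_gwinE mUV) // bl_opsum // (act_sumr mUW); first last.
- by move=> k; apply: bl_comp => //; exact: (bl_phi1 mUV).
- exact: L1_phi1.
apply: opsum0 => k; rewrite mem_boxs => /ninf_leP /(_ j) kj.
apply: (vanish_comp rUV rVW rUW mUV mVW mUW mult (j := j)) => //; rewrite !mxE.
by move: (n ord0 j) (p ord0 j) (m ord0 j) (l ord0 j) (k ord0 j) far lj kj => *; lia.
Qed.

Definition comm N n (B : V -> W) (A : U -> V) : U -> W :=
  opsub (aUW (gwin N n) (fun u => B (A u))) (fun u => B (aUV (gwin N n) A u)).

Lemma bl_comm N n B A : (0 < N)%N -> bl A -> bl B -> bl (comm N n B A).
Proof.
move=> N0 bA bB; apply: bl_sub; first by apply: (bl_gwin mUW) => //; exact: bl_comp.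
by apply: bl_comp => //; exact: (bl_gwin mUV).
Qed.

Lemma comm_le N n B A : (0 < N)%N -> bl A -> bl B ->
  opnorm (comm N n B A) <= 2 * cm * (opnorm B * opnorm A).
Proof.
move=> N0 bA bB; have bg := bl_gwin mUV n N0 bA; have bBA := bl_comp bA bB.
have c0 : 0 <= cm by rewrite exprn_ge0 // ltW // fejer_mass_gt0.
apply: (le_trans (opnorm_sub (bl_gwin mUW n N0 bBA) (bl_comp bg bB))).
have H1 : opnorm (aUW (gwin N n) (fun u => B (A u))) <= cm * (opnorm B * opnorm A).
  apply: (le_trans (opnorm_gwin mUW n N0 bBA)); rewrite ler_wpM2l //.
  exact: opnorm_comp.
have H2 : opnorm (fun u => B (aUV (gwin N n) A u)) <= cm * (opnorm B * opnorm A).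
  apply: (le_trans (opnorm_comp bg bB)); rewrite mulrCA ler_wpM2l ?opnorm_ge0 //.
  exact: (opnorm_gwin mUV).
by move: H1 H2; set x := _ * (_ * _); rewrite (_ : 2 * cm * _ = x + x); [exact: lerD|rewrite /x; ring].
Qed.

Lemma comm_suml N n I (r : seq I) (c : I -> C) (F : I -> V -> W) A : (0 < N)%N -> bl A ->
  (forall i, bl (F i)) -> comm N n (opsum r c F) A = opsum r c (fun i => comm N n (F i) A).
Proof.
move=> N0 bA bF; have [Lg _] := @L1_gwin R d N n N0.
have E : (fun u => opsum r c F (A u)) = opsum r c (fun i u => F i (A u)) by [].
rewrite /comm E (act_sumr mUW) //; last by move=> i; exact: bl_comp.
apply/funext => u; rewrite opsubE /opsum -sumrB; apply: eq_bigr => i _.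
by rewrite opsubE scalerBr.
Qed.

Lemma comm_sumr N n I (r : seq I) (c : I -> C) (F : I -> U -> V) B : (0 < N)%N -> bl B ->
  (forall i, bl (F i)) -> comm N n B (opsum r c F) = opsum r c (fun i => comm N n B (F i)).
Proof.
move=> N0 bB bF; have [Lg _] := @L1_gwin R d N n N0.
rewrite /comm bl_opsum // (act_sumr mUW) //; last by move=> i; exact: bl_comp.
rewrite (act_sumr mUV) // bl_opsum //.
apply/funext => u; rewrite opsubE /opsum -sumrB; apply: eq_bigr => i _.
by rewrite opsubE scalerBr.
Qed.

Lemma comm_subl N n B B' A : (0 < N)%N -> bl A -> bl B -> bl B' ->
  comm N n (opsub B B') A = opsub (comm N n B A) (comm N n B' A).
Proof.
move=> N0 bA bB bB'; have [Lg _] := @L1_gwin R d N n N0.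
have E : (fun u => opsub B B' (A u)) = opsub (fun u => B (A u)) (fun u => B' (A u)) by [].
rewrite /comm E (act_subr mUW) //; try exact: bl_comp.
by apply/funext => u; rewrite !opsubE; exact: subrACA.
Qed.

Lemma comm_subr N n B A A' : (0 < N)%N -> bl A -> bl A' -> bl B ->
  comm N n B (opsub A A') = opsub (comm N n B A) (comm N n B A').
Proof.
move=> N0 bA bA' bB; have [Lg _] := @L1_gwin R d N n N0.
have E : (fun u => B (opsub A A' u)) = opsub (fun u => B (A u)) (fun u => B (A' u)).
  by apply/funext => u; rewrite !opsubE blB.
rewrite /comm E (act_subr mUW) //; try exact: bl_comp.
rewrite (act_subr mUV) //.
by apply/funext => u; rewrite !opsubE blB //; exact: subrACA.
Qed.

End three.

End operators.

(** * The Beurling class *)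

Section beurling_class.
Context {R : realType} {d : nat}.
Local Notation C := R[i].
Local Notation BS := (completeNormedModType C).
Local Notation bl := is_bounded_linear.
Local Notation Zd := 'rV[int]_d.
Local Notation cm := ((@fejer_mass R) ^+ d).

Lemma cm_gt0 : 0 < cm.
Proof. by rewrite exprn_gt0 // fejer_mass_gt0. Qed.

Lemma opnorm_small (U V : BS) (A : U -> V) : bl A -> (forall e : R, 0 < e -> opnorm A <= e) ->
  A = @opzero R U V.
Proof.
move=> bA H; apply: opnorm0_eq => //; apply/eqP; rewrite eq_le opnorm_ge0 // andbT.
by apply/ler_addgt0Pr => e e0; rewrite add0r H.
Qed.

Lemma opsub_eq0 (U V : BS) (A B : U -> V) : opsub A B = @opzero R U V -> A = B.
Proof.
move=> AB; apply/funext => u; apply/eqP; rewrite -subr_eq0; apply/eqP.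
by have := congr1 (fun f => f u) AB; rewrite opsubE.
Qed.

Section one.
Variables U V : BS.
Variables (T : 'rV[R]_d -> (U -> V) -> (U -> V)) (a : ('rV[R]_d -> C) -> (U -> V) -> (U -> V)).
Hypotheses (rep : is_isometric_rep T) (mod : is_L1_module T a).
Variable A : U -> V.
Hypothesis bA : bl A.

Lemma beurling_radsum : (0 < d)%N -> (beurling_norm a A < +oo)%E ->
  exists X : R, radsum d (rsup (fun n : Zd => opnorm (a (phi1 n) A))) X.
Proof.
move=> d0; rewrite /beurling_norm; set f := fun n : Zd => opnorm _; set s := esum _ _ => soo.
have f0 n : 0 <= f n by apply: opnorm_ge0; exact: (bl_phi1 mod).
have fM n : f n <= cm * opnorm A by rewrite /f -gwin1; exact: (opnorm_gwin mod).
have g0 (k : Zd) : (0 <= ereal_sup [set (opnorm (a (phi1 n) A))%:E | n in [set n : Zd | (ninf k <= ninf n)%N]])%E.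
  apply: (@le_trans _ _ (f k)%:E); first by rewrite lee_fin.
  by apply: ereal_sup_ubound; exists k => /=.
have s0 : (0 <= s)%E by exact: esum_ge0.
exists (fine s); split => [k l kl|k|K].
- by apply: (rsup_le d0 fM) => j lj; apply: (beta_le_rsup d0 fM); exact: leq_trans lj.
- exact: (rsup_ge0 d0 f0 fM).
rewrite -lee_fin fineK ?ge0_fin_numE // -sumEFin; apply: esum_ge.
exists [set` boxs d K]; first by split => //; exact: finite_seq.
rewrite -fsbig_seq ?uniq_boxs //; apply: lee_sum => k _.
rewrite /rsup -ereal_sup_EFin; first last.
- by exists (f k); exists k => /=.
- by exists (cm * opnorm A) => _ [j _ <-].
by rewrite image_comp.
Qed.

Lemma radsum_beurling (u : nat -> R) (X : R) : radsum d u X ->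
  (forall n : Zd, opnorm (a (phi1 n) A) <= u (ninf n)) -> (beurling_norm a A < +oo)%E.
Proof.
move=> [um u0 uX] H; apply: (@le_lt_trans _ _ X%:E); last exact: ltry.
apply: ge_ereal_sup => _ [F [finF _] <-]; rewrite fsbig_finite //=.
apply: le_trans.
  apply: (@lee_sum _ _ _ (fun k => (u (ninf k))%:E)) => k _; apply: ge_ereal_sup => _ [n kn <-]; rewrite lee_fin.
  by apply: (le_trans (H n)); exact: um.
rewrite sumEFin lee_fin; apply: (@sum_uniq_le d R (fun j => u (ninf j))) => //.
exact: finmap.fset_uniq.
Qed.

Section summable.
Variables (u : nat -> R) (X : R).
Hypothesis ru : radsum d u X.
Hypothesis uA : forall m : Zd, opnorm (a (phi1 m) A) <= u (ninf m).

Let F (m : Zd) := a (phi1 m) A.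

Let bF m : bl (F m). Proof. exact: (bl_phi1 mod). Qed.

(** On the box of radius [M] the triangle weights differ from 1 by at most [d M / K]; the remaining
    terms have weights at most 1 and are controlled by the tail. The comparison sum does not depend
    on [K], which gives the Cauchy property. *)
Lemma window_near_partial M K (tau : R) : (0 < K)%N -> (M <= K)%N ->
  (forall L, \sum_(m <- boxs d L | (M < ninf m)%N) u (ninf m) <= tau) ->
  opnorm (opsub (a (gwin K 0) A) (opsum (boxs d M) (fun=> 1) F)) <=
  (size (boxs d M))%:R * ((d * M)%:R / K%:R * u 0%N) + tau.
Proof.
move=> K0 MK Htau; have [um u0 _] := ru.
have KR : 0 < K%:R :> R by rewrite ltr0n.
pose w (m : Zd) : R := wt K m - (if (ninf m <= M)%N then 1 else 0).
have -> : opsub (a (gwin K 0) A) (opsum (boxs d M) (fun=> 1) F) =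
    opsum (boxs d K) (fun m => (w m)%:C) F.
  rewrite (act_gwinE mod) //; apply/funext => x; rewrite opsubE /opsum.
  rewrite (sum_boxs_restrict _ MK) [X in _ - X]big_mkcond -sumrB; apply: eq_bigr => m _.
  rewrite add0r /w /F; case: ifP => _; last by rewrite !subr0.
  by rewrite rmorphB scalerBl.
apply: (le_trans (opnorm_sum _ _ bF)).
apply: (@le_trans _ _ (\sum_(m <- boxs d K) (if (ninf m <= M)%N then (d * M)%:R / K%:R * u 0%N
    else u (ninf m)))).
  rewrite big_seq [leRHS]big_seq; apply: ler_sum => m; rewrite mem_boxs => mK.
  have w0 := @wt_ge0 R d K m mK; have w1 := @wt_le1 R d K m mK.
  rewrite nrm_real /w; case: ifP => mM.
    rewrite distrC ger0_norm ?subr_ge0 //; apply: ler_pM.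
    - by rewrite subr_ge0.
    - exact: opnorm_ge0.
    - apply: (le_trans (@one_sub_wt R d K m K0 mK)); rewrite ler_pM2r ?invr_gt0 // ler_nat.
      by rewrite leq_mul2l mM orbT.
    - by apply: (le_trans (uA m)); exact: um.
  rewrite subr0 ger0_norm //; apply: (le_trans (ler_piMl _ w1)); first exact: opnorm_ge0.
  exact: uA.
rewrite (bigID (fun m => (ninf m <= M)%N)) /=; apply: lerD.
  rewrite -(sum_boxs_restrict _ MK) big_seq (eq_bigr (fun=> (d * M)%:R / K%:R * u 0%N)); last first.
    by move=> m; rewrite mem_boxs => ->.
  by rewrite -big_seq big_const_seq count_predT iter_addr_0 -[leLHS]mulr_natl.
apply: le_trans (Htau K); rewrite (eq_bigl (fun m => (M < ninf m)%N)); last first.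
  by move=> m; rewrite -ltnNge.
by apply: ler_sum => m; rewrite ltnNge => /negbTE ->.
Qed.

Lemma window_cauchy (e : R) : 0 < e -> exists K0, forall K L, (K0 <= K)%N -> (K0 <= L)%N ->
  opnorm (opsub (a (gwin K.+1 0) A) (a (gwin L.+1 0) A)) <= e.
Proof.
move=> e0; have e4 : 0 < e / 4 by rewrite divr_gt0.
have [um u0 _] := ru; have [M HM] := radsum_tail ru e4.
pose Z : R := (size (boxs d M))%:R * ((d * M)%:R * u 0%N).
have Z0 : 0 <= Z by rewrite !mulr_ge0.
(* Beyond this index the weight error [Z / k.+1] is at most [e / 4], as the tail is. *)
pose K1 := (Num.truncn (Z / (e / 4))).+1; exists (maxn M K1) => K L.
have H k : (maxn M K1 <= k)%N ->
    opnorm (opsub (a (gwin k.+1 0) A) (opsum (boxs d M) (fun=> 1) F)) <= e / 2.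
  rewrite geq_max => /andP[Mk Kk].
  apply: (le_trans (window_near_partial (ltn0Sn k) (leq_trans Mk (leqnSn k)) HM)).
  have kR : 0 < k.+1%:R :> R by rewrite ltr0n.
  have -> : (size (boxs d M))%:R * ((d * M)%:R / k.+1%:R * u 0%N) = Z / k.+1%:R :> R.
    by rewrite /Z; ring.
  suff h : Z / k.+1%:R <= e / 4.
    by apply: (@le_trans _ _ (e / 4 + e / 4)); [rewrite lerD2r|lra].
  rewrite ler_pdivrMr // mulrC -ler_pdivrMr // (le_trans (ltW (Num.Theory.truncnS_gt _))) //.
  by rewrite ler_nat (leq_trans Kk).
move=> /H HK /H HL; have bP := bl_sum (boxs d M) (fun=> 1) bF.
apply: (le_trans (opnorm_triangle (bl_gwin mod 0 (ltn0Sn K) bA) bP (bl_gwin mod 0 (ltn0Sn L) bA))).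
by rewrite [X in _ + X]opnorm_subC; lra.
Qed.

Variables (TU : 'rV[R]_d -> (U -> U) -> (U -> U)) (aU : ('rV[R]_d -> C) -> (U -> U) -> (U -> U)).
Hypotheses (repU : is_isometric_rep TU) (modU : is_L1_module TU aU).
Hypothesis inv : forall t, TU t id = id.
Hypothesis mult : rep_mult TU T T.

(* Testing against indicators [f] of bounded open sets works because [f A] is
   [T]-continuous although [A] is not yet known to be. *)
Lemma window_limit (L : U -> V) : bl L ->
  (forall e : R, 0 < e -> exists N, forall n, (N <= n)%N -> opnorm (opsub (a (gwin n.+1 0) A) L) <= e) ->
  L = opscale cm%:C A.
Proof.
move=> bL HL; apply: opsub_eq0; set D := opsub _ _.
have bD : bl D by apply: bl_sub => //; exact: bl_scale.
apply: (mod_nondeg mod bD) => f Lf.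
apply: (@L1_density R d (fun f => L1 f -> a f D = @opzero R U V)) => //.
- move=> z g h Lg Lh Hg Hh _; rewrite (mod_linl mod) // Hg // Hh //.
  by apply/funext => x; rewrite /opadd /opscale /opzero scaler0 addr0.
- move=> g Lg H _; apply: opnorm_small => [|e e0]; first exact: (act_bl mod).
  have D0 : 0 < opnorm D + 1 by rewrite ltr_wpDl // opnorm_ge0.
  have [|h [Lh Hh gh]] := H (e / (opnorm D + 1)); first by rewrite divr_gt0.
  have -> : a g D = a (fun t => g t + -1 * h t) D.
    rewrite (act_subl mod) // Hh //; apply/funext => x; by rewrite opsubE /opzero subr0.
  apply: (le_trans (mod_norm mod (L1_sub Lg Lh) bD)).
  apply: (@le_trans _ _ (e / (opnorm D + 1) * opnorm D)).
    by rewrite ler_wpM2r // opnorm_ge0.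
  rewrite -mulrA ler_piMr ?(ltW e0) // mulrC ler_pdivrMr // mul1r lerDl.
  exact: ler01.
- move=> O n oO OQ; set g := fun t => _ => Lg.
  have bg := act_bl mod Lg bA; apply: opnorm_small => [|e e0]; first exact: (act_bl mod).
  have e2 : 0 < e / 2 by rewrite divr_gt0.
  have [N1 H1] := approx_identity rep mod repU modU inv mult bg (Tc_act_L1 rep mod Lg bA) e2.
  have G0 : 0 < `|L1norm g| + 1 by rewrite ltr_wpDl.
  have [|N2 H2] := HL (e / 2 / (`|L1norm g| + 1)); first by rewrite divr_gt0.
  pose k := maxn N1 N2; have [Lk _] := @L1_gwin R d k.+1 0 (ltn0Sn k).
  have bk := bl_gwin mod 0 (ltn0Sn k) bA.
  (* Exchanging the two actions lets the window act on the [T]-continuous operator [g A], where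
     [approx_identity] applies. *)
  have swap : a g (a (gwin k.+1 0) A) = a (gwin k.+1 0) (a g A).
    rewrite -!(mod_conv mod) // (@conv_comm R d (gwin k.+1 0) g) //.
    + exact: Cmeas_gwin.
    + by have /L1P[] := Lg.
    + have [_ [M HM]] := @domRd_fwin R d k.+1 (ltn0Sn k); exists M => t.
      by rewrite nrm_gwin; apply: le_trans (HM t); exact: ler_norm.
    + exists 1 => t; rewrite /g nrm_real indicE; case: (_ \in _); by rewrite ?normr1 ?normr0.
  have -> : a g D = opsub (a g L) (opscale cm%:C (a g A)).
    by rewrite /D (act_subr mod) //; [rewrite (act_scale mod)|exact: bl_scale].
  have bs : bl (opscale cm%:C (a g A)) by exact: bl_scale.
  have bgL := act_bl mod Lg bL; have bgk := bl_gwin mod 0 (ltn0Sn k) bg.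
  apply: (le_trans (opnorm_triangle bgL bgk bs)).
  have h1 := H1 k.+1 (leq_trans (leq_maxl _ _) (leqnSn _)) (ltn0Sn k).
  suff h2 : opnorm (opsub (a g L) (a (gwin k.+1 0) (a g A))) <= e / 2 by lra.
  rewrite -swap -(act_subr mod) // (le_trans (mod_norm mod Lg (bl_sub bL bk))) // opnorm_subC.
  apply: (@le_trans _ _ ((`|L1norm g| + 1) * (e / 2 / (`|L1norm g| + 1)))).
    apply: ler_pM => //.
    + rewrite L1normE //; apply: fine_ge0; apply: integral_ge0 => t _.
      by rewrite lee_fin; exact: nrm_ge0.
    + by apply: opnorm_ge0; exact: bl_sub.
    + by rewrite (le_trans (ler_norm _)) // lerDl ler01.
    + by apply: H2; exact: leq_maxr.
  by rewrite mulrC divfK // gt_eqF.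
Qed.

Theorem beurling_Tc : T_continuous T A.
Proof.
have bG n := bl_gwin mod 0 (ltn0Sn n) bA.
have [L bL HL] := opnorm_cauchy_cvg bG window_cauchy.
have LA := window_limit bL HL.
have cL : T_continuous T L.
  apply: (Tc_lim rep) => // e e0; have [N HN] := HL e e0.
  exists (a (gwin N.+1 0) A); split => //; last exact: HN.
  by apply: (Tc_act_L1 rep mod) => //; have [] := @L1_gwin R d N.+1 0 (ltn0Sn N).
have -> : A = opadd (opscale (cm^-1)%:C L) (@opzero R U V).
  apply/funext => x; rewrite LA /opadd /opscale /opzero addr0 scalerA -rmorphM /=.
  by rewrite mulVf ?scale1r // gt_eqF // cm_gt0.
by apply: (Tc_lin rep) => //; [exact: bl_opzero|exact: (Tc_zero rep)].
Qed.

End summable.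
End one.

End beurling_class.

(** * Separation of window centres in units of the width *)

Section separation.
Variable d : nat.
Implicit Types (i j k m n : 'rV[int]_d).

Lemma ninfZ N k : ninf (N%:Z *: k) = (N * ninf k)%N.
Proof.
apply/eqP; rewrite eqn_leq; apply/andP; split.
  by apply/ninf_leP => i; rewrite mxE abszM absz_nat leq_mul2l ninf_ge orbT.
have [->|[i ->]] := ninf_attained k; first by rewrite muln0.
by have := ninf_ge (N%:Z *: k) i; rewrite mxE abszM absz_nat.
Qed.

Lemma ninf0 : ninf (0 : 'rV[int]_d) = 0%N.
Proof. by apply/eqP; rewrite -leqn0; apply/ninf_leP => i; rewrite mxE. Qed.

Lemma ninfB k m : ninf (k - m) = ninf (m - k).
Proof. by rewrite -ninfN opprB. Qed.

Lemma vdiv0 N : vdiv N (0 : 'rV[int]_d) = 0.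
Proof. by apply/rowP => i; rewrite !mxE div0z. Qed.

(** Beyond radius 67 the centres are at least [68 N] apart, which for every [N >= 1] leaves the
    required [64 + 2 N] even after losing a remainder of size [N], as happens in the next lemmas. *)
Lemma far_scaled N i j : (0 < N)%N -> (67 < ninf (i - j))%N ->
  (64 + N + N <= ninf (N%:Z *: j - N%:Z *: i))%N.
Proof. by move=> N0; rewrite -scalerBr ninfZ ninfB; move: (ninf _) => x; nia. Qed.

Lemma far_small N i j m : (0 < N)%N -> (ninf m <= N)%N -> (67 < ninf (i - j))%N ->
  (64 + N + N <= ninf (N%:Z *: j - (N%:Z *: i + m)))%N.
Proof.
move=> N0 mN far; have := ninf_triangle (N%:Z *: j - (N%:Z *: i + m)) m.
have -> : N%:Z *: j - (N%:Z *: i + m) + m = N%:Z *: (j - i).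
  by rewrite scalerBr opprD addrA subrK.
rewrite ninfZ ninfB; move: mN far.
by move: (ninf _) (ninf _) (ninf _) => x y z; nia.
Qed.

Lemma far_large N i j m : (0 < N)%N -> (67 < ninf (i - (j - vdiv N m)))%N ->
  (64 + N + N <= ninf (N%:Z *: j - (N%:Z *: i + m)))%N.
Proof.
move=> N0 far; have := ninf_triangle (N%:Z *: j - (N%:Z *: i + m)) (m - N%:Z *: vdiv N m).
have -> : N%:Z *: j - (N%:Z *: i + m) + (m - N%:Z *: vdiv N m) = N%:Z *: (j - vdiv N m - i).
  by rewrite !scalerBr opprD !addrA subrK addrAC.
rewrite ninfZ; have := vdiv_rem m N0; move: far; rewrite ninfB.
by move: (ninf _) (ninf _) (ninf _) => x y z; nia.
Qed.

Lemma far_vdiv N i n : (0 < N)%N -> (67 < ninf (i - vdiv N n))%N ->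
  (64 + 1 + N <= ninf (n - N%:Z *: i))%N.
Proof.
move=> N0 far; have := ninf_triangle (n - N%:Z *: i) (N%:Z *: vdiv N n - n).
have -> : n - N%:Z *: i + (N%:Z *: vdiv N n - n) = N%:Z *: (vdiv N n - i).
  by rewrite scalerBr addrC addrA subrK.
rewrite [ninf (_ - n)]ninfB ninfZ; have := vdiv_rem n N0; move: far; rewrite ninfB.
by move: (ninf _) (ninf _) (ninf _) => x y z; nia.
Qed.

Lemma ninf_vdiv_add N n i r : (0 < N)%N -> (ninf i <= r)%N ->
  (ninf n %/ N - r <= ninf (vdiv N n + i))%N.
Proof.
move=> N0 ir; have := ninf_triangle (vdiv N n + i) (- i); rewrite ninfN addrK.
have := ninf_vdiv_ge n N0; move: ir.
by move: (ninf _) (ninf _) (ninf _) (ninf _ %/ N)%N => x y z t; lia.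
Qed.

End separation.

(** * The inverse *)

Section inverse.
Context {R : realType} {d : nat}.
Local Notation C := R[i].
Local Notation BS := (completeNormedModType C).
Local Notation bl := is_bounded_linear.
Local Notation Zd := 'rV[int]_d.
Local Notation cm := ((@fejer_mass R) ^+ d).
Hypothesis d_gt0 : (0 < d)%N.
Variables X Y : BS.
Variables (TXY : 'rV[R]_d -> (X -> Y) -> (X -> Y)) (TYX : 'rV[R]_d -> (Y -> X) -> (Y -> X))
  (TXX : 'rV[R]_d -> (X -> X) -> (X -> X)) (TYY : 'rV[R]_d -> (Y -> Y) -> (Y -> Y)).
Variables (aXY : ('rV[R]_d -> C) -> (X -> Y) -> (X -> Y)) (aYX : ('rV[R]_d -> C) -> (Y -> X) -> (Y -> X))
  (aXX : ('rV[R]_d -> C) -> (X -> X) -> (X -> X)) (aYY : ('rV[R]_d -> C) -> (Y -> Y) -> (Y -> Y)).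
Hypotheses (repXY : is_isometric_rep TXY) (repYX : is_isometric_rep TYX)
  (repXX : is_isometric_rep TXX) (repYY : is_isometric_rep TYY).
Hypotheses (modXY : is_L1_module TXY aXY) (modYX : is_L1_module TYX aYX)
  (modXX : is_L1_module TXX aXX) (modYY : is_L1_module TYY aYY).
Hypotheses (mXXY : rep_mult TXX TXY TXY) (mXYX : rep_mult TXY TYX TXX)
  (mYXY : rep_mult TYX TXY TYY) (mYYX : rep_mult TYY TYX TYX).
Hypothesis coupled : rep_coupled TXY TYX.
Variables (A : X -> Y) (B : Y -> X).
Hypotheses (bA : bl A) (bB : bl B) (AB : mutually_inverse A B).

Let TAB t : mutually_inverse (TXY t A) (TYX t B).
Proof. exact: (proj1 (coupled bA bB) AB). Qed.

(** Coupling makes [T t A] and [T t B] mutually inverse, so the product rule applied to [B A = 1]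
    shows that the identity is invariant. *)
Lemma inv_idX t : TXX t id = id.
Proof.
have E : (fun x => B (A x)) = id by apply/funext => x; case: AB => _ ->.
by rewrite -{1}E mXYX //; apply/funext => x; case: (TAB t) => _ ->.
Qed.

Lemma inv_idY t : TYY t id = id.
Proof.
have E : (fun y => A (B y)) = id by apply/funext => y; case: AB => ->.
by rewrite -{1}E mYXY //; apply/funext => y; case: (TAB t) => ->.
Qed.

(** The resolvent identity [T t B - B = - T t B (T t A - A) B], together with the isometry of
    [T t]. *)
Lemma Tc_inverse : T_continuous TXY A -> T_continuous TYX B.
Proof.
move=> cA; apply: (Tc_intro repYX) => // e e0.
have B0 : 0 < opnorm B ^+ 2 + 1 by rewrite ltr_wpDl // sqr_ge0.
have [|delta d0 Hd] := Tc_elim repXY (e := e / (opnorm B ^+ 2 + 1)) bA cA; first by rewrite divr_gt0.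
exists delta => // t /Hd tA.
have bTA := T_bl repXY t bA; have bTB := T_bl repYX t bB; have bD := bl_sub bTA bA.
have -> : opsub (TYX t B) B = opscale (-1) (fun y => TYX t B (opsub (TXY t A) A (B y))).
  apply/funext => y; rewrite /opscale !opsubE scaleN1r blB // opprB.
  by have [_ ->] := TAB t; have [-> _] := AB.
rewrite opnorm_scale; last by apply: bl_comp bTB; exact: bl_comp.
rewrite nrmN nrm1 mul1r (le_trans (opnorm_comp (bl_comp bB bD) bTB)) //.
rewrite (T_norm repYX) //.
apply: (@le_trans _ _ (opnorm B * ((e / (opnorm B ^+ 2 + 1)) * opnorm B))).
  rewrite ler_wpM2l ?opnorm_ge0 // (le_trans (opnorm_comp bB bD)) //.
  by rewrite ler_wpM2r ?opnorm_ge0.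
rewrite (_ : _ * _ = e * (opnorm B ^+ 2 / (opnorm B ^+ 2 + 1))); last by ring.
by rewrite ler_piMr ?(ltW e0) // ler_pdivrMr // mul1r lerDl ler01.
Qed.

Hypothesis cA : T_continuous TXY A.
Hypothesis cB : T_continuous TYX B.

Let c0 : 0 < cm. Proof. exact: cm_gt0. Qed.

Variables (N M : nat) (eps : R).
Hypotheses (N_gt0 : (0 < N)%N) (MN : (M <= N)%N) (eps0 : 0 < eps).

Let Ap (m : Zd) : X -> Y := aXY (phi1 m) A.
Let alpha m : R := opnorm (Ap m).
Let Bp (i : Zd) : Y -> X := aYX (gwin N (N%:Z *: i)) B.
Let beta i : R := opnorm (Bp i).
Let r := 67%N.
Let near (x : Zd) : R := \sum_(i <- boxs d r) beta (x + i).
Let cmm (j : Zd) := comm aYX aYY N (N%:Z *: j).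

Hypothesis commN : forall m, (ninf m <= M)%N -> forall n (D : Y -> X), bl D -> T_continuous TYX D ->
  opnorm (comm aYX aYY N n (Ap m) D) <= eps * opnorm D.

Let bAp m : bl (Ap m). Proof. exact: (bl_phi1 modXY). Qed.
Let bBp i : bl (Bp i). Proof. exact: (bl_gwin modYX). Qed.
Let alpha0 m : 0 <= alpha m. Proof. exact: opnorm_ge0. Qed.
Let beta0 i : 0 <= beta i. Proof. exact: opnorm_ge0. Qed.
Let near0 x : 0 <= near x. Proof. exact: sumr_ge0. Qed.

(** No cancellation is used: the two halves of the commutator are bounded separately. The first
    survives only for [i] near [j - m / N], the second only for [i] near [j]. *)
Let cmm_split j m i : opnorm (cmm j (Ap m) (Bp i)) <=
  (if (ninf (i - j) <= r)%N then cm * alpha m * beta i else 0) +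
  (if (ninf (i - (j - vdiv N m)) <= r)%N then cm * alpha m * beta i else 0).
Proof.
have bc := bl_comp (bBp i) (bAp m); have bg := bl_gwin modYX (N%:Z *: j) N_gt0 (bBp i).
rewrite addrC (le_trans (opnorm_sub (bl_gwin modYY (N%:Z *: j) N_gt0 bc) (bl_comp bg (bAp m)))) //.
apply: lerD.
  case: leqP => far.
    apply: (le_trans (opnorm_gwin modYY _ N_gt0 bc)); rewrite -mulrA ler_wpM2l ?(ltW c0) //.
    exact: opnorm_comp.
  rewrite (vanish_gcomp repYX repXY repYY modYX modXY modYY mYXY) ?opnorm_opzero //.
  exact: far_large.
case: leqP => far.
  apply: (le_trans (opnorm_comp bg (bAp m))); rewrite -mulrA mulrCA ler_wpM2l ?opnorm_ge0 //.
  exact: (opnorm_gwin modYX).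
rewrite (vanish_gact repYX modYX) //.
  rewrite (_ : (fun u => _) = @opzero R Y Y) ?opnorm_opzero //.
  by apply/funext => y; rewrite /opzero bl0.
exact: far_scaled.
Qed.

(** For [|m| <= M <= N] multiplication by the piece moves centres by at most one unit, so both
    halves vanish unless [i] is near [j]; there the cancellation in the commutator gives [eps]. *)
Let cmm_small j m i : (ninf m <= M)%N -> opnorm (cmm j (Ap m) (Bp i)) <=
  if (ninf (i - j) <= r)%N then eps * beta i else 0.
Proof.
move=> mM; case: leqP => far.
  apply: commN => //; apply: (Tc_act_L1 repYX modYX) => //.
  by have [] := @L1_gwin R d N (N%:Z *: i) N_gt0.
rewrite /cmm /comm (vanish_gcomp repYX repXY repYY modYX modXY modYY mYXY) //.
  rewrite (vanish_gact repYX modYX) //.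
    rewrite (_ : opsub _ _ = @opzero R Y Y) ?opnorm_opzero //.
    by apply/funext => y; rewrite opsubE /opzero bl0 // subrr.
  exact: far_scaled.
by apply: far_small => //; exact: leq_trans mM MN.
Qed.

Let nrm_wt K (l : Zd) : l \in boxs d K -> nrm ((wt K l)%:C : C) <= 1.
Proof.
rewrite mem_boxs => lK; rewrite nrm_real ger0_norm; first exact: wt_le1.
exact: wt_ge0.
Qed.

Let cmm_sum j K L : opnorm (cmm j (aXY (gwin K.+1 0) A) (aYX (gwin (L.+1 * N) 0) B)) <=
  \sum_(m <- boxs d K.+1) (if (ninf m <= M)%N then eps * near j
    else cm * alpha m * (near j + near (j - vdiv N m))).
Proof.
have -> : aXY (gwin K.+1 0) A = opsum (boxs d K.+1) (fun l => (wt K.+1 l)%:C) Ap.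
  by rewrite (act_gwinE modXY) //; congr opsum; apply/funext => m; rewrite add0r.
have -> : aYX (gwin (L.+1 * N) 0) B = opsum (boxs d L.+1) (fun l => (wt L.+1 l)%:C) Bp.
  by rewrite (act_gwin_mul modYX) //; congr opsum; apply/funext => m; rewrite add0r.
set S := opsum (boxs d L.+1) _ _.
have bS : bl S by exact: bl_sum.
rewrite /cmm (comm_suml aYX modYY) //.
have bc m i : bl (cmm j (Ap m) (Bp i)) by exact: (bl_comm modYX modYY).
have bcS m : bl (cmm j (Ap m) S) by exact: (bl_comm modYX modYY).
apply: (le_trans (opnorm_sum _ _ bcS)).
rewrite big_seq [leRHS]big_seq; apply: ler_sum => m mK.
apply: (@le_trans _ _ (opnorm (cmm j (Ap m) S))).
  by rewrite ler_piMl ?opnorm_ge0 // nrm_wt.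
rewrite /S /cmm (comm_sumr modYX modYY) //.
apply: (le_trans (opnorm_sum _ _ (bc m))).
apply: (@le_trans _ _ (\sum_(i <- boxs d L.+1) opnorm (cmm j (Ap m) (Bp i)))).
  rewrite big_seq [leRHS]big_seq; apply: ler_sum => i iL.
  by rewrite ler_piMl ?opnorm_ge0 // nrm_wt.
case: ifP => mM.
  apply: (@le_trans _ _ (\sum_(i <- boxs d L.+1) if (ninf (i - j) <= r)%N then eps * beta i else 0)).
    by apply: ler_sum => i _; exact: cmm_small.
  rewrite -big_mkcond -mulr_sumr ler_wpM2l ?(ltW eps0) //; exact: sum_near.
apply: le_trans; first by apply: ler_sum => i _; exact: cmm_split.
rewrite big_split /= -!big_mkcond -!mulr_sumr mulrDr.
have ca : 0 <= cm * alpha m by rewrite mulr_ge0 // ltW.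
by apply: lerD; rewrite ler_wpM2l //; exact: sum_near.
Qed.

(** Replacing [A] and [B] by wide windows multiplies each by [cm]; dividing by [cm ^+ 2] undoes
    both. *)
Let DB : R := opnorm B / cm ^+ 2.

Let DB0 : 0 <= DB. Proof. by rewrite divr_ge0 ?opnorm_ge0 // exprn_ge0 // ltW. Qed.

(** Apply [B] to [A (G_j B) = G_j 1 - comm]: since [B A = 1], the left-hand side becomes [G_j B]. *)
Let beta_le j : beta j <= opnorm B * opnorm (aYY (gwin N (N%:Z *: j)) id) + opnorm B * opnorm (cmm j A B).
Proof.
have bi := @bl_id R Y; have bgi := bl_gwin modYY (N%:Z *: j) N_gt0 bi.
have E : (fun y => A (B y)) = id by apply/funext => y; case: AB => ->.
have bc : bl (cmm j A B) by exact: (bl_comm modYX modYY).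
have bs := bl_sub bgi bc.
have -> : beta j = opnorm (fun y => B (opsub (aYY (gwin N (N%:Z *: j)) id) (cmm j A B) y)).
  rewrite /beta; congr opnorm; apply/funext => y; rewrite opsubE /cmm /comm opsubE E.
  by rewrite opprB addrC subrK; case: AB => _ ->.
apply: (le_trans (opnorm_comp bs bB)); rewrite -mulrDr ler_wpM2l ?opnorm_ge0 //.
exact: opnorm_sub.
Qed.

Let cmm_approx j (e : R) : 0 < e -> exists K, DB * opnorm (opscale (cm ^+ 2)%:C (cmm j A B)) <= e +
  DB * \sum_(m <- boxs d K) (if (ninf m <= M)%N then eps * near j
    else cm * alpha m * (near j + near (j - vdiv N m))).
Proof.
move=> e0; pose q := DB * (2 * cm * (cm * opnorm A + cm * opnorm B)).
have q0 : 0 <= q.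
  apply: mulr_ge0 => //; apply: mulr_ge0; first by rewrite mulr_ge0 // ltW.
  by rewrite -mulrDr mulr_ge0 ?(ltW c0) // addr_ge0 // opnorm_ge0.
(* The two replacement errors amount to [q * eta] after multiplication by [DB]; [q + 1] avoids
   division by zero. *)
pose eta := e / (q + 1); have q1 : 0 < q + 1 by rewrite ltr_wpDl.
have eta0 : 0 < eta by rewrite divr_gt0.
have [K HK] := approx_identity repXY modXY repXX modXX inv_idX mXXY bA cA eta0.
have [L HL] := approx_identity repYX modYX repYY modYY inv_idY mYYX bB cB eta0.
exists K.+1; have {HK}HK := HK K.+1 (leqnSn K) (ltn0Sn K).
have LN : (L <= L.+1 * N)%N := leq_trans (leqnSn L) (leq_pmulr L.+1 N_gt0).
have LN0 : (0 < L.+1 * N)%N by rewrite muln_gt0 N_gt0.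
have {HL}HL := HL _ LN LN0.
set S := aXY _ _ in HK; set S' := aYX _ _ in HL.
have bS : bl S by exact: (bl_gwin modXY).
have bS' : bl S' by exact: (bl_gwin modYX).
set cAA := opscale _ A in HK; set cBB := opscale _ B in HL.
have bcA : bl cAA by exact: bl_scale.
have bcB : bl cBB by exact: bl_scale.
have E : opscale (cm ^+ 2)%:C (cmm j A B) = cmm j cAA cBB.
  (* A scalar multiple is viewed as a one-term sum, so that linearity of [comm] supplies homogeneity
     as well. *)
  have one (U V : BS) (z : C) (D : U -> V) : opsum [:: tt] (fun=> z) (fun=> D) = opscale z D.
    by apply/funext => x; rewrite /opsum big_seq1.
  have E1 D : bl D -> cmm j D cBB = opscale cm%:C (cmm j D B).
    by move=> bD; rewrite /cBB -!one /cmm (comm_sumr modYX modYY).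
  have E2 D : bl D -> cmm j cAA D = opscale cm%:C (cmm j A D).
    by move=> bD; rewrite /cAA -!one /cmm (comm_suml aYX modYY).
  rewrite E2 // E1 //; apply/funext => y.
  by rewrite /opscale scalerA -rmorphM /= expr2.
rewrite E.
have T1 : opnorm (cmm j cAA cBB) <= opnorm (cmm j S S') +
    (2 * cm * (eta * (cm * opnorm B)) + 2 * cm * (cm * opnorm A * eta)).
  have b3 : bl (cmm j S S') by exact: (bl_comm modYX modYY).
  have -> : cmm j cAA cBB = opadd (cmm j S S') (opadd (cmm j (opsub cAA S) cBB) (cmm j S (opsub cBB S'))).
    rewrite /cmm (comm_subl aYX modYY) // (comm_subr modYX modYY) //.
    move: (comm _ _ _ _ cAA cBB) (comm _ _ _ _ S cBB) (comm _ _ _ _ S S') => f g h.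
    apply/funext => y; change (f y = h y + (opsub f g y + opsub g h y)).
    by rewrite !opsubE [RHS]addrC -addrA !subrK.
  have b4 : bl (cmm j (opsub cAA S) cBB) by apply: (bl_comm modYX modYY) => //; exact: bl_sub.
  have b5 : bl (cmm j S (opsub cBB S')) by apply: (bl_comm modYX modYY) => //; exact: bl_sub.
  apply: (le_trans (opnorm_add b3 (bl_add b4 b5))); rewrite lerD2l.
  apply: (le_trans (opnorm_add b4 b5)); apply: lerD.
    apply: (le_trans (comm_le modYX modYY _ N_gt0 bcB (bl_sub bcA bS))).
    rewrite ler_wpM2l ?mulr_ge0 ?(ltW c0) //; apply: ler_pM.
    - by apply: opnorm_ge0; exact: bl_sub.
    - exact: opnorm_ge0.
    - by rewrite opnorm_subC.
    - by rewrite opnorm_scale // nrm_real ger0_norm ?(ltW c0).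
  apply: (le_trans (comm_le modYX modYY _ N_gt0 (bl_sub bcB bS') bS)).
  rewrite ler_wpM2l ?mulr_ge0 ?(ltW c0) //; apply: ler_pM.
  - exact: opnorm_ge0.
  - by apply: opnorm_ge0; exact: bl_sub.
  - exact: (opnorm_gwin modXY).
  - by rewrite opnorm_subC.
have T2 := cmm_sum j K L.
have qe : q * eta <= e.
  by rewrite /eta mulrCA ler_piMr ?(ltW e0) // ler_pdivrMr // mul1r lerDl ler01.
apply: (le_trans (ler_wpM2l DB0 (le_trans T1 (lerD T2 (lexx _))))).
rewrite mulrDr addrC lerD2r; apply: le_trans qe.
by rewrite le_eqVlt; apply/orP; left; apply/eqP; rewrite /q; ring.
Qed.

Variables (u : nat -> R) (Xu tau : R).
Hypotheses (ru : radsum d u Xu) (alpha_u : forall m, alpha m <= u (ninf m)) (tau0 : 0 <= tau).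
Hypothesis tail : forall K, \sum_(m <- boxs d K | (M < ninf m)%N) alpha m <= tau.

(** Collects the coefficients of [near j]: at most as many [eps] as the box of radius [M] has
    points, plus the half of the large-[m] terms that is centred at [j]. In [e_] it is placed at
    [m = 0], where [vdiv N m = 0]. *)
Let E0 : R := DB * ((size (boxs d M))%:R * eps + cm * tau).
Let e_ (m : Zd) : R := (if m == 0 then E0 else 0) +
  (if (ninf m <= M)%N then 0 else DB * cm * alpha m).
Let eta : R := E0 + DB * cm * tau.

Hypothesis eta_small : eta * (size (boxs d r))%:R * (size (boxs d 2))%:R <= 2^-1.

Let E00 : 0 <= E0.
Proof. by rewrite mulr_ge0 // addr_ge0 // mulr_ge0 // ltW. Qed.

Let Dc0 : 0 <= DB * cm. Proof. by rewrite mulr_ge0 // ltW. Qed.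

Let sum_delta K (f : Zd -> R) : \sum_(m <- boxs d K) (if m == 0 then f m else 0) = f 0.
Proof.
rewrite (bigD1_seq 0) ?uniq_boxs ?mem_boxs ?ninf0 //= eqxx big1 ?addr0 //.
by move=> m /negbTE ->.
Qed.

Let local_ineq j (delta : R) : 0 < delta -> exists K,
  beta j <= (if (ninf j <= 65)%N then opnorm B * cm else 0) + delta +
    \sum_(m <- boxs d K) e_ m * \sum_(i <- boxs d r) beta (j - vdiv N m + i).
Proof.
move=> delta0; have [K HK] := cmm_approx j delta0; exists K.
have bc : bl (cmm j A B) by exact: (bl_comm modYX modYY).
(* The identity sits at frequency zero: once [|j| >= 66], the centre [N j] has norm at least
   [64 + N], and [vanish_ginv] applies. *)
have I : opnorm B * opnorm (aYY (gwin N (N%:Z *: j)) id) <=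
    if (ninf j <= 65)%N then opnorm B * cm else 0.
  case: leqP => far.
    rewrite ler_wpM2l ?opnorm_ge0 // (le_trans (opnorm_gwin modYY _ N_gt0 (@bl_id R Y))) //.
    rewrite ler_piMr ?(ltW c0) //; apply: opnorm_le => // y.
    by rewrite mul1r.
  rewrite (vanish_ginv repYY modYY) ?opnorm_opzero ?mulr0 //.
  - exact: bl_id.
  - exact: inv_idY.
  - rewrite ninfZ (@leq_trans (N * 66)) ?leq_mul2l ?far ?orbT //.
    by rewrite mulnS addnC leq_add2l (leq_trans _ (leq_pmull 65 N_gt0)).
have J : opnorm B * opnorm (cmm j A B) = DB * opnorm (opscale (cm ^+ 2)%:C (cmm j A B)).
  rewrite opnorm_scale // nrm_real ger0_norm; last by apply: exprn_ge0; exact: ltW.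
  rewrite mulrA /DB divfK //.
  by rewrite gt_eqF // exprn_gt0.
apply: (le_trans (beta_le j)); rewrite -addrA lerD // J (le_trans HK) // lerD2l.
have -> : \sum_(m <- boxs d K) e_ m * \sum_(i <- boxs d r) beta (j - vdiv N m + i) =
    E0 * near j + \sum_(m <- boxs d K | (M < ninf m)%N) DB * cm * alpha m * near (j - vdiv N m).
  under eq_bigr do rewrite /e_ mulrDl; rewrite big_split /=; congr (_ + _).
    under eq_bigr do rewrite (fun_if (fun x : R => x * _)) mul0r.
    by rewrite (sum_delta K (fun m => E0 * near (j - vdiv N m))) vdiv0 subr0.
  rewrite [RHS]big_mkcond; apply: eq_bigr => m _; rewrite ltnNge.
  by case: (ninf m <= M)%N; rewrite ?mul0r.
rewrite (bigID (fun m => (ninf m <= M)%N)) /=.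
have S1 : \sum_(m <- boxs d K | (ninf m <= M)%N) (if (ninf m <= M)%N then eps * near j
    else cm * alpha m * (near j + near (j - vdiv N m))) <= (size (boxs d M))%:R * (eps * near j).
  rewrite (eq_bigr (fun=> eps * near j)); last by move=> m ->.
  rewrite big_const_seq iter_addr_0 -[leLHS]mulr_natl ler_wpM2r ?mulr_ge0 ?(ltW eps0) //.
  rewrite ler_nat -size_filter; apply: uniq_leq_size; first by rewrite filter_uniq // uniq_boxs.
  by move=> m; rewrite mem_filter !mem_boxs => /andP[].
have S2 : \sum_(m <- boxs d K | ~~ (ninf m <= M)%N) (if (ninf m <= M)%N then eps * near j
    else cm * alpha m * (near j + near (j - vdiv N m))) <= cm * tau * near j +
    \sum_(m <- boxs d K | (M < ninf m)%N) cm * alpha m * near (j - vdiv N m).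
  rewrite (eq_bigl (fun m => (M < ninf m)%N)); last by move=> m; rewrite -ltnNge.
  rewrite (eq_bigr (fun m => cm * alpha m * near j + cm * alpha m * near (j - vdiv N m))); last first.
    by move=> m; rewrite ltnNge => /negbTE ->; rewrite mulrDr.
  rewrite big_split /= lerD2r -mulr_suml -mulr_sumr ler_wpM2r // ler_wpM2l ?(ltW c0) //.
apply: (le_trans (ler_wpM2l DB0 (lerD S1 S2))).
rewrite le_eqVlt; apply/orP; left; apply/eqP.
rewrite !mulrDr [DB * (\sum_(_ <- _ | _) _)]mulr_sumr addrA; congr (_ + _).
  by rewrite /E0; ring.
by apply: eq_bigr => m _; rewrite !mulrA.
Qed.

Let beta_bound j : beta j <= cm * opnorm B.
Proof. exact: (opnorm_gwin modYX). Qed.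

Let beta_radsum : exists Xb : R, radsum d (rsup beta) Xb.
Proof.
pose es k : R := (if (k <= M)%N then E0 else 0) + DB * cm * u k.
have [um u0 _] := ru.
have Bc : 0 <= opnorm B * cm by rewrite mulr_ge0 ?opnorm_ge0 // ltW.
apply: (@bootstrap d R beta (cm * opnorm B) (fun k => if (k <= 65)%N then opnorm B * cm else 0) _
  e_ es _ eta N r d_gt0 N_gt0 beta0 beta_bound (radsum_finite d 65 Bc)).
- by move=> m; rewrite /e_ addr_ge0 //; case: ifP => // _; rewrite mulr_ge0.
- move=> m; rewrite /e_ /es; apply: lerD.
    by case: eqP => [->|_]; rewrite ?ninf0 //; case: ifP.
  case: ifP => _; first by rewrite mulr_ge0.
  by rewrite ler_wpM2l.
- exact: (radsumD (radsum_finite d M E00) (radsumZ Dc0 ru)).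
- move=> K; rewrite /e_ big_split /= (sum_delta K (fun=> E0)) lerD2l.
  apply: (@le_trans _ _ (DB * cm * \sum_(m <- boxs d K | (M < ninf m)%N) alpha m)); last first.
    by rewrite ler_wpM2l.
  rewrite mulr_sumr [leRHS]big_mkcond; apply: ler_sum => m _; rewrite ltnNge.
  by case: (ninf m <= M)%N.
- exact: eta_small.
- exact: local_ineq.
Qed.

(** Return to unit windows: [cm B] is a limit of weighted sums of the [G_i B], and [phi_n] keeps
    only the boundedly many [i] near [n / N]. The factor [cm] then cancels. *)
Let phi_le (n : Zd) : opnorm (aYX (phi1 n) B) <=
  (size (boxs d r))%:R * rsup beta (ninf n %/ N - r)%N.
Proof.
set x := rsup _ _; have x0 : 0 <= x by exact: (rsup_ge0 d_gt0 beta0 beta_bound).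
have bn := bl_phi1 modYX n bB.
rewrite -(ler_pM2l c0); apply/ler_addgt0Pr => e e0.
have e1 : 0 < e / (cm + 1) by rewrite divr_gt0 // ltr_wpDl // ltW.
have [L HL] := approx_identity repYX modYX repYY modYY inv_idY mYYX bB cB e1.
have LN : (L <= L.+1 * N)%N := leq_trans (leqnSn L) (leq_pmulr L.+1 N_gt0).
have LN0 : (0 < L.+1 * N)%N by rewrite muln_gt0 N_gt0.
have {HL}HL := HL _ LN LN0; set S := aYX _ _ in HL.
have bS : bl S by exact: (bl_gwin modYX).
have bcB : bl (opscale cm%:C B) by exact: bl_scale.
have -> : cm * opnorm (aYX (phi1 n) B) = opnorm (aYX (phi1 n) (opscale cm%:C B)).
  rewrite (act_scale modYX) //; last exact: L1_phi1.
  by rewrite opnorm_scale // nrm_real ger0_norm // ltW.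
have bnS := bl_phi1 modYX n bS.
have -> : aYX (phi1 n) (opscale cm%:C B) =
    opadd (aYX (phi1 n) S) (aYX (phi1 n) (opsub (opscale cm%:C B) S)).
  rewrite (act_subr modYX) //; last exact: L1_phi1.
  by apply/funext => y; rewrite /opadd opsubE addrC subrK.
have bnd := bl_phi1 modYX n (bl_sub bcB bS).
apply: (le_trans (opnorm_add bnS bnd)); apply: lerD; last first.
  rewrite -gwin1 (le_trans (opnorm_gwin modYX n (ltn0Sn 0) (bl_sub bcB bS))) //.
  rewrite opnorm_subC (le_trans (ler_wpM2l (ltW c0) HL)) // mulrCA ler_piMr ?(ltW e0) //.
  by rewrite ler_pdivrMr ?mul1r ?lerDl ?ler01 // ltr_wpDl // ltW.
have -> : S = opsum (boxs d L.+1) (fun l => (wt L.+1 l)%:C) Bp.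
  by rewrite /S (act_gwin_mul modYX) //; congr opsum; apply/funext => m; rewrite add0r.
rewrite (act_sumr modYX) //; last exact: L1_phi1.
have bnB i : bl (aYX (phi1 n) (Bp i)) by exact: (bl_phi1 modYX).
apply: (le_trans (opnorm_sum _ _ bnB)).
apply: (@le_trans _ _ (\sum_(i <- boxs d L.+1 | (ninf (i - vdiv N n) <= r)%N) cm * beta i)).
  rewrite [leRHS]big_mkcond big_seq [leRHS]big_seq; apply: ler_sum => i iL.
  apply: (@le_trans _ _ (opnorm (aYX (phi1 n) (Bp i)))).
    by rewrite ler_piMl ?opnorm_ge0 // nrm_wt.
  rewrite -gwin1; case: leqP => far; first exact: (opnorm_gwin modYX).
  rewrite (vanish_gact repYX modYX) ?opnorm_opzero //.
  exact: far_vdiv.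
rewrite -mulr_sumr ler_wpM2l ?(ltW c0) // (le_trans (sum_near _ _ _ beta0)) //.
rewrite mulr_natl -[X in _ *+ X](count_predT (boxs d r)) -iter_addr_0 -big_const_seq.
rewrite big_seq [leRHS]big_seq; apply: ler_sum => i; rewrite mem_boxs => ir.
apply: (beta_le_rsup d_gt0 beta_bound).
exact: ninf_vdiv_add.
Qed.

Theorem inverse_beurling : (beurling_norm aYX B < +oo)%E.
Proof.
have [Xb rb] := beta_radsum.
exact: radsum_beurling (radsumZ (ler0n _ _) (radsum_div N_gt0 (radsum_shift r rb))) phi_le.
Qed.

End inverse.

Theorem mainTheorem15 (R : realType) (d : nat) (d_gt0 : (0 < d)%N)
  (X Y : completeNormedModType R[i])
  (TXY : 'rV[R]_d -> (X -> Y) -> (X -> Y))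
  (TYX : 'rV[R]_d -> (Y -> X) -> (Y -> X))
  (TXX : 'rV[R]_d -> (X -> X) -> (X -> X))
  (TYY : 'rV[R]_d -> (Y -> Y) -> (Y -> Y))
  (aXY : ('rV[R]_d -> R[i]) -> (X -> Y) -> (X -> Y))
  (aYX : ('rV[R]_d -> R[i]) -> (Y -> X) -> (Y -> X))
  (aXX : ('rV[R]_d -> R[i]) -> (X -> X) -> (X -> X))
  (aYY : ('rV[R]_d -> R[i]) -> (Y -> Y) -> (Y -> Y))
  (repXY : is_isometric_rep TXY) (repYX : is_isometric_rep TYX)
  (repXX : is_isometric_rep TXX) (repYY : is_isometric_rep TYY)
  (modXY : is_L1_module TXY aXY) (modYX : is_L1_module TYX aYX)
  (modXX : is_L1_module TXX aXX) (modYY : is_L1_module TYY aYY)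
  (mXXX : rep_mult TXX TXX TXX) (mXXY : rep_mult TXX TXY TXY)
  (mXYX : rep_mult TXY TYX TXX) (mXYY : rep_mult TXY TYY TXY)
  (mYXX : rep_mult TYX TXX TYX) (mYXY : rep_mult TYX TXY TYY)
  (mYYX : rep_mult TYY TYX TYX) (mYYY : rep_mult TYY TYY TYY)
  (coupled : rep_coupled TXY TYX)
  (A : X -> Y) (B : Y -> X)
  (hA : in_beurling aXY A) (hB : is_bounded_linear B)
  (hAB : mutually_inverse A B) :
  in_beurling aYX B.
Proof.
have [bA bn] := hA; split => //.
have invX := inv_idX mXYX coupled bA hB hAB.
pose al (m : 'rV[int]_d) : R := opnorm (aXY (phi1 m) A).
have al_le m : al m <= fejer_mass ^+ d * opnorm A.
  by rewrite /al -gwin1; exact: (opnorm_gwin modXY).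
have al_u m : al m <= rsup al (ninf m) by exact: (beta_le_rsup d_gt0 al_le).
have [Xu ru] := beurling_radsum modXY bA d_gt0 bn.
have cA := beurling_Tc repXY modXY bA ru al_u repXX modXX invX mXXY.
have cB := Tc_inverse repXY repYX coupled bA hB hAB cA.
have c0 := @cm_gt0 R d; set c := fejer_mass ^+ d in c0.
pose D := opnorm B / c ^+ 2.
have D0 : 0 <= D by rewrite divr_ge0 ?opnorm_ge0 // exprn_ge0 // ltW.
pose s r : R := (size (boxs d r))%:R.
have s0 r : 0 <= s r by exact: ler0n.
(* All constants independent of [M], [eps] and [N] that multiply the small quantities in
   [eta_small]. The [+ 1] in the denominators below guards against [G = 0], for instance when
   [B = 0]. *)
pose G := D * s 67%N * s 2%N; have G0 : 0 <= G by apply: mulr_ge0 => //; exact: mulr_ge0.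
have Gc : 0 < G * c + 1 by rewrite ltr_wpDl //; apply: mulr_ge0 => //; exact: ltW.
pose tau := (8 * (G * c + 1))^-1; have tau0 : 0 < tau by rewrite invr_gt0 mulr_gt0.
have [M HM] := radsum_tail ru tau0.
have GM : 0 < G * s M + 1 by rewrite ltr_wpDl //; exact: mulr_ge0.
pose eps := (4 * (G * s M + 1))^-1; have eps0 : 0 < eps by rewrite invr_gt0 mulr_gt0.
(* A common width for all pieces: [commutator_small] gives one threshold per [m], and the box of
   radius [M] is finite. *)
have [N0 HN] : exists N0, forall N, (N0 <= N)%N -> (0 < N)%N -> forall m, m \in boxs d M ->
    forall n (E : Y -> X), is_bounded_linear E -> T_continuous TYX E ->
      opnorm (comm aYX aYY N n (aXY (phi1 m) A) E) <= eps * opnorm E.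
  elim: (boxs d M) => [|m0 l [N1 H1]]; first by exists 0%N.
  have [N2 H2] := commutator_small repYX repXY repYY modYX modYY mYXY
    (bl_phi1 modXY m0 bA) (Tc_act_L1 repXY modXY (L1_phi1 m0) bA) eps0.
  exists (maxn N1 N2) => N; rewrite geq_max => /andP[NN1 NN2] Np m.
  by rewrite inE => /orP[/eqP ->|ml]; [exact: H2|exact: H1].
pose N := maxn N0 (maxn M 1).
have N_gt0 : (0 < N)%N by rewrite /N !leq_max leqnn !orbT.
have MN : (M <= N)%N by rewrite /N !leq_max leqnn orbT.
apply: (inverse_beurling d_gt0 repXY repYX repXX repYY modXY modYX modXX modYY mXXY mXYX mYXY mYYX
  coupled bA hB hAB cA cB N_gt0 MN eps0 _ ru al_u (ltW tau0)).
- by move=> m mM; apply: HN; rewrite ?leq_maxl // mem_boxs.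
- move=> K; apply: le_trans (HM K); apply: ler_sum => m _; exact: al_u.
- rewrite -/c -/D -/(s M) -/(s 67%N) -/(s 2%N).
  have t1 : G * c * tau <= 8^-1.
    rewrite /tau invfM mulrCA ler_piMr ?invr_ge0 // ler_pdivrMr // mul1r lerDl.
    exact: ler01.
  have t2 : G * s M * eps <= 4^-1.
    rewrite /eps invfM mulrCA ler_piMr ?invr_ge0 // ler_pdivrMr // mul1r lerDl.
    exact: ler01.
  (* The tail enters twice, through [E0] and through the sum of [e_], so the total is at most
     [1/4 + 2 * 1/8 = 1/2]. *)
  rewrite (_ : _ * _ = G * s M * eps + 2 * (G * c * tau)); last by rewrite /G; ring.
  by move: (G * s M * eps) (G * c * tau) t1 t2 => x y; lra.
Qed.
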